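(* Let $1<s<\infty$, $\frac1s+\frac1{s'}=1$, and let $\psi\in\mathfrak{M}''_{\infty}$ be differentiable and such that $\frac{\psi(t)}{|\psi'(t)|}$ increases monotonically to $\infty$ as $t\to\infty$. Then for every $\beta\in\mathbb{R}$, $$e^{\bot}_{2n-1}(L^{\psi}_{\beta,1})_{s}\asymp e^{\bot}_{2n}(L^{\psi}_{\beta,1})_{s}\asymp \psi(n)\,(\eta(n)-n)^{1/s'},\qquad n\in\mathbb{N}.$$
   Context: $L_p$ ($1\le p<\infty$) is the space of $2\pi$-periodic functions with $\|f\|_p=(\int_0^{2\pi}|f|^p)^{1/p}<\infty$; $L_\infty$ is the space of essentially bounded $2\pi$-periodic measurable functions with the ess sup norm. For $f\in L_1$, $\hat f(k)=\frac{1}{2\pi}\int_{-\pi}^{\pi}f(t)e^{-ikt}dt$. Given a sequence $\psi(k)$ and $\beta\in\mathbb{R}$, if $\sum_{k\in\mathbb{Z}\setminus\{0\}}\frac{\hat f(k)}{\psi(|k|)}e^{i(kx+\frac{\beta\pi}{2}\mathrm{sign}\,k)}$ is the Fourier series of some $\varphi\in L_1$, then $\varphi=:f^{\psi}_{\beta}$ is the $(\psi,\beta)$-derivative of $f$. Let $B^0_p=\{\varphi\in L_p:\|\varphi\|_p\le1,\ \int_{-\pi}^{\pi}\varphi=0\}$; the class $L^{\psi}_{\beta,p}$ is the set of $f$ whose $(\psi,\beta)$-derivative exists and belongs to $B^0_p$. $\mathfrak{M}$ is the set of convex (downward), continuous functions $\psi(t)$, $t\ge1$, with $\psi(t)\to0$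 as $t\to\infty$; the sequence $\psi(k)$ defining the class is the restriction of $\psi\in\mathfrak{M}$ to $\mathbb{N}$. For $\psi\in\mathfrak{M}$, $\eta(t)=\eta(\psi;t)=\psi^{-1}(\psi(t)/2)$ and $\mu(t)=\mu(\psi;t)=\frac{t}{\eta(t)-t}$. $\mathfrak{M}^+_\infty=\{\psi\in\mathfrak{M}:\mu(\psi;t)\text{ increases monotonically to }\infty\}$, and $\mathfrak{M}''_\infty=\{\psi\in\mathfrak{M}^+_\infty:\exists K>0\text{ with }\eta(\psi;t)-t\ge K\ \forall t\ge1\}$. For $f\in L_1$, $1\le s\le\infty$, $m\in\mathbb{N}$: $e^{\bot}_m(f)_s=\inf_{\gamma_m}\|f-\sum_{k\in\gamma_m}\hat f(k)e^{ik\cdot}\|_s$, the infimum over all sets $\gamma_m$ of $m$ integers, and $e^{\bot}_m(L^{\psi}_{\beta,p})_s=\sup_{f\in L^{\psi}_{\beta,p}}e^{\bot}_m(f)_s$. $a_n\asymp b_n$ means $C_1a_n\le b_n\le C_2a_n$ for all $n$ with positive constants $C_1,C_2$ independent of $n$. *)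

(* Defs.v *)
From HB Require Import structures.
From mathcomp Require Import all_boot all_order all_algebra.
From mathcomp Require Import all_classical all_reals all_analysis.
Set Implicit Arguments. Unset Strict Implicit. Unset Printing Implicit Defensive.
Import Order.TTheory GRing.Theory Num.Theory.
Import numFieldNormedType.Exports.
Local Open Scope classical_set_scope.
Local Open Scope ring_scope.

Section Defs.
Variable R : realType.
Local Notation mu := (@lebesgue_measure R).

Definition I02pi : set R := `[0, 2 * pi].
Definition Ipi : set R := `[- pi, pi].

Definition periodic2pi (f : R -> R) := forall x, f (x + 2 * pi) = f x.

Definition pnorm (s : R) (g : R -> R) : \bar R :=
  poweR (\int[mu]_(x in I02pi) (`|g x| `^ s)%:E) s^-1.

Definition inL1 (f : R -> R) :=
  [/\ periodic2pi f, measurable_fun setT f &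
      (\int[mu]_(x in I02pi) (`|f x|)%:E < +oo)%E].

(* Fourier coefficient hat f(k) = 1/(2pi) int_{-pi}^{pi} f(t) e^{-ikt} dt,
   given by its real and imaginary parts *)
Definition fre (f : R -> R) (k : int) : R :=
  (2 * pi)^-1 * Rintegral mu Ipi (fun t => f t * cos (k%:~R * t)).
Definition fim (f : R -> R) (k : int) : R :=
  - ((2 * pi)^-1 * Rintegral mu Ipi (fun t => f t * sin (k%:~R * t))).

(* phi is the (psi,beta)-derivative of f: for k <> 0,
   hat phi(k) = hat f(k) e^{i beta pi/2 sign k} / psi(|k|)
   (complex multiplication written out in real and imaginary parts) *)
Definition is_psi_beta_deriv (psi : R -> R) (beta : R) (f phi : R -> R) :=
  inL1 phi /\
  forall k : int, k != 0 ->
    let th := beta * pi / 2 * (Num.sg k)%:~R in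
    let c := psi (`|k|%:~R) in
    fre phi k = (fre f k * cos th - fim f k * sin th) / c /\
    fim phi k = (fre f k * sin th + fim f k * cos th) / c.

Definition Lclass1 (psi : R -> R) (beta : R) : set (R -> R) :=
  [set f | inL1 f /\ exists phi, is_psi_beta_deriv psi beta f phi /\
     (\int[mu]_(x in I02pi) (`|phi x|)%:E <= 1)%E /\
     (\int[mu]_(x in Ipi) (phi x)%:E = 0)%E].

(* modulus of f(x) - sum_{k in g} hat f(k) e^{ikx} *)
Definition approx_err (f : R -> R) (g : seq int) (x : R) : R :=
  Num.sqrt ((f x - \sum_(k <- g) (fre f k * cos (k%:~R * x)
                                   - fim f k * sin (k%:~R * x))) ^+ 2
            + (\sum_(k <- g) (fre f k * sin (k%:~R * x)
                                + fim f k * cos (k%:~R * x))) ^+ 2).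

Definition eperp_f (m : nat) (s : R) (f : R -> R) : \bar R :=
  ereal_inf [set pnorm s (approx_err f g) | g in
               [set g : seq int | uniq g /\ size g = m]].

Definition eperp_class (m : nat) (s : R) (psi : R -> R) (beta : R) : \bar R :=
  ereal_sup [set eperp_f m s f | f in Lclass1 psi beta].

Definition classM (psi : R -> R) :=
  [/\ (forall t, 1 <= t -> 0 < psi t),
      (forall x y l, 1 <= x -> 1 <= y -> 0 <= l <= 1 ->
         psi (l * x + (1 - l) * y) <= l * psi x + (1 - l) * psi y),
      {within `[1, +oo[, continuous psi} &
      psi t @[t --> +oo] --> 0].

Definition psi_inv (psi : R -> R) (y : R) : R :=
  xget 1 [set u | 1 <= u /\ psi u = y].

Definition eta_psi (psi : R -> R) (t : R) : R := psi_inv psi (psi t / 2).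
Definition mu_fun (psi : R -> R) (t : R) : R := t / (eta_psi psi t - t).

Definition classMplus (psi : R -> R) :=
  classM psi /\
  {in `[1, +oo[ &, {homo mu_fun psi : x y / x <= y}} /\
  mu_fun psi t @[t --> +oo] --> +oo.

Definition classM2 (psi : R -> R) :=
  classMplus psi /\ exists K : R, 0 < K /\ forall t, 1 <= t -> K <= eta_psi psi t - t.

End Defs.

(* Main.v *)
(* Upper bound: since mu(t) = t / (eta(t) - t) increases to infinity, eventually the
   intervals [t, eta(t)] grow by a factor at most 3/2 from one to the next while psi
   halves, so the tail sum_(k >= n) psi(k) is O(psi(n) (eta(n) - n)).  The Fourier
   series of a class member f thus converges absolutely, to f almost everywhere, and its
   remainder is the convolution of phi, |phi|_1 <= 1, with a cosine sum P with
   coefficients psi(k), k >= n.  By Abel summation |sin(y/2) P(y)| <= psi(n), which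
   together with |P| = O(psi(n) (eta(n) - n)) bounds |P|_s, and Young and Fatou carry
   the bound over to the remainder.  One more harmonic costs O(psi(n)), which is
   admissible because eta(n) - n >= K.

   Lower bound: let f be the class member whose derivative is a multiple of the Fejer
   kernel of order 2M without its mean, where M >= eta(n) and M = eta(n) + O(1).  Pair
   the residual of f, after removal of any 2n harmonics, with the cosine sum G having
   the increasing weights psi(n) / psi(k), k <= M.  Each surviving frequency with
   |k| <= M contributes at least a constant times psi(n), so the pairing is at least a
   constant times psi(n) (M - n).  Monotonicity of psi / |psi'| makes ln psi convex, so
   that psi(n) / psi(k) decays geometrically below n on the scale eta(n) - n: the weights
   are bounded with sum O(eta(n) - n).  Abel summation then bounds |G|_s', and Hoelder's
   inequality concludes. *)
Require Import Defs.
From HB Require Import structures.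
From mathcomp Require Import all_boot all_order all_algebra.
From mathcomp Require Import all_classical all_reals all_analysis.
From mathcomp Require Import measurable_realfun.
From mathcomp Require Import ring lra.
Import Order.TTheory GRing.Theory Num.Theory.
Import numFieldNormedType.Exports.
Local Open Scope classical_set_scope.
Local Open Scope ring_scope.

Set Implicit Arguments.
Unset Strict Implicit.

(** The rate comes from one profile. A kernel bounded by A everywhere and by B / |sin(y/2)| has size
    A on an arc of length about B / A and decays like B / |y| outside it, so for p > 1 the integral
    of its p-th power is of order A^(p-1) B. With nu = eta(n) - n, the pair (A, B) is (psi(n) nu,
    psi(n)) in the upper bound, which gives the norm psi(n) nu^(1/s'). It is (nu, 1) in the lower
    bound, where a pairing of size psi(n) nu is divided by the dual norm nu^(1/s).

    The weights 1 / psi(k) of the lower bound cancel the multiplier psi(k) of the test function, so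
    all frequencies contribute comparably: it matters how many are removed, not which.

    A member of the class is only known to lie in L_1, so its agreement with its Fourier series
    rests on a uniqueness theorem for Fourier coefficients, derived from Fejer means of indicators
    of intervals and Lebesgue differentiation. *)

(** * Decay of psi, and sums of psi and of its inverse *)

Section ClassM.
Variables (R : realType) (psi : R -> R).
Hypothesis psiM : classM psi.

Lemma classM_gt0 t : 1 <= t -> 0 < psi t.
Proof. by case: psiM => + _ _ _; apply. Qed.

Lemma classM_small e : 0 < e -> \forall t \near +oo, psi t < e.
Proof.
case: psiM => _ _ _ lim0 e0.
have /cvgrPdist_lt /(_ e e0) := lim0.
apply: filterS => t; rewrite sub0r normrN; exact: le_lt_trans (ler_norm _).
Qed.

(** Convexity and the limit 0 together: if psi x <= psi y, some z > y has psi z < psi y, and the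
    chord from x to z passes strictly below the value at y. *)
Lemma classM_decr x y : 1 <= x -> x < y -> psi y < psi x.
Proof.
case: psiM => pos conv _ _ x1 xy.
rewrite ltNge; apply/negP => le_xy.
have y1 : 1 <= y by rewrite (le_trans x1) // ltW.
have [z [yz psiz]] : exists z, y < z /\ psi z < psi y.
  have /(_ _) := filterI (nbhs_pinfty_gt (num_real y)) (classM_small (pos _ y1)).
  by move=> /filter_ex [z [? ?]]; exists z.
have z1 : 1 <= z by rewrite (le_trans y1) // ltW.
pose l := (z - y) / (z - x).
have zx : 0 < z - x by rewrite subr_gt0 (lt_trans xy).
have /andP[l0 l1] : 0 <= l < 1.
  apply/andP; split; first by rewrite divr_ge0 // ?(ltW zx) // subr_ge0 ltW.
  by rewrite ltr_pdivrMr // mul1r; lra.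
have El : l * x + (1 - l) * z = y.
  rewrite /l; field; exact: lt0r_neq0.
have := conv x z l x1 z1; rewrite El => /(_ _)H.
have {H} : psi y <= l * psi x + (1 - l) * psi z by apply: H; lra.
have : l * psi x <= l * psi y by apply: ler_wpM2l => //; lra.
have : (1 - l) * psi z < (1 - l) * psi y by rewrite ltr_pM2l //; lra.
lra.
Qed.

Lemma classM_decrw x y : 1 <= x -> x <= y -> psi y <= psi x.
Proof. by move=> x1; rewrite le_eqVlt => /predU1P[->//|/(classM_decr x1)/ltW]. Qed.

(** [psi_inv] chooses a preimage with default 1. The intermediate value theorem exhibits a preimage
    in the domain, so the default never stands in for one, and monotonicity places it beyond t. *)
Lemma eta_psi_spec t : 1 <= t -> t < eta_psi psi t /\ psi (eta_psi psi t) = psi t / 2.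
Proof.
move=> t1; have pt := classM_gt0 t1.
have [T [tT psiT]] : exists T, t < T /\ psi T < psi t / 2.
  have e0 : 0 < psi t / 2 by rewrite divr_gt0.
  have /(_ _) := filterI (nbhs_pinfty_gt (num_real t)) (classM_small e0).
  by move=> /filter_ex [z [? ?]]; exists z.
have cont : {within `[t, T], continuous psi}.
  case: psiM => _ _ ct _; apply: continuous_subspaceW ct.
  by move=> x /=; rewrite !in_itv/= => /andP[tx _]; rewrite (le_trans t1).
have [|u ut pu] := IVT (v := psi t / 2) (ltW tT) cont.
  have h : psi t / 2 <= psi t by lra.
  by rewrite ge_min le_max h (ltW psiT) orbT.
have : [set u | 1 <= u /\ psi u = psi t / 2] !=set0.
  exists u; split=> //; move: ut; rewrite in_itv/= => /andP[+ _]; exact: le_trans.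
rewrite /eta_psi /psi_inv => /(xgetPex 1) [].
set e := xget _ _ => e1 pe; split=> //.
rewrite ltNge; apply/negP => /(classM_decrw e1); rewrite pe.
by apply/negP; rewrite -ltNge; lra.
Qed.

Hypothesis dpsi : forall t, 1 < t -> derivable psi t 1.
Hypothesis mono :
  {in `]1, +oo[ &, {homo (fun t => psi t / `|derive1 psi t|) : x y / x <= y}}.

(** Mean value theorem for ln psi. The nonvanishing of the derivative is recorded because psi /
    |psi'| is inverted afterwards, and division by 0 would give 0. *)
Lemma classM_slope a b : 1 <= a -> a < b ->
  exists2 c, a < c < b &
    ln (psi a) - ln (psi b) = `|derive1 psi c| / psi c * (b - a) /\ derive1 psi c != 0.
Proof.
move=> a1 ab.
have [||c] := @MVT _ (fun x => ln (psi x)) (fun x => derive1 psi x / psi x) a b ab.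
- move=> x; rewrite in_itv/= => /andP[ax _].
  have x1 : 1 < x by apply: le_lt_trans ax.
  have px := classM_gt0 (ltW x1).
  have dx : is_derive x 1 psi (derive1 psi x).
    by rewrite derive1E; apply: DeriveDef => //; exact: dpsi.
  have := @is_derive1_comp _ (@ln R) psi x _ _ (is_derive1_ln px) dx.
  by rewrite mulrC.
- apply: within_continuous_comp.
    move=> y /set_mem[x /=]; rewrite in_itv/= => /andP[ax _] <-.
    by apply: continuous_ln; apply: classM_gt0; exact: le_trans ax.
  case: psiM => _ _ ct _; apply: continuous_subspaceW ct.
  by move=> x /=; rewrite !in_itv/= => /andP[tx _]; rewrite (le_trans a1).
rewrite in_itv/= => acb E; exists c => //.
have {acb} /andP[ac cb] := acb.
have c1 : 1 < c by apply: le_lt_trans ac.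
have pc := classM_gt0 (ltW c1).
have ba : 0 < b - a by rewrite subr_gt0.
have lnab : ln (psi b) < ln (psi a).
  rewrite ltr_ln ?posrE ?classM_gt0 //; first exact: classM_decr.
  by rewrite (le_trans a1) // ltW.
have : derive1 psi c / psi c < 0.
  by rewrite -(pmulr_llt0 _ ba) -E subr_lt0.
rewrite pmulr_llt0 ?invr_gt0 // => d0.
by split; [rewrite ltr0_norm // -opprB E; ring|rewrite lt_eqF].
Qed.

(** Since |psi'| / psi does not increase, the mean slope of - ln psi on [a, b] is at least that on
    [b, c]; the comparison is cleared of denominators. *)
Lemma classM_log_convex a b c : 1 <= a -> a < b -> b < c ->
  (ln (psi b) - ln (psi c)) * (b - a) <= (ln (psi a) - ln (psi b)) * (c - b).
Proof.
move=> a1 ab bc.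
have [x /andP[ax xb] [-> dx]] := classM_slope a1 ab.
have b1 : 1 <= b by rewrite (le_trans a1) // ltW.
have [y /andP[by' yc] [-> dy]] := classM_slope b1 bc.
have xy : x <= y by rewrite ltW // (lt_trans xb).
have x1 : 1 < x by apply: le_lt_trans ax.
have y1 : 1 < y by apply: le_lt_trans by'.
have := @mono x y; rewrite !in_itv/= !andbT => /(_ x1 y1 xy) /=.
have px := classM_gt0 (ltW x1); have py := classM_gt0 (ltW y1).
rewrite -[psi x / _]invf_div -[psi y / _]invf_div lef_pV2 ?posrE ?divr_gt0 ?normr_gt0 //.
move=> H; rewrite -!mulrA [(c - b) * _]mulrC mulrA [leRHS]mulrA ler_wpM2r //.
by rewrite mulr_ge0 // subr_ge0 ltW.
Qed.

Variable K : R.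
Hypothesis K0 : 0 < K.
Hypothesis HK : forall t, 1 <= t -> K <= eta_psi psi t - t.

Lemma ln_psi_eta t : 1 <= t -> ln (psi t) - ln (psi (eta_psi psi t)) = ln 2.
Proof.
move=> t1; have [_ ->] := eta_psi_spec t1; have pt := classM_gt0 t1.
by rewrite ln_div ?posrE //; ring.
Qed.

(** Below n, - ln psi is at least as steep as on [n, eta(n)], where it rises by ln 2. *)
Lemma decay_below n k : 1 <= k -> k <= n ->
  psi n / psi k <= expR (- (ln 2 / (eta_psi psi n - n)) * (n - k)).
Proof.
move=> k1 kn.
have n1 : 1 <= n by rewrite (le_trans k1).
have pn := classM_gt0 n1; have pk := classM_gt0 k1.
have [ne pe] := eta_psi_spec n1.
have nu0 : 0 < eta_psi psi n - n by rewrite subr_gt0.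
move: kn; rewrite le_eqVlt => /predU1P[<-|kn].
  by rewrite subrr mulr0 expR0 divff // lt0r_neq0.
have := classM_log_convex k1 kn ne.
rewrite ln_psi_eta // => H.
rewrite -[leLHS]lnK ?posrE ?divr_gt0 // ler_expR ln_div ?posrE //.
rewrite mulNr lerNr opprB mulrAC ler_pdivrMr //.
Qed.

(** Past eta(n), - ln psi is at most as steep as on [n, eta(n)], so the ratio at most doubles over
    each length eta(n) - n. *)
Lemma decay_above n M : 1 <= n -> eta_psi psi n <= M ->
  psi n / psi M <= expR (ln 2 * ((M - n) / (eta_psi psi n - n))).
Proof.
move=> n1 eM.
have [ne pe] := eta_psi_spec n1.
have nu0 : 0 < eta_psi psi n - n by rewrite subr_gt0.
have nM : n <= M by rewrite (le_trans (ltW ne)).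
have e1 : 1 <= eta_psi psi n by rewrite (le_trans n1) // ltW.
have M1 := le_trans n1 nM.
have pn := classM_gt0 n1; have pM := classM_gt0 M1.
have L2 := ln_psi_eta n1.
move: eM; rewrite le_eqVlt => /predU1P[eM|eM].
  rewrite -eM divff ?lt0r_neq0 // mulr1 lnK ?posrE // pe.
  have -> : psi n / (psi n / 2) = 2 by field; rewrite lt0r_neq0.
  exact: lexx.
have := classM_log_convex n1 ne eM; rewrite L2 => H.
rewrite -[leLHS]lnK ?posrE ?divr_gt0 // ler_expR ln_div ?posrE // mulrA ler_pdivlMr //.
move: L2 H; set x := ln (psi n); set y := ln (psi M); set z := ln (psi _); set e := eta_psi _ _.
move=> Hx H.
have -> : (x - y) * (e - n) = (z - y) * (e - n) + ln 2 * (e - n) by rewrite -Hx; ring.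
lra.
Qed.

Lemma geometric_le (q : R) n : 0 <= q < 1 -> \sum_(i < n) q ^+ i <= (1 - q)^-1.
Proof.
move=> /andP[q0 q1]; rewrite -[leRHS]mul1r ler_pdivlMr ?subr_gt0 //.
rewrite mulrC -opprB mulNr -subrX1 opprB gerBl //; exact: exprn_ge0.
Qed.

Lemma geometric_expR_le (x : R) n : 0 < x ->
  \sum_(i < n) expR (- x * i%:R) <= 1 + x^-1.
Proof.
move=> x0; have e1 : expR (- x) < 1 by rewrite expR_lt1 oppr_lt0.
have -> : \sum_(i < n) expR (- x * i%:R) = \sum_(i < n) expR (- x) ^+ i.
  by apply: eq_bigr => i _; rewrite mulrC expRM_natl.
apply: le_trans (geometric_le _ _) _; first by rewrite expR_ge0.
(* exp x >= 1 + x gives 1 - exp(-x) >= x / (1 + x), whose inverse is 1 + 1 / x. *)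
have h := expR_ge1Dx x.
have -> : 1 + x^-1 = ((x / (1 + x)))^-1 by field; rewrite !lt0r_neq0 // addr_gt0.
rewrite lef_pV2 ?posrE ?subr_gt0 ?divr_gt0 ?addr_gt0 //.
have -> : x / (1 + x) = 1 - (1 + x)^-1 by field; rewrite lt0r_neq0 // addr_gt0.
by rewrite lerD2l lerN2 expRN lef_pV2 ?posrE ?expR_gt0 ?addr_gt0.
Qed.

(** These are the weights of the dual kernel. Up to n they form a geometric sum on the scale nu =
    eta(n) - n; the other M - n <= nu + 1 of them are each bounded. The lower bound nu >= K absorbs
    additive constants into multiples of nu. *)
Lemma weight_bounds : exists2 C : R, 0 < C & forall n : nat, (0 < n)%N ->
  exists M : nat,
  [/\ n%:R + (eta_psi psi n%:R - n%:R) <= M%:R,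
     forall i : nat, (i < M)%N -> psi n%:R / psi i.+1%:R <= C &
     \sum_(i < M) psi n%:R / psi i.+1%:R <= C * (eta_psi psi n%:R - n%:R)].
Proof.
(* This is 2^((nu + 1) / nu) with nu replaced by its lower bound K. *)
pose W := expR (ln 2 * (1 + K^-1)).
have W0 : 0 < W by exact: expR_gt0.
have l2 : 0 < ln 2 :> R by rewrite ln_gt0 // ltr1n.
(* W serves the pointwise bound; the bracket serves the sum, which is at most 1 + nu / ln 2 + W (nu
   + 1), where 1 <= nu / K. *)
pose C := W + (K^-1 + (ln 2)^-1 + W * (1 + K^-1)).
have WC : W <= C.
  by rewrite lerDl !addr_ge0 ?mulr_ge0 ?addr_ge0 ?invr_ge0 // ltW.
exists C; first exact: lt_le_trans WC.
move=> n n0.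
have n1 : 1 <= n%:R :> R by rewrite ler1n.
set nu := eta_psi psi n%:R - n%:R.
have Knu : K <= nu by exact: HK.
have nu0 : 0 < nu by apply: lt_le_trans Knu.
have pn := classM_gt0 n1.
pose c := `|Num.ceil nu|%N.
have cE : c%:R = (Num.ceil nu)%:~R :> R.
  by rewrite /c natr_absz ger0_norm // ceil_ge0 (lt_trans _ nu0) // ltrN10.
have c1 : nu <= c%:R by rewrite cE ceil_ge.
have c2 : c%:R <= nu + 1 by have := ceilB1_lt nu; rewrite intrB -cE; lra.
pose M := (n + c)%N.
have nM : eta_psi psi n%:R <= M%:R by rewrite natrD -lerBlDl.
have wW i : (i < M)%N -> psi n%:R / psi i.+1%:R <= W.
  move=> iM.
  have i1 : 1 <= i.+1%:R :> R by rewrite ler1n.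
  apply: (@le_trans _ _ (psi n%:R / psi M%:R)).
    rewrite ler_pM2l // lef_pV2 ?posrE ?classM_gt0 //; last first.
      by rewrite ler1n ltn_addr.
    by apply: classM_decrw => //; rewrite ler_nat.
  apply: le_trans (decay_above n1 nM) _; rewrite ler_expR ler_pM2l //.
  rewrite natrD addrAC subrr add0r ler_pdivrMr // mulrDl mul1r (le_trans c2) // lerD2l.
  by rewrite ler_pdivlMl // mulr1.
exists M; split.
- by rewrite natrD lerD2l.
- by move=> i /wW/le_trans; apply.
rewrite big_split_ord /=.
have H1 : \sum_(i < n) psi n%:R / psi i.+1%:R <= 1 + (ln 2 / nu)^-1.
  apply: le_trans (geometric_expR_le n _); last by rewrite divr_gt0.
  rewrite [leRHS](reindex_inj rev_ord_inj) /=; apply: ler_sum => i _.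
  rewrite natrB //; apply: decay_below; first by rewrite ler1n.
  by rewrite ler_nat.
have H2 : \sum_(i < c) psi n%:R / psi (n + i).+1%:R <= W * (nu + 1).
  apply: (@le_trans _ _ (\sum_(i < c) W)).
    by apply: ler_sum => i _; apply: wW; rewrite ltn_add2l.
  by rewrite sumr_const card_ord -mulr_natr ler_pM2l.
apply: le_trans (lerD H1 H2) _.
have k1 : 1 <= K^-1 * nu by rewrite ler_pdivlMl // mulr1.
have W1 : W * 1 <= W * (K^-1 * nu) by rewrite ler_pM2l.
rewrite invf_div /C.
have -> : (W + (K^-1 + (ln 2)^-1 + W * (1 + K^-1))) * nu =
  W * nu + K^-1 * nu + nu / ln 2 + W * nu + W * (K^-1 * nu) by field; rewrite !lt0r_neq0.
have : 0 < W * nu by exact: mulr_gt0.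
lra.
Qed.

Hypothesis hmu : {in `[1, +oo[ &, {homo mu_fun psi : x y / x <= y}}.
Hypothesis muy : mu_fun psi t @[t --> +oo] --> +oo.

Lemma count_interval (t u : R) N : t <= u ->
  \sum_(k < N | t <= k%:R < u) 1 <= u - t + 1 :> R.
Proof.
move=> tu.
(* Strengthened for the induction on N: each counted k is paid for by a unit increase of min N (u +
   1). *)
have H : \sum_(k < N | t <= k%:R < u) 1 <= Num.max 0 (Num.min N%:R (u + 1) - t) :> R.
  elim: N => [|N IH]; first by rewrite big_ord0 le_max lexx.
  rewrite big_mkcond big_ord_recr /= -big_mkcond /=.
  move: IH; rewrite -(natr1 N); set S := \sum_(i < N | _) _; set x : R := N%:R.
  rewrite !le_max !lerBrDr !le_min; case: ifPn => [/andP[tx xu]|_].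
    by move=> /orP[?|/andP[? ?]]; apply/orP; right; apply/andP; split; lra.
  rewrite addr0 => /orP[->//|/andP[h1 h2]]; apply/orP; right; apply/andP; split; lra.
apply: le_trans H _; rewrite ge_max; apply/andP; split; first by lra.
have : Num.min N%:R (u + 1) <= u + 1 by rewrite ge_min lexx orbT.
lra.
Qed.

(** The induction walks from t to eta(t), at least K further, until N is passed; m bounds the number
    of steps. With D = eta(t) - t the bound 4 psi(t) (D + 1/2) reproduces itself: [t, eta(t)) costs
    psi(t) (D + 1), and at eta(t) psi is halved while D grows by at most 3/2, so the total is at
    most psi(t) (4 D + 2). *)
Lemma tail_step t0 : 1 <= t0 -> (forall t, t0 <= t -> 2 <= mu_fun psi t) ->
  forall m t N, t0 <= t -> N%:R <= t + m%:R * K ->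
  \sum_(k < N | t <= k%:R) psi k%:R <= 4 * psi t * (eta_psi psi t - t + 2^-1).
Proof.
move=> t01 mu2; elim=> [|m IH] t N t0t Nt; have t1 := le_trans t01 t0t;
  have pt := classM_gt0 t1; have [te pe] := eta_psi_spec t1;
  have nu0 : 0 < eta_psi psi t - t by rewrite subr_gt0.
  rewrite big_pred0; first by apply: mulr_ge0; lra.
  move=> k; apply/negbTE; rewrite -ltNge; move: Nt; rewrite mul0r addr0.
  by apply: lt_le_trans; rewrite ltr_nat.
have e1 : 1 <= eta_psi psi t by rewrite (le_trans t1) // ltW.
have Nt' : N%:R <= eta_psi psi t + m%:R * K.
  by apply: le_trans Nt _; rewrite -natr1 mulrDl mul1r; have := HK t1; lra.
have {IH} S2 := IH (eta_psi psi t) N (le_trans t0t (ltW te)) Nt'.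
rewrite [leLHS](bigID (fun k : 'I_N => k%:R < eta_psi psi t)) /=.
(* mu(t) <= mu(eta(t)) reads D2 <= D (1 + D / t), and mu(t) >= 2 means D / t <= 1/2. *)
have D' : eta_psi psi (eta_psi psi t) - eta_psi psi t <= 3 / 2 * (eta_psi psi t - t).
  have := @hmu t (eta_psi psi t); rewrite !in_itv/= !andbT => /(_ t1 e1 (ltW te)).
  have := mu2 _ t0t; rewrite /mu_fun.
  have [ee _] := eta_psi_spec e1; move: ee nu0; rewrite -subr_gt0.
  set D2 := eta_psi psi (eta_psi psi t) - _ => D20; set D := eta_psi psi t - t => D0.
  rewrite ler_pdivlMr // ler_pdivrMr // mulrAC ler_pdivlMr //.
  have -> : eta_psi psi t = t + D by rewrite /D; ring.
  have t00 : 0 < t by rewrite (lt_le_trans ltr01).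
  move=> h1 h2; rewrite -(ler_pM2l t00) (le_trans h2) //.
  have -> : t * (3 / 2 * D) = (t + t / 2) * D by field.
  by rewrite ler_pM2r //; lra.
have S1 : \sum_(k < N | (t <= k%:R) && (k%:R < eta_psi psi t)) psi k%:R <=
    psi t * (eta_psi psi t - t + 1).
  apply: (@le_trans _ _ (\sum_(k < N | (t <= k%:R < eta_psi psi t)) psi t * 1)).
    by apply: ler_sum => k /andP[tk _]; rewrite mulr1; exact: classM_decrw.
  by rewrite -mulr_sumr ler_pM2l // count_interval // ltW.
have -> : \sum_(k < N | (t <= k%:R) && ~~ (k%:R < eta_psi psi t)) psi k%:R =
    \sum_(k < N | eta_psi psi t <= k%:R) psi k%:R.
  apply: eq_bigl => k; rewrite -leNgt.
  by apply/andP/idP => [[]//|ek]; split=> //; rewrite (le_trans (ltW te)).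
apply: le_trans (lerD S1 S2) _; rewrite pe.
set D2 := eta_psi psi (eta_psi psi t) - _ in D' *.
set D := eta_psi psi t - t in D' *.
have -> : 4 * (psi t / 2) * (D2 + 2^-1) = psi t * (2 * D2 + 1) by field.
have -> : 4 * psi t * (D + 2^-1) = psi t * (4 * D + 2) by field.
by rewrite -mulrDr ler_pM2l //; lra.
Qed.

Lemma tail_sum_bound : exists2 C : R, 0 < C & forall n N : nat, (0 < n)%N ->
  \sum_(i < N) psi (n + i)%:R <= C * (psi n%:R * (eta_psi psi n%:R - n%:R)).
Proof.
have [t0 [t01 mu2]] : exists t0, 1 <= t0 /\ forall t, t0 <= t -> 2 <= mu_fun psi t.
  have /cvgryPge /(_ 2) [A [_ HA]] := muy.
  exists (Num.max 1 (A + 1)); split; first by rewrite le_max lexx.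
  by move=> t; rewrite ge_max => /andP[_ tA]; apply: HA; lra.
have tail t N : t0 <= t ->
    \sum_(k < N | t <= k%:R) psi k%:R <= 4 * psi t * (eta_psi psi t - t + 2^-1).
  move=> t0t; apply: (@tail_step t0 t01 mu2 (Num.truncn (N%:R / K)).+1) => //.
  have := truncnS_gt (N%:R / K).
  rewrite ltr_pdivrMr // => /ltW/le_trans; apply; rewrite lerDr; lra.
(* For n < t0 this constant bounds the whole sum, while psi(n) (eta(n) - n) is at least psi(t0) K;
   the final constant adds up the two regimes. *)
pose S0 := psi 1 * (t0 - 1 + 1) + 4 * psi t0 * (eta_psi psi t0 - t0 + 2^-1).
have pt0 := classM_gt0 t01.
have p1 := classM_gt0 (lexx 1).
have nu00 : 0 < eta_psi psi t0 - t0 by apply: lt_le_trans K0 (HK _).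
have S00 : 0 < S0.
  have t00 : 0 < t0 by lra.
  by rewrite /S0 subrK; apply: addr_gt0; [exact: mulr_gt0|apply: mulr_gt0; lra].
exists (4 * (1 + (2 * K)^-1) + S0 / (psi t0 * K)).
  have h1 : 0 < (2 * K)^-1 by rewrite invr_gt0 mulr_gt0.
  have h2 : 0 < S0 / (psi t0 * K) by rewrite divr_gt0 // mulr_gt0.
  by apply: addr_gt0 => //; lra.
move=> n N n0.
have n1 : 1 <= n%:R :> R by rewrite ler1n.
have -> : \sum_(i < N) psi (n + i)%:R = \sum_(k < n + N | n%:R <= k%:R :> R) psi k%:R.
  rewrite [RHS]big_split_ord /= [X in _ = X + _]big_pred0 => [|i]; last first.
    by rewrite ler_nat leqNgt ltn_ord.
  by rewrite add0r; apply: eq_bigl => i; rewrite ler_nat leq_addr.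
set nu := eta_psi psi n%:R - n%:R.
have Knu : K <= nu by exact: HK.
have nu0 : 0 < nu by apply: lt_le_trans Knu.
have pn := classM_gt0 n1.
have pnu : 0 < psi n%:R * nu by exact: mulr_gt0.
have [tn|nt] := leP t0 n%:R.
  apply: le_trans (tail _ _ tn) _; rewrite -/nu.
  apply: (@le_trans _ _ (4 * (1 + (2 * K)^-1) * (psi n%:R * nu))); last first.
    by rewrite ler_pM2r // lerDl divr_ge0 ?mulr_ge0 // ltW.
  have -> : 4 * (1 + (2 * K)^-1) * (psi n%:R * nu) = 4 * psi n%:R * (nu + 2^-1 * (nu / K)).
    by field; rewrite lt0r_neq0.
  by rewrite ler_pM2l ?mulr_gt0 // lerD2l ler_peMr // ler_pdivlMr // mul1r.
have H : \sum_(k < n + N | n%:R <= k%:R :> R) psi k%:R <= S0.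
  rewrite (bigID (fun k : 'I__ => k%:R < t0)) /= lerD //.
    apply: (@le_trans _ _ (\sum_(k < n + N | 1 <= k%:R < t0) psi 1 * 1)); last first.
      by rewrite -mulr_sumr ler_pM2l //; apply: count_interval; exact: t01.
    rewrite [leLHS]big_mkcond [leRHS]big_mkcond; apply: ler_sum => k _.
    case: ifPn => [/andP[nk ->]|_]; last by case: ifP => // _; rewrite mulr1 ltW.
    by rewrite (le_trans n1 nk) /= mulr1; apply: classM_decrw => //; exact: le_trans nk.
  apply: le_trans (tail _ (n + N)%N (lexx t0)).
  rewrite [leLHS]big_mkcond [leRHS]big_mkcond; apply: ler_sum => k _.
  rewrite -leNgt; case: (leP t0 k%:R) => [tk|_]; last by rewrite andbF.
  by case: ifP => // _; apply/ltW/classM_gt0/(le_trans t01).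
apply: le_trans H _.
apply: (@le_trans _ _ (S0 / (psi t0 * K) * (psi n%:R * nu))).
  rewrite mulrAC ler_pdivlMr ?mulr_gt0 // ler_pM2l //.
  by apply: ler_pM => //; rewrite ?ltW // classM_decr.
by rewrite ler_pM2r // lerDr mulr_ge0 ?addr_ge0 ?invr_ge0 ?mulr_ge0 // ltW.
Qed.

End ClassM.

(** * Cosine sums and their pointwise bounds *)

Section TrigSums.
Variable R : realType.
Implicit Types (a : nat -> R) (m N : nat) (theta y c : R).

(** The phase [theta] carries the shift beta pi / 2 and, with value pi / 2, turns cosines into
    sines, so one real family covers both parts of complex exponentials. *)
Definition cossum a m N theta y : R :=
  \sum_(i < N) a i * cos ((m + i)%:R * y - theta).

(* Summation by parts, from
   2 sin(y/2) cos(k y - theta) = sin((k+1/2) y - theta) - sin((k-1/2) y - theta). *)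
Lemma cossum_abel a m N theta y :
  `|2 * sin (y / 2) * cossum a m N.+1 theta y| <=
  `|a 0%N| + `|a N| + \sum_(i < N) `|a i.+1 - a i|.
Proof.
pose s k : R := sin ((m + k)%:R * y - y / 2 - theta).
have step k : 2 * sin (y / 2) * cos ((m + k)%:R * y - theta) = s k.+1 - s k.
  rewrite /s addnS -(natr1 (m + k)%N).
  have -> : ((m + k)%:R + 1) * y - y / 2 - theta = (m + k)%:R * y - theta + y / 2 by field.
  have -> : (m + k)%:R * y - y / 2 - theta = (m + k)%:R * y - theta - y / 2 by field.
  by set x := _ * y - theta; rewrite (sinD x (y / 2)) (sinB x (y / 2)); ring.
have H n : `|2 * sin (y / 2) * cossum a m n.+1 theta y - a n * s n.+1| <=
    `|a 0%N| + \sum_(i < n) `|a i.+1 - a i|.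
  elim: n => [|n IH].
    rewrite /cossum big_ord_recr !big_ord0 /= add0r addr0.
    have -> : 2 * sin (y / 2) * (a 0%N * cos ((m + 0)%:R * y - theta)) - a 0%N * s 1%N
       = - (a 0%N * s 0%N) by have := step 0%N; set u := cos _ => E;
       have -> : 2 * sin (y / 2) * (a 0%N * u) = a 0%N * (2 * sin (y / 2) * u) by [ring];
       rewrite E; ring.
    by rewrite normrN normrM ler_piMr // sin_max.
  rewrite /cossum big_ord_recr /= -/(cossum a m n.+1 theta y) big_ord_recr /=.
  have -> : 2 * sin (y / 2) * (cossum a m n.+1 theta y + a n.+1 * cos ((m + n.+1)%:R * y - theta))
      - a n.+1 * s n.+2 =
    (2 * sin (y / 2) * cossum a m n.+1 theta y - a n * s n.+1) - (a n.+1 - a n) * s n.+1.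
    have E := step n.+1; rewrite mulrDr [_ * (a _ * _)]mulrCA E; ring.
  apply: le_trans (ler_normB _ _) _; rewrite addrA lerD //.
  by rewrite normrM ler_piMr // sin_max.
have -> : 2 * sin (y / 2) * cossum a m N.+1 theta y =
  (2 * sin (y / 2) * cossum a m N.+1 theta y - a N * s N.+1) + a N * s N.+1 by ring.
apply: le_trans (ler_normD _ _) _; rewrite addrAC lerD //.
by rewrite normrM ler_piMr // sin_max.
Qed.

Lemma variation_monotone a N :
  (forall i, (i < N)%N -> a i <= a i.+1) \/ (forall i, (i < N)%N -> a i.+1 <= a i) ->
  \sum_(i < N) `|a i.+1 - a i| = `|a N - a 0%N|.
Proof.
case=> H.
  rewrite (eq_bigr (fun i : 'I_N => a i.+1 - a i)) => [|i _]; last first.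
    by rewrite ger0_norm // subr_ge0 H.
  have -> : \sum_(i < N) (a i.+1 - a i) = a N - a 0%N.
    by rewrite -(big_mkord predT (fun i => a i.+1 - a i)) telescope_sumr.
  rewrite ger0_norm // subr_ge0.
  by elim: N H => // N IH H; rewrite (le_trans (IH _)) ?H // => i iN; rewrite H // ltnW.
rewrite (eq_bigr (fun i : 'I_N => - (a i.+1 - a i))) => [|i _]; last first.
  by rewrite ler0_norm // subr_le0 H.
rewrite sumrN.
have -> : \sum_(i < N) (a i.+1 - a i) = a N - a 0%N.
  by rewrite -(big_mkord predT (fun i => a i.+1 - a i)) telescope_sumr.
rewrite ler0_norm // subr_le0.
by elim: N H => // N IH H; rewrite (le_trans _ (IH _)) ?H // => i iN; rewrite H // ltnW.
Qed.

(** For nonnegative monotone coefficients the end terms and the variation add up to twice the larger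
    end coefficient, which cancels the 2 of the summation by parts. *)
Lemma cossum_sin_le a m N theta y B :
  (forall i, (i < N)%N -> 0 <= a i <= B) ->
  (forall i, (i.+1 < N)%N -> a i <= a i.+1) \/ (forall i, (i.+1 < N)%N -> a i.+1 <= a i) ->
  0 <= B -> `|sin (y / 2)| * `|cossum a m N theta y| <= B.
Proof.
case: N => [|N] aB mon B0.
  by rewrite /cossum big_ord0 normr0 mulr0.
have := cossum_abel a m N theta y.
rewrite variation_monotone; last by case: mon => H; [left|right] => i iN; exact: H.
rewrite !normrM [`|2|]ger0_norm // => H.
have /andP[a0 a0B] := aB 0%N isT.
have /andP[aN aNB] := aB N (ltnSn N).
rewrite (ger0_norm a0) (ger0_norm aN) in H.
have : a 0%N + a N + `|a N - a 0%N| <= 2 * B.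
  by case: (leP (a 0%N) (a N)) => h;
   [rewrite ger0_norm ?subr_ge0|rewrite ler0_norm ?subr_le0 ?(ltW h)] => //; lra.
rewrite -mulrA in H; lra.
Qed.

Lemma cossum_norm_le a m N theta y :
  (forall i, (i < N)%N -> 0 <= a i) -> `|cossum a m N theta y| <= \sum_(i < N) a i.
Proof.
move=> a0; apply: le_trans (ler_norm_sum _ _ _) _.
apply: ler_sum => i _; rewrite normrM ger0_norm ?a0 //.
by rewrite ler_piMr ?a0 // cos_max.
Qed.

(** On [0, pi], sin z >= z cos z, because the difference has derivative z sin z. At z = y / 4 the
    doubling formula gives sin(y/2) >= (y/2) cos(y/4)^2, and cos(y/4)^2 >= 1/2 because cos(y/2) >=
    0. *)
Lemma sin_half_ge y : 0 <= y <= pi -> y / 4 <= sin (y / 2).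
Proof.
move=> /andP[y0 ypi].
pose g (z : R) := sin z - z * cos z.
have gd (z : R) : is_derive z 1 g (z * sin z).
  by apply: is_derive_eq; rewrite /GRing.scale /=; ring.
have pih := pihalf_02 R.
have g0 (z : R) : 0 <= z <= pi -> 0 <= g z.
  move=> /andP[z0 zpi].
  have -> : 0 = g 0 by rewrite /g sin0 mul0r subrr.
  move: z0; rewrite le_eqVlt => /predU1P[<-//|z0].
  have [|w] := @MVT _ g (fun z => z * sin z) 0 z z0 (fun x _ => gd x).
    by apply: derivable_within_continuous => x _; have [] := gd x.
  rewrite in_itv/= => /andP[w0 wz] E.
  rewrite -subr_ge0 E subr0; apply: mulr_ge0; last exact: ltW.
  by rewrite mulr_ge0 ?(ltW w0) // sin_ge0_pi // (ltW w0) (le_trans (ltW wz)).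
have z4 : 0 <= y / 4 <= pi by apply/andP; split; lra.
have := g0 _ z4; rewrite /g subr_ge0 => H.
have -> : y / 2 = (y / 4) *+ 2 by rewrite -mulr_natr; field.
rewrite sin_mulr2n.
have c0 : 0 <= cos (y / 4) by apply: cos_ge0_pihalf; apply/andP; split; lra.
have c2 : 2^-1 <= cos (y / 4) ^+ 2.
  have : 0 <= cos ((y / 4) *+ 2) by apply: cos_ge0_pihalf; rewrite -mulr_natr; apply/andP; split; lra.
  rewrite cos_mulr2n -mulr_natr; lra.
have : cos (y / 4) * (y / 4 * cos (y / 4)) <= cos (y / 4) * sin (y / 4) by rewrite ler_wpM2l.
have -> : cos (y / 4) * (y / 4 * cos (y / 4)) = y / 4 * cos (y / 4) ^+ 2 by ring.
have : y / 4 * 2^-1 <= y / 4 * cos (y / 4) ^+ 2 by rewrite ler_wpM2l //; lra.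
rewrite -[(cos _ * _) *+ 2]mulr_natr; lra.
Qed.

Lemma sin_half_ge2 y : 0 <= y <= 2 * pi -> y / 4 <= sin (y / 2) \/ (2 * pi - y) / 4 <= sin (y / 2).
Proof.
move=> /andP[y0 y2].
have [ypi|ypi] := leP y pi; first by left; apply: sin_half_ge; rewrite y0.
right.
have -> : sin (y / 2) = sin ((2 * pi - y) / 2).
  have -> : (2 * pi - y) / 2 = - (y / 2) + pi by field.
  by rewrite sinDpi sinN opprK.
by apply: sin_half_ge; apply/andP; split; lra.
Qed.

(* If |P| <= A and |sin (y/2)| |P| <= B on a period then |P| <= 2A/(1 + c d) with
   c = A/(4B) and d the distance from y to 2 pi Z. *)
Lemma kernel_majorant (P A B y : R) : 0 < A -> 0 < B -> 0 <= y <= 2 * pi ->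
  0 <= P -> P <= A -> `|sin (y / 2)| * P <= B ->
  P <= 2 * A / (1 + A / (4 * B) * y) \/ P <= 2 * A / (1 + A / (4 * B) * (2 * pi - y)).
Proof.
move=> A0 B0 y02 P0 PA PB.
have aux d : 0 <= d -> d / 4 <= sin (y / 2) -> P <= 2 * A / (1 + A / (4 * B) * d).
  move=> d0 ds.
  have c0 : 0 < A / (4 * B) by rewrite divr_gt0 // mulr_gt0.
  have den0 : 0 < 1 + A / (4 * B) * d by rewrite ltr_pwDl // mulr_ge0 // ltW.
  rewrite ler_pdivlMr //.
  have dP : d / 4 * P <= B.
    by apply: le_trans PB; apply: ler_wpM2r => //; apply: le_trans ds (ler_norm _).
  have -> : P * (1 + A / (4 * B) * d) = P + A * ((d / 4 * P) / B) by field; rewrite lt0r_neq0.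
  have : A * ((d / 4 * P) / B) <= A * 1 by rewrite ler_pM2l // ler_pdivrMr // mul1r.
  lra.
have /andP[y0 y2] := y02.
by case: (sin_half_ge2 y02) => h; [left|right]; apply: aux => //; lra.
Qed.

End TrigSums.

(** * Integrals over a period and the L_p norm of a kernel *)

Section PeriodicIntegrals.
Variable R : realType.
Local Notation mu := (@lebesgue_measure R).
Local Notation I := (@I02pi R).

Lemma pi2_gt0 : 0 < 2 * pi :> R.
Proof. by rewrite mulr_gt0 // pi_gt0. Qed.

Lemma measurable_I02pi : measurable I.
Proof. exact: measurable_itv. Qed.
Hint Resolve measurable_I02pi : core.

Lemma FTC2_is_derive (F f : R -> R) (a b : R) : a < b ->
  (forall x, a <= x <= b -> is_derive x 1 F (f x)) ->
  {within `[a, b], continuous f} ->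
  (\int[mu]_(x in `[a, b]) (f x)%:E = (F b - F a)%:E)%E.
Proof.
move=> ab dF cf; rewrite (continuous_FTC2 ab cf (F := F)) //.
- split.
  + move=> x; rewrite in_itv/= => /andP[ax xb].
    by have [] : is_derive x 1 F (f x) by apply: dF; rewrite !ltW.
  + apply: cvg_at_right_filter.
    have [d _] : is_derive a 1 F (f a) by apply: dF; rewrite lexx ltW.
    by apply: differentiable_continuous; apply/derivable1_diffP.
  + apply: cvg_at_left_filter.
    have [d _] : is_derive b 1 F (f b) by apply: dF; rewrite lexx ltW.
    by apply: differentiable_continuous; apply/derivable1_diffP.
- move=> x; rewrite in_itv/= => /andP[ax xb].
  have d : is_derive x 1 F (f x) by apply: dF; rewrite !ltW.
  by rewrite derive1E derive_val.
Qed.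

Lemma continuous_integrable (f : R -> R) (a b : R) : continuous f ->
  mu.-integrable `[a, b] (EFin \o f).
Proof.
move=> cf; apply: continuous_compact_integrable; first exact: segment_compact.
exact: continuous_subspaceT.
Qed.

Lemma continuous_measurable (f : R -> R) (D : set R) : continuous f -> measurable_fun D f.
Proof. by move=> cf; apply: measurable_funTS; exact: continuous_measurable_fun. Qed.

Lemma continuous_bounded_itv (f : R -> R) (a b : R) : a <= b -> continuous f ->
  [bounded f x | x in `[a, b]].
Proof.
move=> ab cf.
have [|c _ Hc] := @EVT_max _ (fun x => `|f x|) a b ab.
  by apply: continuous_subspaceT => x; apply: continuous_comp; [exact: cf|exact: norm_continuous].
exists `|f c|; split; first exact: num_real.
by move=> M /ltW cM x /= xab; apply: le_trans cM; exact: Hc.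
Qed.

(** The image of Lebesgue measure under a translation gives half-open intervals their length, hence
    is Lebesgue measure. *)
Lemma ge0_integral_translate (c : R) (D : set R) (G : R -> \bar R) :
  measurable D -> measurable_fun setT G -> (forall x, (0 <= G x)%E) ->
  (\int[mu]_(x in (fun x => x + c)%R @^-1` D) G (x + c)%R = \int[mu]_(x in D) G x)%E.
Proof.
move=> mD mG G0.
pose T := fun x : measurableTypeR R => (x + c : measurableTypeR R).
have mc : measurable_fun setT T.
  by apply: measurable_funD => //; exact: measurable_id.
have mu_push A : measurable A -> mu A = pushforward mu T A.
  apply: (@lebesgue_measure_unique R (pushforward mu T)) => X [[a b] _ <-].
  transitivity (mu `](a - c), (b - c)]%classic); last first.
    rewrite /pushforward /=; congr (mu _).
    by apply/seteqP; split => x /=; rewrite /T !in_itv/= ltrBlDr lerBrDr.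
  rewrite !lebesgue_measure_itv /= !lte_fin ltrD2r.
  by case: ifP => // _; rewrite -!EFinB; congr EFin; ring.
transitivity (\int[pushforward mu T]_(y in D) G y)%E.
  by rewrite ge0_integral_pushforward //; exact: measurable_funTS.
by apply: eq_measure_integral => A mA _; exact/esym/mu_push.
Qed.

(** The part over [a, 0) moves by one period to [a + 2 pi, 2 pi); half-open intervals keep the
    pieces disjoint. The range of a covers the origins that occur, - pi and - t with t in the
    period. *)
Lemma periodic_integral (G : R -> \bar R) (a : R) :
  measurable_fun setT G -> (forall x, (0 <= G x)%E) -> (forall x, G (x + 2 * pi) = G x) ->
  - (2 * pi) <= a <= 0 ->
  (\int[mu]_(x in `[a, (a + 2 * pi)%R]) G x = \int[mu]_(x in I) G x)%E.
Proof.
move=> mG G0 pG /andP[a1 a0]; have p0 := pi2_gt0.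
have mGD D : measurable_fun D G by exact: measurable_funTS.
rewrite /I02pi -integral_itv_bndo_bndc // -[RHS]integral_itv_bndo_bndc //.
have -> : `[a, a + 2 * pi[%classic = `[a, 0[%classic `|` `[0, a + 2 * pi[%classic :> set R.
  apply/seteqP; split => x /=; rewrite !in_itv/=.
    by case: (ltP x 0) => h /andP[h1 h2]; [left|right]; apply/andP.
  by case=> /andP[h1 h2]; apply/andP; split; lra.
have -> : `[0, 2 * pi[%classic =
    `[0, a + 2 * pi[%classic `|` `[a + 2 * pi, 2 * pi[%classic :> set R.
  apply/seteqP; split => x /=; rewrite !in_itv/=.
    by case: (ltP x (a + 2 * pi)) => h /andP[h1 h2]; [left|right]; apply/andP.
  by case=> /andP[h1 h2]; apply/andP; split; lra.
rewrite ge0_integral_setU //; [|exact: mGD|]; last first.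
  by rewrite disj_set2E; apply/eqP/seteqP; split => // x /= []; rewrite !in_itv/=; lra.
rewrite ge0_integral_setU //; [|exact: mGD|]; last first.
  by rewrite disj_set2E; apply/eqP/seteqP; split => // x /= []; rewrite !in_itv/=; lra.
rewrite addeC; congr (_ + _)%E.
rewrite -(@ge0_integral_translate (2 * pi) `[a + 2 * pi, 2 * pi[) //.
have -> : (fun x : R => x + 2 * pi) @^-1` `[a + 2 * pi, 2 * pi[%classic = `[a, 0[%classic.
  by apply/seteqP; split => x /=; rewrite !in_itv/= => /andP[h1 h2]; apply/andP; split; lra.
by apply: eq_integral => x _; rewrite pG.
Qed.

(** Links Fourier coefficients, integrated over [- pi, pi], to norms, integrated over [0, 2 pi].
    Positive and negative parts are moved separately. *)
Lemma periodic_Rintegral (f : R -> R) : measurable_fun setT f -> periodic2pi f ->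
  Rintegral mu (@Ipi R) f = Rintegral mu I f.
Proof.
move=> mf pf; rewrite /Rintegral; congr fine.
rewrite integralE [RHS]integralE.
have -> : @Ipi R = `[- pi, - pi + 2 * pi]%classic.
  by rewrite /Ipi; have -> : - pi + 2 * pi = pi :> R by ring.
have ph : - (2 * pi) <= - (pi : R) <= 0.
  by have h := pi_gt0 R; apply/andP; split; lra.
have mF : measurable_fun [set: R] (EFin \o f) by exact/measurable_EFinP.
congr (_ - _)%E; apply: periodic_integral => //.
- exact: measurable_funepos.
- by move=> x; rewrite !funeposE /= pf.
- exact: measurable_funeneg.
- by move=> x; rewrite !funenegE /= pf.
Qed.

Lemma periodic_integral_shift (G : R -> \bar R) (t : R) :
  measurable_fun setT G -> (forall x, (0 <= G x)%E) -> (forall x, G (x + 2 * pi) = G x) ->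
  I t -> (\int[mu]_(x in I) G (x - t)%R = \int[mu]_(x in I) G x)%E.
Proof.
move=> mG G0 pG; rewrite /I02pi /= in_itv/= => /andP[t0 t1].
rewrite -(@periodic_integral G (- t)) //; last by apply/andP; split; lra.
rewrite -(@ge0_integral_translate (- t) `[- t, - t + 2 * pi]) //.
have -> // : (fun x : R => x + - t) @^-1` `[- t, - t + 2 * pi]%classic = `[0, 2 * pi]%classic.
by apply/seteqP; split => x /=; rewrite !in_itv/= => /andP[h1 h2]; apply/andP; split; lra.
Qed.

Lemma affine_continuous (al be : R) : continuous (fun y : R => al + be * y).
Proof.
move=> y; apply: continuousD; first exact: cst_continuous.
by apply: continuousM; [exact: cst_continuous|exact: id].
Qed.

(** Meant for slopes of both signs, for the distances to the two ends of the period. *)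
Lemma integral_affine_powR (al be p : R) : 1 < p -> be != 0 ->
  (forall y : R, 0 <= y <= 2 * pi -> 0 < al + be * y) ->
  (\int[mu]_(y in I) ((al + be * y) `^ (- p))%:E =
   (((al + be * (2 * pi)) `^ (1 - p) - al `^ (1 - p)) / (be * (1 - p)))%:E)%E.
Proof.
move=> p1 be0 pos; have p0 := pi2_gt0.
pose F (y : R) := (al + be * y) `^ (1 - p) / (be * (1 - p)).
have bp : be * (1 - p) != 0 by rewrite mulf_neq0 // subr_eq0 lt_eqF.
have dF (y : R) : 0 <= y <= 2 * pi -> is_derive y 1 F ((al + be * y) `^ (- p)).
  move=> /pos ay.
  have H : is_derive (al + be * y) 1 (fun z : R => z `^ (1 - p)) ((1 - p) * (al + be * y) `^ (1 - p - 1)).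
    apply: DeriveDef; last first.
      by rewrite -derive1E powR_derive1 // in_itv/= andbT.
    by apply: derivable_powR; rewrite in_itv/= andbT.
  have H2 : is_derive y 1 (fun y : R => al + be * y) be.
    by apply: is_derive_eq; rewrite /GRing.scale /=; ring.
  have H3 := @is_derive1_comp _ (fun z : R => z `^ (1 - p)) (fun y : R => al + be * y) y _ _ H H2.
  have -> : (al + be * y) `^ (- p) =
     (be * (1 - p))^-1 *: ((1 - p) * (al + be * y) `^ (1 - p - 1) * be).
    have -> : 1 - p - 1 = - p by ring.
    rewrite /GRing.scale /=; field.
    by move: bp; rewrite mulf_eq0 negb_or => /andP[-> ->].
  have -> : F = (be * (1 - p))^-1 \*: ((fun z : R => z `^ (1 - p)) \o (fun y : R => al + be * y)).
    by apply/funext => z; rewrite /F /= /GRing.scale /= mulrC.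
  exact: is_deriveZ.
rewrite /I02pi (FTC2_is_derive (F := F)) //.
  by rewrite /F mulr0 addr0 -mulrBl.
apply: continuous_in_subspaceT => y; rewrite inE/= in_itv/= => /pos ay.
rewrite /=; apply: (@continuous_comp _ _ _ (fun y : R => al + be * y) (fun z => z `^ (- p))).
  exact: affine_continuous.
apply: differentiable_continuous; apply/derivable1_diffP.
by apply: derivable_powR; rewrite in_itv/= andbT.
Qed.

(** With c = A / (4B) and d the distance to one end of the period, (2A)^p (1 + c d)^(-p) integrates
    to at most (2A)^p / (c (p - 1)), whatever the length of the period, because p > 1. The two ends
    give the leading factor 2. *)
Lemma kernel_Lp (P : R -> R) (A B p : R) : 1 < p -> 0 < A -> 0 < B -> continuous P ->
  (forall y, 0 <= P y <= A) -> (forall y, `|sin (y / 2)| * P y <= B) ->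
  (\int[mu]_(y in I) (P y `^ p)%:E <= (2 * 2 `^ p * 4 / (p - 1) * (A `^ (p - 1) * B))%:E)%E.
Proof.
move=> p1 A0 B0 cP PA PB.
have pp : 0 < p by lra.
pose c := A / (4 * B).
have c0 : 0 < c by rewrite divr_gt0 // mulr_gt0.
have tp := pi2_gt0.
have pos1 (y : R) : 0 <= y <= 2 * pi -> 0 < 1 + c * y.
  by move=> /andP[y0 _]; rewrite ltr_pwDl // mulr_ge0 // ltW.
have pos2 (y : R) : 0 <= y <= 2 * pi -> 0 < 1 + c * (2 * pi) + - c * y.
  move=> /andP[y0 y1]; have : 0 <= c * (2 * pi - y) by rewrite mulr_ge0 ?subr_ge0 // ltW.
  by rewrite mulrBr; lra.
pose q (y : R) := (2 * A) `^ p * ((1 + c * y) `^ (- p) + (1 + c * (2 * pi) + - c * y) `^ (- p)).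
have mq al be : measurable_fun I (fun y : R => (al + be * y) `^ (- p)).
  apply: (measurableT_comp (measurable_powR (- p))).
  by apply: continuous_measurable; exact: affine_continuous.
have Pq y : I y -> P y `^ p <= q y.
  rewrite /I02pi /= in_itv/= => y02.
  have /andP[P0 PAy] := PA y.
  rewrite /q mulrDr.
  have aux d : 0 < d -> P y <= 2 * A / d -> P y `^ p <= (2 * A) `^ p * d `^ (- p).
    move=> d0 h; have A2 : 0 <= 2 * A by rewrite mulr_ge0 // ltW.
    apply: (@le_trans _ _ ((2 * A / d) `^ p)).
      by apply: ge0_ler_powR => //; rewrite ?nnegrE ?divr_ge0 // ltW.
    by rewrite powRM ?invr_ge0 ?(ltW d0) // -(powR_inv1 (ltW d0)) -powRrM mulN1r.
  have [h|h] := kernel_majorant A0 B0 y02 P0 PAy (PB y).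
    by apply: le_trans (aux _ (pos1 _ y02) h) _; rewrite lerDl mulr_ge0 ?powR_ge0.
  have E : 1 + A / (4 * B) * (2 * pi - y) = 1 + c * (2 * pi) + - c * y by rewrite /c; ring.
  rewrite E in h.
  by apply: le_trans (aux _ (pos2 _ y02) h) _; rewrite lerDr mulr_ge0 ?powR_ge0.
apply: (@le_trans _ _ (\int[mu]_(y in I) (q y)%:E)%E).
  apply: (ge0_le_integral mu measurable_I02pi) => //.
  - by move=> y _; rewrite lee_fin powR_ge0.
  - apply/measurable_EFinP; apply: (measurableT_comp (measurable_powR p)).
    exact: continuous_measurable.
  - apply/measurable_EFinP; apply: measurable_funM; first exact: measurable_cst.
    by apply: measurable_funD; exact: mq.
under eq_integral => y _ do rewrite EFinM EFinD.
rewrite ge0_integralZl_EFin ?powR_ge0 //; last 2 first.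
- by move=> y _; rewrite -EFinD lee_fin addr_ge0 // powR_ge0.
- by apply: emeasurable_funD; apply/measurable_EFinP; exact: mq.
rewrite ge0_integralD //; last 4 first.
- by move=> y _; rewrite lee_fin powR_ge0.
- by apply/measurable_EFinP; exact: mq.
- by move=> y _; rewrite lee_fin powR_ge0.
- by apply/measurable_EFinP; exact: mq.
rewrite integral_affine_powR ?lt0r_neq0 //.
rewrite integral_affine_powR ?oppr_eq0 ?lt0r_neq0 //.
rewrite -EFinD -EFinM lee_fin.
have -> : 1 + c * (2 * pi) + - c * (2 * pi) = 1 by ring.
rewrite powR1.
(* The far limit of integration only contributes the factor 1 - z <= 1, dropped at the end. *)
set z := _ `^ (1 - p).
have cn : c != 0 by rewrite lt0r_neq0.
have pn : p - 1 != 0 by rewrite lt0r_neq0 ?subr_gt0.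
have np : 1 - p != 0 by rewrite -opprB oppr_eq0.
have An : A != 0 by rewrite lt0r_neq0.
have z0 : 0 <= z by exact: powR_ge0.
have cE : c^-1 = 4 * B / A by rewrite /c invf_div.
have -> : (z - 1) / (c * (1 - p)) + (1 - z) / (- c * (1 - p)) =
   2 * (1 - z) / (p - 1) * c^-1 by field; rewrite cn pn np.
have -> : A `^ (p - 1) = A `^ p / A.
  by rewrite powRB ?lt0r_neq0 ?implybT // powRr1 // ltW.
rewrite powRM ?(ltW A0) // cE.
have -> : 2 `^ p * A `^ p * (2 * (1 - z) / (p - 1) * (4 * B / A)) =
  2 * 2 `^ p * 4 / (p - 1) * (A `^ p / A * B) * (1 - z) by field; rewrite An pn.
rewrite ler_piMr //; last by lra.
rewrite !mulr_ge0 ?invr_ge0 ?powR_ge0 ?subr_ge0 //; exact: ltW.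
Qed.

End PeriodicIntegrals.

(** * Orthogonality, the Fejer kernel and Young's convolution inequality *)

Section TrigIntegrals.
Variable R : realType.
Local Notation mu := (@lebesgue_measure R).
Local Notation I := (@I02pi R).
Let mI := @measurable_I02pi R.

Lemma continuous_integrable_I (f : R -> R) : continuous f -> mu.-integrable I (EFin \o f).
Proof. exact: continuous_integrable. Qed.

Lemma integrable_mul_bounded (u g : R -> R) (M : R) :
  mu.-integrable I (EFin \o u) -> measurable_fun I g -> (forall x, I x -> `|g x| <= M) ->
  mu.-integrable I (EFin \o (fun x => u x * g x)).
Proof.
move=> iu mg gM.
have -> : EFin \o (fun x => u x * g x) = ((EFin \o u) \* (EFin \o g))%E.
  by apply/funext => x.
have bg : [bounded g x | x in I].
  by exists M; split; [exact: num_real|move=> N /ltW MN x Ix; exact: le_trans (gM x Ix) MN].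
exact: (@integrableMl _ _ _ mu I mI (EFin \o u) g iu mg bg).
Qed.

Lemma integrable_mul_continuous (u g : R -> R) :
  mu.-integrable I (EFin \o u) -> continuous g -> mu.-integrable I (EFin \o (fun x => u x * g x)).
Proof.
move=> iu cg.
have [M [_ HM]] : [bounded g x | x in I].
  by apply: continuous_bounded_itv => //; rewrite ltW // pi2_gt0.
apply: (@integrable_mul_bounded u g (M + 1)) => //; first exact: continuous_measurable.
by move=> x Ix; apply: HM; rewrite ?ltrDl.
Qed.

Lemma integrable_scale (u : R -> R) (c : R) :
  mu.-integrable I (EFin \o u) -> mu.-integrable I (EFin \o (fun x => c * u x)).
Proof.
move=> iu; have -> : (fun x => c * u x) = (fun x => u x * c) by apply/funext => x; rewrite mulrC.
by apply: integrable_mul_continuous iu _; exact: cst_continuous.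
Qed.

Lemma integrable_add (u v : R -> R) : mu.-integrable I (EFin \o u) ->
  mu.-integrable I (EFin \o v) -> mu.-integrable I (EFin \o (fun x => u x + v x)).
Proof.
move=> iu iv.
have -> : EFin \o (fun x => u x + v x) = ((EFin \o u) \+ (EFin \o v))%E by apply/funext.
exact: (@integrableD _ _ _ mu I mI (EFin \o u) (EFin \o v) iu iv).
Qed.

Lemma lebesgue_I02pi : mu I = (2 * pi)%:E.
Proof. by rewrite /I02pi lebesgue_measure_itv /= lte_fin pi2_gt0 -EFinB subr0. Qed.

Lemma Rintegral_cst_I (c : R) : Rintegral mu I (fun=> c) = c * (2 * pi).
Proof. by rewrite Rintegral_cst //; congr (_ * _); exact: (congr1 fine lebesgue_I02pi). Qed.

Lemma EFin_Rintegral (u : R -> R) : mu.-integrable I (EFin \o u) ->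
  (Rintegral mu I u)%:E = (\int[mu]_(x in I) (u x)%:E)%E.
Proof. by move=> iu; rewrite /Rintegral fineK //; exact: integrable_fin_num. Qed.

Lemma normr_Rintegral_le (u : R -> R) : mu.-integrable I (EFin \o u) ->
  `|Rintegral mu I u| <= Rintegral mu I (fun x => `|u x|).
Proof. by move=> iu; exact: le_normr_Rintegral. Qed.

Lemma sum_continuous N (g : nat -> R -> R) :
  (forall i, continuous (g i)) -> continuous (fun x => \sum_(i < N) g i x).
Proof.
move=> cg; elim: N => [|n IH] x.
  under eq_fun do rewrite big_ord0; exact: cst_continuous.
by under eq_fun do rewrite big_ord_recr /=; apply: continuousD; [exact: IH|exact: cg].
Qed.

Lemma Rintegral_mul_sum (u : R -> R) N (g : nat -> R -> R) :
  mu.-integrable I (EFin \o u) -> (forall i, continuous (g i)) ->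
  Rintegral mu I (fun x => u x * \sum_(i < N) g i x) =
  \sum_(i < N) Rintegral mu I (fun x => u x * g i x).
Proof.
move=> iu cg.
elim: N => [|N IH].
  rewrite big_ord0; under eq_Rintegral do rewrite big_ord0 mulr0.
  by rewrite Rintegral_cst // mul0r.
rewrite big_ord_recr /= -IH -RintegralD //; last 2 first.
- by apply: integrable_mul_continuous => //; exact: sum_continuous.
- exact: integrable_mul_continuous.
by apply: eq_Rintegral => x _; rewrite big_ord_recr /= mulrDr.
Qed.

Lemma cos_affine_continuous (k th : R) : continuous (fun x : R => cos (k * x - th)).
Proof.
move=> x; apply: (@continuous_comp _ _ _ (fun y : R => k * y - th) cos).
  apply: continuousB; last exact: cst_continuous.
  by apply: continuousM; [exact: cst_continuous|exact: id].
exact: continuous_cos.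
Qed.

Lemma cossum_continuous a m N th : continuous (@cossum R a m N th).
Proof.
apply: (@sum_continuous N (fun i x => a i * cos ((m + i)%:R * x - th))) => i x.
by apply: continuousM; [exact: cst_continuous|exact: cos_affine_continuous].
Qed.

Lemma cos_add2pi (k : nat) (z : R) : cos (z + k%:R * (2 * pi)) = cos z.
Proof.
have -> : k%:R * (2 * pi) = (pi *+ 2) *+ k :> R by rewrite -[RHS]mulr_natl -[pi *+ 2]mulr_natl.
exact: (periodicn (@cosD2pi R)).
Qed.

Lemma is_derive_cos_affine (k th x : R) :
  is_derive x 1 (fun x : R => cos (k * x - th)) (- (k * sin (k * x - th))).
Proof. by apply: is_derive_eq; rewrite /GRing.scale /=; ring. Qed.

Lemma integral_cos (k : nat) (th : R) :
  Rintegral mu I (fun x => cos (k%:R * x - th)) = if k == 0%N then 2 * pi * cos th else 0.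
Proof.
have p0 := @pi2_gt0 R.
case: eqP => [->|/eqP k0].
  under eq_Rintegral do rewrite mul0r sub0r cosN.
  by rewrite Rintegral_cst_I; ring.
have kn : k%:R != 0 :> R by rewrite pnatr_eq0.
pose F (x : R) := - k%:R^-1 * cos (k%:R * x - (th - pi / 2)).
have dF (x : R) : is_derive x 1 F (cos (k%:R * x - th)).
  have := is_derive_cos_affine k%:R (th - pi / 2) x.
  move=> /(is_deriveZ (- (k%:R^-1))).
  have -> // : - k%:R^-1 *: - (k%:R * sin (k%:R * x - (th - pi / 2))) = cos (k%:R * x - th).
  have -> : k%:R * x - (th - pi / 2) = k%:R * x - th + pi / 2 by ring.
  by rewrite sinDpihalf /GRing.scale /=; field.
rewrite /Rintegral /I02pi (FTC2_is_derive (F := F)) //=; last first.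
  by apply: continuous_subspaceT; exact: cos_affine_continuous.
rewrite /F mulr0.
have -> : k%:R * (2 * pi) - (th - pi / 2) = (0 - (th - pi / 2)) + k%:R * (2 * pi) by ring.
by rewrite cos_add2pi subrr.
Qed.

Lemma integral_cos_cos (j m : nat) (al be : R) : (0 < j)%N ->
  Rintegral mu I (fun x => cos (j%:R * x - al) * cos (m%:R * x - be)) =
  if j == m then pi * cos (al - be) else 0.
Proof.
(* The order j <= m keeps the difference frequency m - j a natural number. The case m = 0 is
   separate because the swapped statement needs its first frequency positive. *)
wlog jm : j m al be / (j <= m)%N => [H|].
  move=> j0; have [jm|mj] := leqP j m; first exact: H.
  have [m0|m0] := posnP m.
    rewrite m0 gtn_eqF //; under eq_Rintegral do rewrite mul0r sub0r.
    rewrite RintegralZr //; last by apply: continuous_integrable_I; exact: cos_affine_continuous.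
    by rewrite integral_cos gtn_eqF // mul0r.
  under eq_Rintegral do rewrite mulrC.
  by rewrite (H m j) // ?(ltnW mj) // eq_sym gtn_eqF //.
move=> j0.
under eq_Rintegral => x _.
  have -> : cos (j%:R * x - al) * cos (m%:R * x - be) =
    2^-1 * (cos ((m - j)%:R * x - (be - al)) + cos ((j + m)%:R * x - (al + be))).
    rewrite natrB // natrD.
    have -> : (m%:R - j%:R) * x - (be - al) = (m%:R * x - be) - (j%:R * x - al) by ring.
    have -> : (j%:R + m%:R) * x - (al + be) = (m%:R * x - be) + (j%:R * x - al) by ring.
    by set U := _ - be; set V := _ - al; rewrite (cosB U V) (cosD U V); field.
  over.
have ci k th : mu.-integrable I (EFin \o (fun x : R => cos (k * x - th))).
  by apply: continuous_integrable_I; exact: cos_affine_continuous.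
rewrite RintegralZl //; last first.
  apply: continuous_integrable_I => x.
  by apply: continuousD; exact: cos_affine_continuous.
rewrite RintegralD // !integral_cos addn_eq0 (gtn_eqF j0) /= addr0 subn_eq0.
have -> : (m <= j)%N = (j == m) by rewrite eqn_leq jm.
case: ifP => _; last by rewrite mulr0.
by rewrite -[be - al]opprB cosN; field.
Qed.

Definition fejer N (y : R) : R :=
  1 + 2 * cossum (fun i => 1 - i.+1%:R / N%:R) 1 N 0 y.

(** The classical square: the right side is the squared modulus of the sum of e^(iky) over k < N,
    its imaginary part being the cosine sum of phase pi / 2. *)
Lemma fejerE N y : (0 < N)%N ->
  N%:R * fejer N y = cossum (fun=> 1) 0 N 0 y ^+ 2 + cossum (fun=> 1) 0 N (pi / 2) y ^+ 2.
Proof.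
move=> N0.
have H n : n%:R + 2 * (\sum_(i < n) (n%:R - i.+1%:R) * cos (i.+1%:R * y)) =
   (\sum_(i < n) cos (i%:R * y)) ^+ 2 + (\sum_(i < n) sin (i%:R * y)) ^+ 2 :> R.
  elim: n => [|n IH]; first by rewrite !big_ord0; ring.
  rewrite big_ord_recr /= subrr mul0r addr0 [\sum_(i < n.+1) cos _]big_ord_recr
    [\sum_(i < n.+1) sin _]big_ord_recr /=.
  have -> : \sum_(i < n) (n.+1%:R - i.+1%:R) * cos (i.+1%:R * y) =
     \sum_(i < n) (n%:R - i.+1%:R) * cos (i.+1%:R * y) + \sum_(i < n) cos (i.+1%:R * y).
    by rewrite -big_split; apply: eq_bigr => i _ /=; rewrite -(natr1 n); ring.
  set C := \sum_(i < n) cos (i%:R * y) in IH *; set S := \sum_(i < n) sin _ in IH *.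
  (* Read backwards, the sum has the arguments n y - i y, which expand in C and S. *)
  have E : \sum_(i < n) cos (i.+1%:R * y) = C * cos (n%:R * y) + S * sin (n%:R * y).
    rewrite (reindex_inj rev_ord_inj) /= /C /S !mulr_suml -big_split; apply: eq_bigr => i _ /=.
    rewrite subnSK // natrB ?(ltnW (ltn_ord i)) // mulrBl cosB; ring.
  rewrite E -(natr1 n).
  have := sin2cos2 (n%:R * y); set c := cos _; set s := sin _ => sc.
  have -> : (C + c) ^+ 2 + (S + s) ^+ 2 = C ^+ 2 + S ^+ 2 + 2 * (C * c + S * s) + (c ^+ 2 + s ^+ 2) by ring.
  rewrite sc -IH; ring.
have Nn : N%:R != 0 :> R by rewrite pnatr_eq0 -lt0n.
have -> : cossum (fun=> 1) 0 N 0 y = \sum_(i < N) cos (i%:R * y).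
  by apply: eq_bigr => i _; rewrite mul1r subr0.
have -> : cossum (fun=> 1) 0 N (pi / 2) y = \sum_(i < N) sin (i%:R * y).
  by apply: eq_bigr => i _; rewrite mul1r cosBpihalf.
rewrite -H /fejer /cossum mulrDr mulr1 mulrCA mulr_sumr; congr (_ + _ * _).
apply: eq_bigr => i _; rewrite add1n subr0; field.
by [].
Qed.

Lemma fejer_ge0 N y : (0 < N)%N -> 0 <= fejer N y.
Proof.
move=> N0; have N0' : 0 < N%:R :> R by rewrite ltr0n.
by rewrite -(pmulr_rge0 _ N0') fejerE // addr_ge0 // sqr_ge0.
Qed.

(** Both sums in [fejerE] have constant coefficients, so summation by parts bounds each by 1 after
    multiplication by sin(y/2). *)
Lemma fejer_decay N y : (0 < N)%N -> sin (y / 2) ^+ 2 * fejer N y <= 2 / N%:R.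
Proof.
move=> N0; have N0' : 0 < N%:R :> R by rewrite ltr0n.
rewrite ler_pdivlMr // -mulrA [_ * N%:R]mulrC fejerE // mulrDr -!exprMn.
have aux th : (sin (y / 2) * cossum (fun=> 1) 0 N th y) ^+ 2 <= 1.
  have := @cossum_sin_le R (fun=> 1) 0 N th y 1.
  rewrite -normrM => H; rewrite -real_normK ?num_real // expr_le1 //.
  by apply: H => //; [move=> i _; rewrite lexx ler01|left].
by have := aux 0; have := aux (pi / 2); lra.
Qed.

(** Jensen's inequality for |phi| dt, of mass at most 1. The tangent inequality at the integral Y, p
    Y^(p-1) v <= (p - 1) Y^p + v^p, is integrated, and a mass below 1 only helps. It is itself
    Young's inequality for products, with exponents p / (p - 1) and p. *)
Lemma jensen_powR (phi Q : R -> R) (A p : R) : 1 < p ->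
  measurable_fun setT phi -> (\int[mu]_(t in I) (`|phi t|)%:E <= 1)%E ->
  measurable_fun setT Q -> (forall t, 0 <= Q t <= A) ->
  (Rintegral mu I (fun t => `|phi t| * Q t)) `^ p <=
  Rintegral mu I (fun t => `|phi t| * Q t `^ p).
Proof.
move=> p1 mphi phi1 mQ QA.
have p0 : 0 < p by lra.
have aux (a J m : R) : p * a <= (p - 1) * a * m + J ->
  (p - 1) * a * m <= (p - 1) * a * 1 -> a <= J by lra.
have iphi : mu.-integrable I (EFin \o (fun t => `|phi t|)).
  apply/integrableP; split.
    by apply/measurable_EFinP; apply: measurableT_comp => //; exact: measurable_funTS.
  under eq_integral do rewrite /= normr_id.
  by apply: le_lt_trans phi1 _; rewrite ltry.
have m1 : Rintegral mu I (fun t => `|phi t|) <= 1.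
  rewrite -lee_fin /Rintegral fineK //; exact: integrable_fin_num.
have iQ : mu.-integrable I (EFin \o (fun t => `|phi t| * Q t)).
  apply: (@integrable_mul_bounded _ _ A iphi); first exact: measurable_funTS.
  by move=> t _; have /andP[h1 h2] := QA t; rewrite ger0_norm.
have iQp : mu.-integrable I (EFin \o (fun t => `|phi t| * Q t `^ p)).
  apply: (@integrable_mul_bounded _ _ (A `^ p) iphi).
    by apply: (measurableT_comp (measurable_powR p)); exact: measurable_funTS.
  move=> t _; have /andP[h1 h2] := QA t; rewrite ger0_norm ?powR_ge0 //.
  by apply: ge0_ler_powR => //; rewrite ?nnegrE ?(ltW p0) // (le_trans h1).
set Y := Rintegral _ _ _.
have Y0 : 0 <= Y.
  by apply: Rintegral_ge0 => t _; rewrite mulr_ge0 //; case/andP: (QA t).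
pose q := p / (p - 1).
have pn : p - 1 != 0 by rewrite lt0r_neq0 // subr_gt0.
have p0n : p != 0 by rewrite lt0r_neq0.
have tangent v : 0 <= v -> p * (Y `^ (p - 1) * v) <= (p - 1) * Y `^ p + v `^ p.
  move=> v0.
  have := @conjugate_powR R (Y `^ (p - 1)) v q p (powR_ge0 _ _) v0.
  have -> : q^-1 + p^-1 = 1 by rewrite /q; field; rewrite p0n pn.
  have q0 : 0 < q by rewrite divr_gt0 // subr_gt0.
  rewrite -powRrM.
  have -> : (p - 1) * q = p by rewrite /q; field.
  move=> /(_ q0 p0 erefl) H.
  have -> : (p - 1) * Y `^ p + v `^ p = p * (Y `^ p / q + v `^ p / p).
    by rewrite /q; field; rewrite p0n pn.
  by rewrite ler_pM2l.
have YY : Y `^ (p - 1) * Y = Y `^ p.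
  have [->|Yn] := eqVneq Y 0; first by rewrite mulr0 powR0.
  by rewrite -{2}[Y]powRr1 // -powRD ?Yn ?implybT // subrK.
have : Rintegral mu I (fun t => (p * Y `^ (p - 1)) * (`|phi t| * Q t)) <=
    Rintegral mu I (fun t => (p - 1) * Y `^ p * `|phi t| + `|phi t| * Q t `^ p).
  apply: le_Rintegral => //.
  - exact: integrable_scale.
  - by apply: integrable_add => //; exact: integrable_scale.
  - move=> t _; have /andP[Qt _] := QA t.
    have := ler_wpM2l (normr_ge0 (phi t)) (tangent _ Qt).
    by rewrite !mulrDr; lra.
rewrite RintegralZl // RintegralD //; last exact: integrable_scale.
rewrite RintegralZl // -/Y -mulrA YY => H.
by apply: aux H _; rewrite ler_wpM2l // mulr_ge0 ?powR_ge0 // subr_ge0 ltW.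
Qed.

Lemma integral_cst_mul_le (phi : R -> R) (C : \bar R) : measurable_fun setT phi ->
  (\int[mu]_(t in I) (`|phi t|)%:E <= 1)%E -> (0 <= C)%E ->
  (\int[mu]_(t in I) ((`|phi t|)%:E * C) <= C)%E.
Proof.
move=> mphi phi1 C0.
have mn : measurable_fun I (fun t : R => (`|phi t|)%:E).
  by apply/measurable_EFinP; apply: measurableT_comp => //; exact: measurable_funTS.
rewrite (ge0_integralZr mu mI mn) //.
by rewrite -[leRHS]mul1e; exact: lee_wpmul2r.
Qed.

(** Jensen's inequality bounds |S(x)|^p by the integral of |phi(t)| |P(x - t)|^p; after Tonelli's
    theorem the inner integral no longer depends on t, by periodicity. *)
Lemma young_convolution (phi P S : R -> R) (A p : R) : 1 < p ->
  measurable_fun setT phi -> (\int[mu]_(t in I) (`|phi t|)%:E <= 1)%E ->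
  continuous P -> periodic2pi P -> (forall t, `|P t| <= A) ->
  continuous S -> (forall x, S x = Rintegral mu I (fun t => phi t * P (x - t))) ->
  (\int[mu]_(x in I) (`|S x| `^ p)%:E <= \int[mu]_(y in I) (`|P y| `^ p)%:E)%E.
Proof.
move=> p1 mphi phi1 cP pP PA cS ES.
have p0 : 0 < p by lra.
have PAp y : `| `|P y| `^ p | <= A `^ p.
  have A0 : 0 <= A by apply: le_trans (PA 0).
  rewrite ger0_norm; last exact: powR_ge0.
  by apply: ge0_ler_powR (PA y); rewrite ?nnegrE ?(ltW p0).
have iphi : mu.-integrable I (EFin \o phi).
  apply/integrableP; split; first by apply/measurable_EFinP; exact: measurable_funTS.
  by apply: le_lt_trans phi1 _; rewrite ltry.
have cnP : continuous (fun y => `|P y|).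
  by move=> y; apply: continuous_comp; [exact: cP|exact: norm_continuous].
have csub (x : R) : continuous (fun t : R => x - t).
  by move=> t; apply: continuousB; [exact: cst_continuous|exact: id].
have cPx x : continuous (fun t => P (x - t)).
  by move=> t; apply: continuous_comp; [exact: csub|exact: cP].
have cnPx x : continuous (fun t => `|P (x - t)|).
  by move=> t; apply: (@continuous_comp _ _ _ (fun t => x - t) (fun y => `|P y|)); [exact: csub|exact: cnP].
have mPp : measurable_fun setT (fun y => `|P y| `^ p).
  by apply: (measurableT_comp (measurable_powR p)); exact: continuous_measurable.
pose g x t : \bar R := (`|phi t| * `|P (x - t)| `^ p)%:E.
have mg x : measurable_fun setT (g x).
  apply/measurable_EFinP; apply: measurable_funM; first exact: measurableT_comp.
  apply: (measurableT_comp (measurable_powR p)); exact: continuous_measurable.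
(* Indicators extend the integrand to the whole plane for Tonelli's theorem; [Fx] and [Ft] turn the
   partial integrals back into integrals over the period. *)
pose F (z : R * R) : \bar R :=
  (\1_I z.1 * \1_I z.2 * (`|phi z.2| * `|P (z.1 - z.2)| `^ p))%:E.
have mnphi : measurable_fun setT (fun t : R => `|phi t|) by apply: measurableT_comp.
have mind : measurable_fun setT (\1_I : R -> R) by exact: measurable_indic.
have mF : measurable_fun setT F.
  apply/measurable_EFinP; apply: measurable_funM.
    apply: measurable_funM.
      by apply: (measurableT_comp mind); exact: measurable_fst.
    by apply: (measurableT_comp mind); exact: measurable_snd.
  apply: measurable_funM.
    apply: measurableT_comp => //; apply: measurableT_comp mphi _; exact: measurable_snd.
  apply: (measurableT_comp mPp).
  by apply: measurable_funB; [exact: measurable_fst|exact: measurable_snd].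
have F0 z : (0 <= F z)%E.
  by rewrite lee_fin !mulr_ge0 // powR_ge0.
have Fx x : (\int[mu]_t F (x, t) = ((fun x => \int[mu]_(t in I) g x t) \_ I) x)%E.
  rewrite patchE; case: ifPn => [xI|xI].
    rewrite [RHS]integral_mkcond; apply: eq_integral => t _.
    rewrite /F /= indicE xI mul1r patchE indicE; case: ifPn => _; rewrite ?mul1r ?mul0r //.
  apply: integral0_eq => t _; by rewrite /F /= indicE (negbTE xI) !mul0r.
have Ft t : (\int[mu]_x F (x, t) =
    ((fun t => (`|phi t|)%:E * \int[mu]_(y in I) (`|P y| `^ p)%:E) \_ I) t)%E.
  rewrite patchE; case: ifPn => [tI|tI]; last first.
    by apply: integral0_eq => x _; rewrite /F /= [\1_I t]indicE (negbTE tI) mulr0 !mul0r.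
  transitivity (\int[mu]_(x in I) ((`|phi t|)%:E * (`|P (x - t)| `^ p)%:E))%E.
    rewrite [RHS]integral_mkcond; apply: eq_integral => x _.
    rewrite /F /= [\1_I t]indicE tI mulr1 patchE indicE -EFinM.
    by case: ifPn => _; rewrite ?mul1r ?mul0r.
  rewrite ge0_integralZl_EFin //; last first.
    apply/measurable_EFinP; apply: measurable_funTS; apply: (measurableT_comp mPp).
    by apply: measurable_funB => //; exact: measurable_id.
  congr (_ * _)%E.
  apply: (@periodic_integral_shift R (fun y => (`|P y| `^ p)%:E)).
  - exact/measurable_EFinP.
  - by move=> x; rewrite lee_fin powR_ge0.
  - by move=> x; rewrite pP.
  - exact: set_mem.
have Tonelli := @fubini_tonelli _ _ _ _ R mu mu F mF F0.
have SE x : ((`|S x| `^ p)%:E <= \int[mu]_(t in I) g x t)%E.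
  have mnPx : measurable_fun setT (fun t : R => `|P (x - t)|) by exact: continuous_measurable.
  have H := @jensen_powR phi (fun t => `|P (x - t)|) A p p1 mphi phi1 mnPx.
  have {}H := H (fun t => introT andP (conj (normr_ge0 _) (PA _))).
  have ig : mu.-integrable I (EFin \o (fun t => `|phi t| * `|P (x - t)| `^ p)).
    apply: (@integrable_mul_bounded _ _ (A `^ p)); first exact: integrable_norm.
      exact: measurable_funTS (measurableT_comp (measurable_powR p) mnPx).
    by move=> t _; exact: PAp.
  have -> : (\int[mu]_(t in I) g x t)%E = (Rintegral mu I (fun t => `|phi t| * `|P (x - t)| `^ p))%:E.
    by rewrite (EFin_Rintegral ig).
  have SY : `|S x| <= Rintegral mu I (fun t => `|phi t| * `|P (x - t)|).
    have := normr_Rintegral_le (integrable_mul_continuous iphi (cPx x)).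
    by rewrite -ES; under eq_Rintegral do rewrite normrM.
  have J0 : 0 <= Rintegral mu I (fun t => `|phi t| * `|P (x - t)|).
    by apply: Rintegral_ge0 => t _; exact: mulr_ge0.
  rewrite lee_fin; refine (le_trans _ H).
  exact: (ge0_ler_powR (ltW p0) (normr_ge0 _) J0 SY).
have mnS : measurable_fun setT (fun x : R => `|S x|).
  apply: continuous_measurable => x.
  by apply: continuous_comp; [exact: cS|exact: norm_continuous].
have mSI : measurable_fun I (fun x : R => (`|S x| `^ p)%:E).
  apply/measurable_EFinP; exact: measurable_funTS (measurableT_comp (measurable_powR p) mnS).
have mSp : measurable_fun setT ((fun x : R => (`|S x| `^ p)%:E) \_ I).
  exact: (measurable_restrictT _ mI).1 mSI.
apply: (@le_trans _ _ (\int[mu]_x \int[mu]_t F (x, t))%E).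
  rewrite [leLHS]integral_mkcond; apply: (ge0_le_integral mu measurableT).
  - by move=> x _; rewrite patchE; case: ifPn => // _; rewrite lee_fin powR_ge0.
  - exact: mSp.
  - exact: measurable_fun_fubini_tonelli_F.
  - move=> x _; rewrite Fx !patchE; case: ifPn => // _; exact: SE.
rewrite Tonelli.
under eq_integral do rewrite Ft.
have C0 : (0 <= \int[mu]_(y in I) (`|P y| `^ p)%:E)%E.
  by apply: integral_ge0 => x _; rewrite lee_fin powR_ge0.
rewrite -integral_mkcond; exact: (integral_cst_mul_le mphi phi1 C0).
Qed.

End TrigIntegrals.

(** * Uniqueness of Fourier coefficients and Fourier inversion *)

Section FourierSeries.
Variable R : realType.
Local Notation mu := (@lebesgue_measure R).
Local Notation I := (@I02pi R).
Let mI := @measurable_I02pi R.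

Lemma Rintegral_add (u v : R -> R) :
  mu.-integrable I (EFin \o u) -> mu.-integrable I (EFin \o v) ->
  Rintegral mu I (fun x => u x + v x) = Rintegral mu I u + Rintegral mu I v.
Proof. by move=> iu iv; exact: (@RintegralD _ _ _ mu I u v mI iu iv). Qed.

Lemma Rintegral_scale (c : R) (u : R -> R) : mu.-integrable I (EFin \o u) ->
  Rintegral mu I (fun x => c * u x) = c * Rintegral mu I u.
Proof. by move=> iu; exact: (@RintegralZl _ _ _ mu I u c mI iu). Qed.

Lemma ae_neq (c : R) : {ae mu, forall x, x <> c}.
Proof.
exists [set c]; split; [exact: measurable_set1|exact: lebesgue_measure_set1|].
by move=> x /= /contrapT.
Qed.

Lemma ae_imply (P Q : R -> Prop) : {ae mu, forall x, P x} ->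
  (forall x, P x -> Q x) -> {ae mu, forall x, Q x}.
Proof.
by move=> [N [mN N0 PN]] PQ; exists N; split => // x /= nQ; apply: PN => Px; exact/nQ/PQ.
Qed.

Lemma ae_and (P Q : R -> Prop) : {ae mu, forall x, P x} -> {ae mu, forall x, Q x} ->
  {ae mu, forall x, P x /\ Q x}.
Proof.
move=> hP hQ; have F := ae_filter_ringOfSetsType mu.
exact: filterI hP hQ.
Qed.

Lemma Rintegral_dominated (f_ : nat -> R -> R) (f g : R -> R) :
  (forall n, measurable_fun I (f_ n)) -> measurable_fun I f ->
  mu.-integrable I (EFin \o g) -> (forall n x, `|f_ n x| <= g x) ->
  {ae mu, forall x, I x -> f_ n x @[n --> \oo] --> f x} ->
  Rintegral mu I (f_ n) @[n --> \oo] --> Rintegral mu I f.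
Proof.
move=> mf_ mf ig fg ae_f.
have mE : forall n, measurable_fun I (fun x => (f_ n x)%:E).
  by move=> n; apply/measurable_EFinP.
have mfE : measurable_fun I (EFin \o f) by apply/measurable_EFinP.
have cE : {ae mu, forall x, I x -> (f_ n x)%:E @[n --> \oo] --> (f x)%:E}.
  apply: (ae_imply ae_f) => x H Ix; apply/fine_cvgP; split; first exact: nearW.
  exact: H.
have gE : {ae mu, forall x n, I x -> (`|(f_ n x)%:E| <= (g x)%:E)%E}.
  by apply: aeW => x n _; rewrite lee_fin.
have [i1 _ i3] := @dominated_convergence _ _ R mu I mI
  (fun n x => (f_ n x)%:E) (fun x => (f x)%:E) (fun x => (g x)%:E) mE mfE cE ig gE.
apply: fine_cvg; rewrite EFin_Rintegral //; exact: i3.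
Qed.

Lemma continuous_add_fun (f g : R -> R) :
  continuous f -> continuous g -> continuous (fun x => f x + g x).
Proof. by move=> cf cg x; apply: continuousD; [exact: cf|exact: cg]. Qed.

Lemma continuous_cmul_fun (c : R) (f : R -> R) :
  continuous f -> continuous (fun x => c * f x).
Proof. by move=> cf x; apply: continuousM; [exact: cst_continuous|exact: cf]. Qed.

(** Its increment in t from 0 to b, divided by 2 pi, is the Fejer mean at x of the indicator of
    [0, b]. The explicit form shows that, for fixed t, it is a trigonometric polynomial in x. *)
Definition fejer_primitive N (x t : R) : R :=
  t + 2 * \sum_(i < N) (1 - i.+1%:R / N%:R) / i.+1%:R *
    cos (i.+1%:R * x - (i.+1%:R * t - pi / 2)).

Lemma is_derive_sum_ord N (g dg : nat -> R -> R) (t : R) :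
  (forall i, is_derive t 1 (g i) (dg i t)) ->
  is_derive t 1 (fun t => \sum_(i < N) g i t) (\sum_(i < N) dg i t).
Proof.
move=> H; elim: N => [|N IH].
  under eq_fun do rewrite big_ord0; rewrite big_ord0; exact: is_derive_cst.
under eq_fun do rewrite big_ord_recr /=; rewrite big_ord_recr /=.
exact: is_deriveD.
Qed.

Lemma is_derive_fejer_primitive N (x t : R) :
  is_derive t 1 (fejer_primitive N x) (fejer N (x - t)).
Proof.
have H i : is_derive t 1 (fun t : R => (1 - i.+1%:R / N%:R) / i.+1%:R *
    cos (i.+1%:R * x - (i.+1%:R * t - pi / 2)))
    ((1 - i.+1%:R / N%:R) * cos ((1 + i)%:R * (x - t) - 0)).
  have kn : i.+1%:R != 0 :> R by rewrite pnatr_eq0.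
  have -> : (fun t : R => (1 - i.+1%:R / N%:R) / i.+1%:R *
      cos (i.+1%:R * x - (i.+1%:R * t - pi / 2))) =
     ((1 - i.+1%:R / N%:R) / i.+1%:R) \*: (fun t : R => cos (- i.+1%:R * t - (- (i.+1%:R * x) - pi / 2))).
    apply/funext => z; rewrite /GRing.scale /=; congr (_ * cos _); ring.
  have -> : (1 - i.+1%:R / N%:R) * cos ((1 + i)%:R * (x - t) - 0) =
     ((1 - i.+1%:R / N%:R) / i.+1%:R) *: - (- i.+1%:R * sin (- i.+1%:R * t - (- (i.+1%:R * x) - pi / 2))).
    have -> : - i.+1%:R * t - (- (i.+1%:R * x) - pi / 2) = i.+1%:R * (x - t) + pi / 2 by ring.
    rewrite sinDpihalf add1n subr0 /GRing.scale /=.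
    set z := cos _; set d := 1 - _; field.
    by [].
  exact: is_deriveZ (is_derive_cos_affine _ _ _).
have H2 := is_deriveD (is_derive_id t 1) (is_deriveZ 2 (@is_derive_sum_ord N _ (fun i t => (1 - i.+1%:R / N%:R) * cos ((1 + i)%:R * (x - t) - 0)) t H)).
exact: H2.
Qed.

Lemma fejer_primitive_bounds N (x a b e : R) : (0 < N)%N -> a < b ->
  (forall t, a < t < b -> fejer N (x - t) <= e) ->
  0 <= fejer_primitive N x b - fejer_primitive N x a <= e * (b - a).
Proof.
move=> N0 ab H.
have [|c] := @MVT _ (fejer_primitive N x) (fun t => fejer N (x - t)) a b ab
    (fun t _ => is_derive_fejer_primitive N x t).
  apply: derivable_within_continuous => t _.
  by have [] := is_derive_fejer_primitive N x t.
rewrite in_itv/= => acb ->.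
rewrite mulr_ge0 ?fejer_ge0 ?subr_ge0 ?(ltW ab) //=.
by rewrite ler_wpM2r ?subr_ge0 ?(ltW ab) // H.
Qed.

Lemma fejer_primitive_period N x :
  fejer_primitive N x (2 * pi) - fejer_primitive N x 0 = 2 * pi.
Proof.
rewrite /fejer_primitive.
have -> : \sum_(i < N) (1 - i.+1%:R / N%:R) / i.+1%:R *
    cos (i.+1%:R * x - (i.+1%:R * (2 * pi) - pi / 2)) =
  \sum_(i < N) (1 - i.+1%:R / N%:R) / i.+1%:R * cos (i.+1%:R * x - (i.+1%:R * 0 - pi / 2)).
  apply: eq_bigr => i _; congr (_ * _).
  rewrite -(@cos_add2pi R i.+1 (i.+1%:R * x - (i.+1%:R * (2 * pi) - pi / 2))); congr cos; ring.
ring.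
Qed.

Lemma fejerN N (y : R) : fejer N (- y) = fejer N y.
Proof.
rewrite /fejer /cossum; congr (_ + _ * _); apply: eq_bigr => i _.
by rewrite !subr0 mulrN cosN.
Qed.

(** On this range sin(y/2) >= d/4, so the decay bound 2 / N is divided by (d/4)^2. *)
Lemma fejer_small N (y d : R) : (0 < N)%N -> 0 < d -> d <= y <= 2 * pi - d ->
  fejer N y <= 32 / d ^+ 2 / N%:R.
Proof.
move=> N0 d0 /andP[dy yd].
have y2 : 0 <= y <= 2 * pi by apply/andP; split; lra.
have ds : d / 4 <= sin (y / 2) by case: (sin_half_ge2 y2) => h; lra.
have F0 := @fejer_ge0 R N y N0.
have d40 : 0 < (d / 4) ^+ 2 by rewrite exprn_gt0 // divr_gt0.
have H : (d / 4) ^+ 2 * fejer N y <= 2 / N%:R.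
  apply: le_trans (fejer_decay y N0); rewrite ler_wpM2r //.
  by rewrite ler_pXn2r // nnegrE; lra.
have -> : 32 / d ^+ 2 / N%:R = 2 / N%:R / (d / 4) ^+ 2.
  by field; rewrite lt0r_neq0 //= pnatr_eq0 -lt0n.
by rewrite ler_pdivlMr // mulrC.
Qed.

Lemma cvg_harmonic_bound (u : nat -> R) (l K : R) :
  (forall n, `|l - u n| <= K / n.+1%:R) -> u n @[n --> \oo] --> l.
Proof.
move=> H.
have h : (K * harmonic n) @[n --> \oo] --> (0 : R).
  by rewrite -[X in _ --> X](mulr0 K); apply: cvgMr; exact: cvg_harmonic.
apply/cvgrPdist_le => e e0.
have /cvgrPdist_le /(_ e e0) := h.
apply: filterS => n; rewrite sub0r normrN => hn.
by apply: le_trans (H n) _; apply: le_trans hn; exact: ler_norm.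
Qed.

(** The error is the mass that the kernel centred at x puts on the wrong side of b: on [b, 2 pi] if
    x < b, since the total mass is 2 pi, and on [0, b] if x > b. There the distance to the centre
    modulo 2 pi is at least d, so the kernel is O(1/n). *)
Lemma fejer_indic_cvg (b x : R) : 0 < b < 2 * pi -> 0 < x < 2 * pi -> x <> b ->
  (fejer_primitive n.+1 x b - fejer_primitive n.+1 x 0) / (2 * pi) @[n --> \oo] -->
  (\1_(`[0, b]%classic) x : R).
Proof.
move=> /andP[b0 b2] /andP[x0 x2] xb.
have p0 := @pi2_gt0 R.
have [d [d0 Hd]] : exists d, 0 < d /\
    forall n, `|\1_(`[0, b]%classic) x - (fejer_primitive n.+1 x b - fejer_primitive n.+1 x 0) / (2 * pi)| <=
      (32 / d ^+ 2 / n.+1%:R * (2 * pi)) / (2 * pi).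
  have [xltb|bx|//] := ltgtP x b.
    (* For t in (b, 2 pi), t - x lies between b - x and 2 pi - x, so its distance to 0 and to 2 pi
       exceeds this minimum. *)
    exists (Num.min (b - x) x); split; first by rewrite lt_min subr_gt0 xltb.
    move=> n; set d := Num.min _ _.
    have d0 : 0 < d by rewrite lt_min subr_gt0 xltb.
    have [dx1 dx2] : d <= b - x /\ d <= x by rewrite !ge_min !lexx orbT.
    have -> : \1_(`[0, b]%classic) x = 1 :> R.
      by rewrite indicE mem_set //= in_itv/= !ltW.
    have Hf t : b < t < 2 * pi -> fejer n.+1 (x - t) <= 32 / d ^+ 2 / n.+1%:R.
      move=> /andP[bt t2].
      by rewrite -fejerN; apply: fejer_small => //; apply/andP; split; lra.
    have /andP[h1 h2] := @fejer_primitive_bounds n.+1 x b (2 * pi) _ isT b2 Hf.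
    have -> // : 1 - (fejer_primitive n.+1 x b - fejer_primitive n.+1 x 0) / (2 * pi) =
      (fejer_primitive n.+1 x (2 * pi) - fejer_primitive n.+1 x b) / (2 * pi).
      have aux (P a1 a2 a3 : R) : 0 < P -> a3 - a1 = P -> 1 - (a2 - a1) / P = (a3 - a2) / P.
        by move=> P0 E; rewrite -{1}(divff (lt0r_neq0 P0)) -{1}E; ring.
      exact: aux p0 (fejer_primitive_period n.+1 x).
    rewrite ger0_norm ?divr_ge0 ?(ltW p0) // ler_pM2r ?invr_gt0 //.
    apply: le_trans h2 _; rewrite ler_wpM2l //; last by lra.
    by rewrite !divr_ge0 ?sqr_ge0.
  exists (Num.min (x - b) (2 * pi - x)); split; first by rewrite lt_min !subr_gt0 bx.
  move=> n; set d := Num.min _ _.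
  have d0 : 0 < d by rewrite lt_min !subr_gt0 bx.
  have [dx1 dx2] : d <= x - b /\ d <= 2 * pi - x by rewrite !ge_min !lexx orbT.
  have -> : \1_(`[0, b]%classic) x = 0 :> R.
    by rewrite indicE memNset //= in_itv/= => /andP[_]; apply/negP; rewrite -ltNge.
  have Hf t : 0 < t < b -> fejer n.+1 (x - t) <= 32 / d ^+ 2 / n.+1%:R.
    move=> /andP[t0 tb].
    by apply: fejer_small => //; apply/andP; split; lra.
  have /andP[h1 h2] := @fejer_primitive_bounds n.+1 x 0 b _ isT b0 Hf.
  rewrite sub0r normrN ger0_norm ?divr_ge0 ?(ltW p0) // ler_pM2r ?invr_gt0 //.
  apply: le_trans h2 _; rewrite ler_wpM2l //; last by lra.
  by rewrite !divr_ge0 ?sqr_ge0.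
apply: (@cvg_harmonic_bound _ _ (32 / d ^+ 2)) => n.
apply: le_trans (Hd n) _.
by rewrite mulfK // lt0r_neq0.
Qed.

(** Supplies the domination: the primitive is monotone in t with total increment 2 pi. *)
Lemma fejer_indic_le1 N (b x : R) : (0 < N)%N -> 0 < b < 2 * pi ->
  `|(fejer_primitive N x b - fejer_primitive N x 0) / (2 * pi)| <= 1.
Proof.
move=> N0 /andP[b0 b2]; have p0 := @pi2_gt0 R.
have mon a c : a < c -> fejer_primitive N x a <= fejer_primitive N x c.
  move=> ac.
  have [|z] := @MVT _ (fejer_primitive N x) (fun t => fejer N (x - t)) a c ac
    (fun t _ => is_derive_fejer_primitive N x t).
    apply: derivable_within_continuous => t _.
    by have [] := is_derive_fejer_primitive N x t.
  by move=> _; rewrite -subr_ge0 => ->; rewrite mulr_ge0 ?fejer_ge0 ?subr_ge0 ?ltW.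
have m1 := mon _ _ b0; have m2 := mon _ _ b2.
have per := fejer_primitive_period N x.
rewrite ger0_norm; last by rewrite divr_ge0 ?subr_ge0 // ltW.
rewrite ler_pdivrMr // mul1r; lra.
Qed.

Lemma fejer_primitive_continuous N t : continuous (fun x => fejer_primitive N x t).
Proof.
apply: (@continuous_add_fun (fun=> t)); first exact: cst_continuous.
apply: continuous_cmul_fun.
apply: (@sum_continuous R N (fun i x => (1 - i.+1%:R / N%:R) / i.+1%:R *
    cos (i.+1%:R * x - (i.+1%:R * t - pi / 2)))) => i.
by apply: continuous_cmul_fun; exact: cos_affine_continuous.
Qed.

Lemma Rintegral_mul_fejer_primitive (u : R -> R) N t :
  mu.-integrable I (EFin \o u) ->
  (forall (k : nat) th, Rintegral mu I (fun x => u x * cos (k%:R * x - th)) = 0) ->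
  Rintegral mu I (fun x => u x * fejer_primitive N x t) = 0.
Proof.
move=> iu u0.
have u00 : Rintegral mu I u = 0.
  rewrite -(u0 0%N 0); apply: eq_Rintegral => x _.
  by rewrite mul0r subr0 cos0 mulr1.
pose g i (x : R) := (1 - i.+1%:R / N%:R) / i.+1%:R *
    cos (i.+1%:R * x - (i.+1%:R * t - pi / 2)).
have cg i : continuous (g i).
  by apply: continuous_cmul_fun; exact: cos_affine_continuous.
have icos k th : mu.-integrable I (EFin \o (fun x => u x * cos (k * x - th))).
  by apply: integrable_mul_continuous iu _; exact: cos_affine_continuous.
have -> : (fun x => u x * fejer_primitive N x t) =
    (fun x => t * u x + 2 * (u x * \sum_(i < N) g i x)).
  by apply/funext => x; rewrite /fejer_primitive -/(g _ _); ring.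
have iug : mu.-integrable I (EFin \o (fun x => u x * \sum_(i < N) g i x)).
  by apply: integrable_mul_continuous iu _; exact: sum_continuous.
have i1 : mu.-integrable I (EFin \o (fun x => t * u x)) by exact: integrable_scale.
have i2 : mu.-integrable I (EFin \o (fun x => 2 * (u x * \sum_(i < N) g i x))).
  exact: integrable_scale.
rewrite (Rintegral_add i1 i2).
rewrite (Rintegral_scale _ iu) u00 mulr0 add0r (Rintegral_scale _ iug).
rewrite (Rintegral_mul_sum N iu cg) big1 ?mulr0 // => i _.
have -> : (fun x => u x * g i x) = (fun x => (1 - i.+1%:R / N%:R) / i.+1%:R *
   (u x * cos (i.+1%:R * x - (i.+1%:R * t - pi / 2)))).
  by apply/funext => x; rewrite /g mulrCA.
by rewrite (Rintegral_scale _ (icos _ _)) u0 mulr0.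
Qed.

Lemma Rintegral_initial_eq0 (u : R -> R) (b : R) :
  mu.-integrable I (EFin \o u) ->
  (forall (k : nat) th, Rintegral mu I (fun x => u x * cos (k%:R * x - th)) = 0) ->
  0 < b < 2 * pi -> Rintegral mu I (fun x => u x * \1_(`[0, b]%classic) x) = 0.
Proof.
move=> iu u0 b02.
pose T n x := (fejer_primitive n.+1 x b - fejer_primitive n.+1 x 0) / (2 * pi).
have mu_ : measurable_fun I u by have /integrableP[/measurable_EFinP] := iu.
have cT n : continuous (T n).
  have -> : T n = (fun x => (2 * pi)^-1 * (fejer_primitive n.+1 x b + -1 * fejer_primitive n.+1 x 0)).
    by apply/funext => x; rewrite /T; ring.
  apply: continuous_cmul_fun; apply: continuous_add_fun; first exact: fejer_primitive_continuous.
  by apply: continuous_cmul_fun; exact: fejer_primitive_continuous.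
have mind : measurable_fun I (\1_(`[0, b]%classic) : R -> R).
  by apply: measurable_funTS; exact: measurable_indic.
have H := @Rintegral_dominated (fun n x => u x * T n x) (fun x => u x * \1_(`[0, b]%classic) x)
  (fun x => `|u x|).
have cv : Rintegral mu I (fun x => u x * T n x) @[n --> \oo] -->
    Rintegral mu I (fun x => u x * \1_(`[0, b]%classic) x).
  apply: H.
  - by move=> n; apply: measurable_funM => //; exact: continuous_measurable.
  - exact: measurable_funM.
  - exact: integrable_norm.
  - by move=> n x; rewrite normrM ler_piMr // fejer_indic_le1.
  - apply: (ae_imply (ae_and (ae_neq 0) (ae_and (ae_neq b) (ae_neq (2 * pi))))).
    move=> x [x0 [xb x2]]; rewrite /I02pi /= in_itv/= => /andP[h1 h2].
    apply: cvgMr; apply: fejer_indic_cvg => //.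
    by rewrite !lt_neqAle h1 h2 !andbT; apply/andP; split; apply/eqP => // /esym.
have z n : Rintegral mu I (fun x => u x * T n x) = 0.
  have ip t : mu.-integrable I (EFin \o (fun x => u x * fejer_primitive n.+1 x t)).
    by apply: integrable_mul_continuous iu _; exact: fejer_primitive_continuous.
  have -> : (fun x => u x * T n x) = (fun x => (2 * pi)^-1 *
     (u x * fejer_primitive n.+1 x b + -1 * (u x * fejer_primitive n.+1 x 0))).
    by apply/funext => x; rewrite /T; ring.
  have ip0 : mu.-integrable I (EFin \o (fun x => -1 * (u x * fejer_primitive n.+1 x 0))).
    exact: integrable_scale.
  rewrite (Rintegral_scale _ (integrable_add (ip b) ip0)) (Rintegral_add (ip b) ip0).
  by rewrite (Rintegral_scale _ (ip 0)) !Rintegral_mul_fejer_primitive // mulr0 addr0 mulr0.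
have E : (fun n => Rintegral mu I (fun x => u x * T n x)) = (fun=> 0) by apply/funext.
rewrite E in cv; apply: (cvg_unique _ cv); first exact: Rhausdorff.
exact: cvg_cst.
Qed.

(** The integral of u over [0, x] vanishes for every x in (0, 2 pi), being a limit of integrals
    against trigonometric polynomials. By Lebesgue differentiation its derivative is u almost
    everywhere. *)
Lemma fourier_unique (u : R -> R) : mu.-integrable I (EFin \o u) ->
  (forall (k : nat) th, Rintegral mu I (fun x => u x * cos (k%:R * x - th)) = 0) ->
  {ae mu, forall x, I x -> u x = 0}.
Proof.
move=> iu u0.
pose ut := u \_ I.
have iut : mu.-integrable setT (EFin \o ut).
  by have := iu; rewrite integrable_mkcond //= (restrict_EFin u).
have lut : locally_integrable setT ut by exact: integrable_locally mI iu.
pose F x := Rintegral mu `[0, x] ut.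
have F0 x : 0 < x < 2 * pi -> F x = 0.
  move=> /[dup] x02 /andP[x0 x2]; rewrite -(Rintegral_initial_eq0 iu u0 x02) /F.
  rewrite Rintegral_mkcond [RHS]Rintegral_mkcond; apply: eq_Rintegral => t _.
  rewrite /ut /patch indicE.
  case: ifPn => [tx|tx].
    by case: ifPn => _ //; rewrite mulr1.
  by case: ifPn => _; rewrite ?mulr0.
have i0 y : mu.-integrable [set` Interval (BLeft 0) (BRight y)] (EFin \o ut).
  by apply: integrableS iut.
have ftc := FTC1 i0 lut.
apply: (ae_imply (ae_and ftc (ae_and (ae_neq 0) (ae_neq (2 * pi))))).
move=> x [H [x0 x2]]; rewrite /I02pi /= in_itv/= => /andP[h1 h2].
have x02 : 0 < x < 2 * pi.
  by rewrite !lt_neqAle h1 h2 !andbT; apply/andP; split; apply/eqP => // /esym.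
have /andP[x0' x2'] := x02.
have [|_ dF] := H; first by rewrite /= lte_fin.
have <- : ut x = u x.
  by rewrite /ut patchE mem_set // /I02pi /= in_itv/= h1 h2.
rewrite -dF derive1E (@near_eq_derive _ _ _ _ (cst 0)).
  exact: derive_cst.
near=> y; apply: F0; apply/andP; split.
  by near: y; exact: lt_nbhsr.
by near: y; exact: lt_nbhsl.
Unshelve. all: by end_near.
Qed.

Lemma inL1_integrable (f : R -> R) : inL1 f -> mu.-integrable I (EFin \o f).
Proof.
move=> [_ mf fi]; apply/integrableP; split; last exact: fi.
by apply/measurable_EFinP; exact: measurable_funTS.
Qed.

Lemma fourier_coef (f : R -> R) (k : nat) (th : R) : inL1 f ->
  Rintegral mu I (fun x => f x * cos (k%:R * x - th)) =
  2 * pi * (fre f k%:Z * cos th - fim f k%:Z * sin th).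
Proof.
move=> f1; have [pf mf _] := f1; have iu := inL1_integrable f1.
have mc : measurable_fun setT (fun t : R => cos (k%:R * t - 0)).
  by apply: continuous_measurable; exact: cos_affine_continuous.
have ms : measurable_fun setT (fun t : R => cos (k%:R * t - pi / 2)).
  by apply: continuous_measurable; exact: cos_affine_continuous.
have per th' : periodic2pi (fun t => f t * cos (k%:R * t - th')).
  move=> x; rewrite pf; congr (_ * _).
  by rewrite -(@cos_add2pi R k (k%:R * x - th')); congr cos; ring.
have ic th' : mu.-integrable I (EFin \o (fun x => f x * cos (k%:R * x - th'))).
  by apply: integrable_mul_continuous iu _; exact: cos_affine_continuous.
have pn : 2 * pi != 0 :> R by rewrite lt0r_neq0 // pi2_gt0.
have E1 : Rintegral mu I (fun x => f x * cos (k%:R * x - 0)) = 2 * pi * fre f k%:Z.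
  rewrite /fre mulrA divff // mul1r -periodic_Rintegral //; last exact: measurable_funM.
  by apply: eq_Rintegral => x _; rewrite subr0.
have E2 : Rintegral mu I (fun x => f x * cos (k%:R * x - pi / 2)) = - (2 * pi * fim f k%:Z).
  rewrite /fim mulrN opprK mulrA divff // mul1r -periodic_Rintegral //; last exact: measurable_funM.
  by apply: eq_Rintegral => x _; rewrite cosBpihalf.
have -> : (fun x => f x * cos (k%:R * x - th)) =
  (fun x => cos th * (f x * cos (k%:R * x - 0)) + sin th * (f x * cos (k%:R * x - pi / 2))).
  by apply/funext => x; rewrite subr0 cosBpihalf cosB; ring.
have i1 : mu.-integrable I (EFin \o (fun x => cos th * (f x * cos (k%:R * x - 0)))).
  exact: integrable_scale.
have i2 : mu.-integrable I (EFin \o (fun x => sin th * (f x * cos (k%:R * x - pi / 2)))).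
  exact: integrable_scale.
rewrite (Rintegral_add i1 i2) (Rintegral_scale _ (ic _)) (Rintegral_scale _ (ic _)) E1 E2; ring.
Qed.

(** For real f the Fourier terms of frequencies k and - k are conjugate, and this is their sum. At k
    = 0 it would count the mean twice, so partial sums keep [fre f 0] apart. *)
Definition harmonic_term (f : R -> R) (k : nat) (x : R) : R :=
  2 * (fre f k%:Z * cos (k%:R * x) - fim f k%:Z * sin (k%:R * x)).

Lemma harmonic_term_continuous f k : continuous (harmonic_term f k).
Proof.
have -> : harmonic_term f k = (fun x => 2 * (fre f k%:Z * cos (k%:R * x - 0) +
    - fim f k%:Z * cos (k%:R * x - pi / 2))).
  by apply/funext => x; rewrite /harmonic_term subr0 cosBpihalf; ring.
apply: continuous_cmul_fun; apply: continuous_add_fun;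
  by apply: continuous_cmul_fun; exact: cos_affine_continuous.
Qed.

Lemma harmonic_term_coef f (k m : nat) th : (0 < k)%N ->
  Rintegral mu I (fun x => cos (m%:R * x - th) * harmonic_term f k x) =
  if k == m then 2 * pi * (fre f m%:Z * cos th - fim f m%:Z * sin th) else 0.
Proof.
move=> k0.
have ic th' : mu.-integrable I (EFin \o (fun x => cos (k%:R * x - th') * cos (m%:R * x - th))).
  apply: integrable_mul_continuous; last exact: cos_affine_continuous.
  by apply: continuous_integrable_I; exact: cos_affine_continuous.
have -> : (fun x => cos (m%:R * x - th) * harmonic_term f k x) =
  (fun x => (2 * fre f k%:Z) * (cos (k%:R * x - 0) * cos (m%:R * x - th)) +
   (- (2 * fim f k%:Z)) * (cos (k%:R * x - pi / 2) * cos (m%:R * x - th))).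
  by apply/funext => x; rewrite /harmonic_term subr0 cosBpihalf; ring.
have i1 : mu.-integrable I (EFin \o (fun x => (2 * fre f k%:Z) * (cos (k%:R * x - 0) * cos (m%:R * x - th)))).
  exact: integrable_scale.
have i2 : mu.-integrable I (EFin \o (fun x => (- (2 * fim f k%:Z)) * (cos (k%:R * x - pi / 2) * cos (m%:R * x - th)))).
  exact: integrable_scale.
rewrite (Rintegral_add i1 i2) (Rintegral_scale _ (ic _)) (Rintegral_scale _ (ic _)).
rewrite !integral_cos_cos //; case: eqP => [->|_]; last by rewrite !mulr0 addr0.
by rewrite sub0r cosN -[pi / 2 - th]opprB cosN cosBpihalf; ring.
Qed.

(** The series converges absolutely to some g and its partial sums share one bound, so dominated
    convergence gives g the coefficients of f; uniqueness then identifies the two almost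
    everywhere. *)
Lemma fourier_inversion (f : R -> R) (e : nat -> R) (E : R) : inL1 f ->
  (forall k, `|fre f k.+1%:Z| + `|fim f k.+1%:Z| <= e k) ->
  (forall N, \sum_(k < N) e k <= E) ->
  {ae mu, forall x, I x ->
    fre f 0 + \sum_(k < n) harmonic_term f k.+1 x @[n --> \oo] --> f x}.
Proof.
move=> f1 fe eE; have iu := inL1_integrable f1.
have [pf mf _] := f1.
have e0 k : 0 <= e k by apply: le_trans (fe k); rewrite addr_ge0.
have te k x : `|harmonic_term f k.+1 x| <= 2 * e k.
  rewrite /harmonic_term normrM [`|2|]ger0_norm // ler_pM2l //.
  apply: le_trans (ler_normB _ _) _; apply: le_trans (fe k).
  rewrite !normrM; apply: lerD; rewrite ler_piMr //; [exact: cos_max|exact: sin_max].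
pose S n x := fre f 0 + \sum_(k < n) harmonic_term f k.+1 x.
have cS n : continuous (S n).
  apply: (@continuous_add_fun (fun=> fre f 0)); first exact: cst_continuous.
  by apply: (@sum_continuous R n (fun k => harmonic_term f k.+1)) => k; exact: harmonic_term_continuous.
pose M := `|fre f 0| + 2 * E.
have SM n x : `|S n x| <= M.
  apply: le_trans (ler_normD _ _) _; rewrite lerD2l.
  apply: le_trans (ler_norm_sum _ _ _) _.
  apply: (@le_trans _ _ (\sum_(k < n) 2 * e k)); first exact: ler_sum.
  by rewrite -mulr_sumr ler_pM2l.
have cvS x : cvgn (S^~ x).
  have H : cvgn (series (fun k => harmonic_term f k.+1 x)).
    apply: normed_cvg.
    have -> : [normed series (fun k => harmonic_term f k.+1 x)] =
        (fun n => \sum_(k < n) `|harmonic_term f k.+1 x|).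
      by rewrite /normed_series_of seriesEord.
    apply: nondecreasing_is_cvgn.
      by apply/nondecreasing_seqP => n; rewrite big_ord_recr lerDl.
    exists (2 * E) => _ [n _ <-].
    apply: (@le_trans _ _ (\sum_(k < n) 2 * e k)); first exact: ler_sum.
    by rewrite -mulr_sumr ler_pM2l.
  have -> : S^~ x = (fun n => fre f 0 + series (fun k => harmonic_term f k.+1 x) n).
    by apply/funext => n; rewrite /S /series /= big_mkord.
  by apply: is_cvgD => //; exact: is_cvg_cst.
pose g x := limn (S^~ x).
have Sg x : S n x @[n --> \oo] --> g x by exact: cvS.
have mS n : measurable_fun setT (S n) by exact: continuous_measurable.
have mg : measurable_fun setT g.
  by apply: (@measurable_fun_cvg _ _ _ _ S) => // x _; exact: Sg.
have gM x : `|g x| <= M.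
  have h : `|S n x| @[n --> \oo] --> `|g x| by apply: cvg_norm; exact: Sg.
  rewrite -(cvg_lim (@Rhausdorff R) h); apply: limr_le; first exact: cvgP h.
  by apply: nearW => n; exact: SM.
have icst (c : R) : mu.-integrable I (EFin \o (fun=> c)).
  by apply: continuous_integrable_I; exact: cst_continuous.
have ig : mu.-integrable I (EFin \o g).
  have := @integrable_mul_bounded R (fun=> 1) g M (icst 1) (measurable_funTS mg) (fun x _ => gM x).
  by have -> : (fun x => 1 * g x) = g by apply/funext => x; rewrite mul1r.
have coefg (m : nat) th : Rintegral mu I (fun x => g x * cos (m%:R * x - th)) =
    Rintegral mu I (fun x => f x * cos (m%:R * x - th)).
  have cv : Rintegral mu I (fun x => S n x * cos (m%:R * x - th)) @[n --> \oo] -->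
      Rintegral mu I (fun x => g x * cos (m%:R * x - th)).
    have mc : measurable_fun setT (fun t : R => cos (m%:R * t - th)).
      by apply: continuous_measurable; exact: cos_affine_continuous.
    apply: (@Rintegral_dominated _ _ (fun=> M)).
    - by move=> n; apply: measurable_funTS; apply: measurable_funM.
    - by apply: measurable_funTS; apply: measurable_funM.
    - exact: icst.
    - by move=> n x; rewrite normrM -[M]mulr1; apply: ler_pM => //; exact: cos_max.
    - by apply: aeW => x _; apply: cvgMl; exact: Sg.
  (* Once n >= m the partial sum has exactly the m-th coefficient of f. *)
  have ev : \forall n \near \oo, Rintegral mu I (fun x => f x * cos (m%:R * x - th)) =
      Rintegral mu I (fun x => S n x * cos (m%:R * x - th)).
    exists m => // n /= mn; rewrite fourier_coef //.
    have icos : mu.-integrable I (EFin \o (fun x => cos (m%:R * x - th))).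
      by apply: continuous_integrable_I; exact: cos_affine_continuous.
    have ct k : continuous (harmonic_term f k.+1) by exact: harmonic_term_continuous.
    have -> : (fun x => S n x * cos (m%:R * x - th)) =
      (fun x => fre f 0 * cos (m%:R * x - th) +
        cos (m%:R * x - th) * \sum_(k < n) harmonic_term f k.+1 x).
      by apply/funext => x; rewrite /S; ring.
    have i1 : mu.-integrable I (EFin \o (fun x => fre f 0 * cos (m%:R * x - th))).
      exact: integrable_scale.
    have i2 : mu.-integrable I (EFin \o (fun x => cos (m%:R * x - th) * \sum_(k < n) harmonic_term f k.+1 x)).
      by apply: integrable_mul_continuous icos _; apply: (@sum_continuous R n (fun k => harmonic_term f k.+1)).
    rewrite (Rintegral_add i1 i2) (Rintegral_scale _ icos) integral_cos.
    rewrite (Rintegral_mul_sum n icos ct).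
    under eq_bigr do rewrite harmonic_term_coef //.
    case: m mn {cv icos i1 i2} => [|m] mn.
      rewrite big1 //= addr0.
      have -> : fim f 0%:Z = 0.
        rewrite /fim; under eq_Rintegral do rewrite mul0r sin0 mulr0.
        by rewrite /Rintegral integral0 /= mulr0 oppr0.
      by rewrite mul0r subr0; ring.
    rewrite mulr0 add0r (bigD1 (Ordinal mn)) //= eqxx big1 ?addr0 // => i im.
    by rewrite ifN // eqSS; apply: contraNneq im => im; apply/eqP/val_inj.
  apply: (cvg_unique _ cv); first exact: Rhausdorff.
  by apply: cvg_near_cst; apply: filterS ev => n ->.
have ifg : mu.-integrable I (EFin \o (fun x => f x + -1 * g x)).
  by apply: integrable_add => //; exact: integrable_scale.
have U := @fourier_unique (fun x => f x + -1 * g x) ifg.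
have {}U : {ae mu, forall x, I x -> f x + -1 * g x = 0}.
  apply: U => k th.
  have i1 : mu.-integrable I (EFin \o (fun x => f x * cos (k%:R * x - th))).
    by apply: integrable_mul_continuous iu _; exact: cos_affine_continuous.
  have i2 : mu.-integrable I (EFin \o (fun x => g x * cos (k%:R * x - th))).
    by apply: integrable_mul_continuous ig _; exact: cos_affine_continuous.
  have i3 : mu.-integrable I (EFin \o (fun x => -1 * (g x * cos (k%:R * x - th)))).
    exact: integrable_scale.
  have -> : (fun x => (f x + -1 * g x) * cos (k%:R * x - th)) =
    (fun x => f x * cos (k%:R * x - th) + -1 * (g x * cos (k%:R * x - th))).
    by apply/funext => x; ring.
  by rewrite (Rintegral_add i1 i3) (Rintegral_scale _ i2) coefg mulN1r subrr.
apply: (ae_imply U) => x H Ix.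
have -> : f x = g x by have := H Ix; rewrite mulN1r => /subr0_eq.
exact: Sg.
Qed.

End FourierSeries.

(** * Fourier remainders of class members in L_s *)

Section FourierTail.
Variable R : realType.
Local Notation mu := (@lebesgue_measure R).
Local Notation I := (@I02pi R).
Let mI := @measurable_I02pi R.

Lemma cvg_powR (u : nat -> R) (l s : R) : 0 < s -> (forall n, 0 <= u n) ->
  u n @[n --> \oo] --> l -> u n `^ s @[n --> \oo] --> l `^ s.
Proof.
move=> s0 u0 ul.
have l0 : 0 <= l.
  by rewrite -(cvg_lim (@Rhausdorff R) ul); apply: limr_ge; [exact: cvgP ul|exact: nearW].
move: l0; rewrite le_eqVlt => /predU1P[l0|l0].
  rewrite -l0 powR0 ?lt0r_neq0 //; apply/cvgrPdist_lt => e e0.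
  have ei0 : 0 < e `^ s^-1 by exact: powR_gt0.
  move: ul => /cvgrPdist_lt /(_ _ ei0); apply: filterS => n.
  rewrite -l0 !sub0r !normrN !ger0_norm ?powR_ge0 // => H.
  have -> : e = (e `^ s^-1) `^ s by rewrite -powRrM mulVf ?lt0r_neq0 // powRr1 // ltW.
  by apply: gt0_ltr_powR => //; rewrite nnegrE ?powR_ge0.
apply: (@continuous_cvg _ _ _ _ _ u (fun z => z `^ s)) ul.
apply: differentiable_continuous; apply/derivable1_diffP.
by apply: derivable_powR; rewrite in_itv/= andbT.
Qed.

Lemma fatou_Lp (F : nat -> R -> R) (G : R -> R) (s : R) (B : \bar R) : 0 < s ->
  (forall n, continuous (F n)) -> measurable_fun I G ->
  {ae mu, forall x, I x -> F n x @[n --> \oo] --> G x} ->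
  (forall n, (\int[mu]_(x in I) (`|F n x| `^ s)%:E <= B)%E) ->
  (\int[mu]_(x in I) (`|G x| `^ s)%:E <= B)%E.
Proof.
move=> s0 cF mG FG FB.
pose h n x := (`|F n x| `^ s)%:E.
have mh n : measurable_fun I (h n).
  apply/measurable_EFinP; apply: (measurableT_comp (measurable_powR s)).
  apply: continuous_measurable => x.
  by apply: continuous_comp; [exact: cF|exact: norm_continuous].
have h0 n x : I x -> (0 <= h n x)%E by move=> _; rewrite lee_fin powR_ge0.
have fat := fatou mu mI mh h0.
(* Measurability of the lower limit is reduced to that of an upper limit by a change of sign. *)
have einfE (u : nat -> \bar R) : limn_einf u = (- limn_esup (fun n => - u n))%E.
  by rewrite -[LHS]oppeK -limn_esupN.
have mliminf : measurable_fun I (fun x => limn_einf (h^~ x)).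
  under eq_fun do rewrite einfE.
  apply: measurableT_comp => //; apply: measurable_fun_limn_esup => // n.
  exact: measurableT_comp.
have mGs : measurable_fun I (fun x => (`|G x| `^ s)%:E).
  apply/measurable_EFinP; apply: (measurableT_comp (measurable_powR s)).
  exact: measurableT_comp.
have ge0 (u : nat -> \bar R) : (forall n, (0 <= u n)%E) -> (0 <= limn_einf u)%E.
  move=> u0; rewrite limn_einf_lim; apply: lime_ge; first exact: is_cvg_einfs.
  by apply: nearW => n; apply: le_ereal_inf_tmp => _ [k _ <-].
have leB (u : nat -> \bar R) : (forall n, (u n <= B)%E) -> (limn_einf u <= B)%E.
  move=> uB; rewrite limn_einf_lim; apply: lime_le; first exact: is_cvg_einfs.
  apply: nearW => n; apply: le_trans (uB n); apply: ereal_inf_lbound.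
  by exists n => /=.
apply: le_trans (leB _ FB); apply: le_trans fat.
apply: (@ae_ge0_le_integral _ _ _ mu I mI) => //.
- by move=> x Ix; apply: ge0 => n; exact: h0.
- apply: (ae_imply FG) => x H Ix.
  have c : h n x @[n --> \oo] --> (`|G x| `^ s)%:E.
    apply/fine_cvgP; split; first exact: nearW.
    apply: (@cvg_powR (fun n => `|F n x|)) => //.
    by apply: cvg_norm; exact: H.
  by rewrite (cvg_limn_einf_sup c).1.
Qed.

Lemma freN (f : R -> R) (k : int) : fre f (- k) = fre f k.
Proof.
rewrite /fre; congr (_ * _); apply: eq_Rintegral => t _.
by rewrite mulrNz mulNr cosN.
Qed.

Lemma fimN (f : R -> R) (k : nat) : inL1 f -> fim f (- k%:Z) = - fim f k%:Z.
Proof.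
move=> f1; have [pf mf _] := f1.
have pn : 2 * pi != 0 :> R by rewrite lt0r_neq0 // pi2_gt0.
have -> : fim f (- k%:Z) = - ((2 * pi)^-1 * Rintegral mu I (fun t => f t * cos (k%:R * t - - (pi / 2)))).
  rewrite /fim -periodic_Rintegral.
  - congr (- (_ * _)); apply: eq_Rintegral => t _; congr (_ * _).
    by rewrite opprK cosDpihalf mulrNz mulNr sinN.
  - apply: measurable_funM => //; apply: continuous_measurable; exact: cos_affine_continuous.
  - move=> x; rewrite pf; congr (_ * _).
    by rewrite -(@cos_add2pi R k (k%:R * x - - (pi / 2))); congr cos; ring.
rewrite fourier_coef // cosN sinN cos_pihalf sin_pihalf mulr0 mulrN1 opprK add0r mulrA.
by rewrite mulVf // mul1r.
Qed.

Lemma fim0 (f : R -> R) : fim f 0 = 0.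
Proof.
rewrite /fim; under eq_Rintegral do rewrite mul0r sin0 mulr0.
by rewrite /Rintegral integral0 /= mulr0 oppr0.
Qed.

(** Each step adds a conjugate pair, so for real f a sum of Fourier terms over the list is real and
    grows by one [harmonic_term]. *)
Fixpoint sym_freqs (n : nat) : seq int :=
  if n is m.+1 then m.+1%:Z :: - m.+1%:Z :: sym_freqs m else [:: 0].

Lemma mem_sym_freqs n (k : int) : (k \in sym_freqs n) = (`|k| <= n)%N.
Proof.
elim: n => [|n IH]; first by rewrite inE leqn0 absz_eq0.
rewrite [sym_freqs _.+1]/= !inE IH [RHS]leq_eqVlt [(`|k| < n.+1)%N]ltnS orbA; congr (_ || _).
by case: k {IH} => j; rewrite ?orbF.
Qed.

Lemma sym_freqs_uniq n : uniq (sym_freqs n).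
Proof.
by elim: n => //= n ->; rewrite andbT inE negb_or -andbA !mem_sym_freqs abszN absz_nat ltnn.
Qed.

Lemma size_sym_freqs n : size (sym_freqs n) = (2 * n + 1)%N.
Proof. by elim: n => //= n ->; rewrite mulnS !add2n. Qed.

Lemma sum_sym_freqs_re (f : R -> R) n x : inL1 f ->
  \sum_(k <- sym_freqs n) (fre f k * cos (k%:~R * x) - fim f k * sin (k%:~R * x)) =
  fre f 0 + \sum_(i < n) harmonic_term f i.+1 x.
Proof.
move=> f1; elim: n => [|n IH].
  by rewrite /= big_seq1 big_ord0 mul0r cos0 sin0 mulr0 subr0 mulr1 addr0.
have E : (- n.+1%:Z)%:~R * x = - (n.+1%:R * x) by rewrite mulrNz mulNr.
rewrite /= ?NegzE !big_cons IH big_ord_recr /= freN fimN // E cosN sinN /harmonic_term.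
have -> : n.+1%:Z%:~R = n.+1%:R :> R by [].
by ring.
Qed.

Lemma sum_sym_freqs_im (f : R -> R) n x : inL1 f ->
  \sum_(k <- sym_freqs n) (fre f k * sin (k%:~R * x) + fim f k * cos (k%:~R * x)) = 0.
Proof.
move=> f1; elim: n => [|n IH].
  by rewrite /= big_seq1 mul0r sin0 mulr0 fim0 mul0r addr0.
have E : (- n.+1%:Z)%:~R * x = - (n.+1%:R * x) by rewrite mulrNz mulNr.
rewrite /= ?NegzE !big_cons IH freN fimN // E cosN sinN.
have -> : n.+1%:Z%:~R = n.+1%:R :> R by [].
by ring.
Qed.

Lemma sqrt_sum_sqr_le (a b : R) : Num.sqrt (a ^+ 2 + b ^+ 2) <= `|a| + `|b|.
Proof.
have h : 0 <= `|a| + `|b| by rewrite addr_ge0.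
rewrite -[leRHS]ger0_norm // -sqrtr_sqr ler_wsqrtr //.
rewrite sqrrD !real_normK ?num_real // [leRHS]addrAC lerDl.
by rewrite mulrn_wge0 // mulr_ge0.
Qed.

Lemma approx_err_sym (f : R -> R) n x : inL1 f ->
  approx_err f (sym_freqs n) x = `|f x - (fre f 0 + \sum_(i < n) harmonic_term f i.+1 x)|.
Proof.
by move=> f1; rewrite /approx_err sum_sym_freqs_re // sum_sym_freqs_im // expr0n addr0 sqrtr_sqr.
Qed.

(** A frequency added without its opposite makes the approximant complex; its real and imaginary
    parts each cost at most the size of the coefficient. *)
Lemma approx_err_cons (f : R -> R) (k : nat) n x : inL1 f ->
  approx_err f (k%:Z :: sym_freqs n) x <=
  `|f x - (fre f 0 + \sum_(i < n) harmonic_term f i.+1 x)| +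
  2 * (`|fre f k%:Z| + `|fim f k%:Z|).
Proof.
move=> f1; rewrite /approx_err !big_cons sum_sym_freqs_re // sum_sym_freqs_im // addr0.
set X := fre f 0 + _; set c := cos _; set s := sin _.
apply: le_trans (sqrt_sum_sqr_le _ _) _.
have c1 : `|c| <= 1 by exact: cos_max.
have s1 : `|s| <= 1 by exact: sin_max.
have h1 : `|fre f k * c - fim f k * s| <= `|fre f k| + `|fim f k|.
  by apply: le_trans (ler_normB _ _) _; rewrite !normrM; apply: lerD; rewrite ler_piMr.
have h2 : `|fre f k * s + fim f k * c| <= `|fre f k| + `|fim f k|.
  by apply: le_trans (ler_normD _ _) _; rewrite !normrM; apply: lerD; rewrite ler_piMr.
have h3 : `|f x - (fre f k * c - fim f k * s + X)| <= `|f x - X| + `|fre f k * c - fim f k * s|.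
  have -> : f x - (fre f k * c - fim f k * s + X) = (f x - X) - (fre f k * c - fim f k * s) by ring.
  exact: ler_normB.
lra.
Qed.

Variables (psi : R -> R) (beta : R).
Hypothesis psiM : classM psi.

Section Class.
Variables f phi : R -> R.
Hypothesis f1 : inL1 f.
Hypothesis fphi : is_psi_beta_deriv psi beta f phi.
Hypothesis phi1 : (\int[mu]_(x in I) (`|phi x|)%:E <= 1)%E.
Let th := beta * pi / 2.

(** The defining relation rotates the coefficient of f by the angle [th]; the inverse rotation
    solves it for that coefficient. *)
Lemma class_coef (k : nat) : (0 < k)%N ->
  fre f k%:Z = psi k%:R * (fre phi k%:Z * cos th + fim phi k%:Z * sin th) /\
  fim f k%:Z = psi k%:R * (fim phi k%:Z * cos th - fre phi k%:Z * sin th).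
Proof.
move=> k0; have [_ H] := fphi.
have kz : k%:Z != 0 by rewrite eqz_nat -lt0n.
have := H k%:Z kz; rewrite gtr0_sg ?ltz_nat // mulr1 => -[-> ->].
have -> : psi (`|k%:Z|%:~R) = psi k%:R by [].
have pk : psi k%:R != 0 by rewrite lt0r_neq0 // classM_gt0 // ler1n.
have := sin2cos2 th; rewrite -/th; set c := cos th; set s := sin th => sc.
have E : s ^+ 2 + c ^+ 2 = 1 by rewrite sc; ring.
split.
  transitivity (fre f k * (s ^+ 2 + c ^+ 2)); first by rewrite E mulr1.
  by field.
transitivity (fim f k * (s ^+ 2 + c ^+ 2)); first by rewrite E mulr1.
by field.
Qed.

Lemma class_phi_coef_le k : `|fre phi k%:Z| <= 1 /\ `|fim phi k%:Z| <= 1.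
Proof.
have [phiL _] := fphi.
have iphi := inL1_integrable phiL.
have H th' : `|2 * pi * (fre phi k%:Z * cos th' - fim phi k%:Z * sin th')| <= 1.
  rewrite -fourier_coef //.
  have ic : mu.-integrable I (EFin \o (fun x => phi x * cos (k%:R * x - th'))).
    by apply: integrable_mul_continuous iphi _; exact: cos_affine_continuous.
  apply: le_trans (normr_Rintegral_le ic) _; rewrite -lee_fin.
  have icn : mu.-integrable I (EFin \o (fun x => `|phi x * cos (k%:R * x - th')|)).
    exact: integrable_norm.
  rewrite (EFin_Rintegral icn); apply: le_trans phi1.
  apply: (ge0_le_integral mu mI) => //.
  - by have /integrableP[] := icn.
  - by have /integrableP[] := integrable_norm iphi.
  - by move=> x _; rewrite lee_fin normrM ler_piMr // cos_max.
have p2 : 1 <= 2 * pi :> R by have := pi_ge2 R; lra.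
have aux (z : R) : `|2 * pi * z| <= 1 -> `|z| <= 1.
  rewrite normrM [`|2 * pi|]ger0_norm; last by lra.
  move=> h; apply: le_trans h; rewrite ler_peMl //.
split.
  by have := H 0; rewrite cos0 sin0 mulr0 subr0 mulr1; exact: aux.
by have := H (pi / 2); rewrite cos_pihalf sin_pihalf mulr0 mulr1 sub0r mulrN normrN; exact: aux.
Qed.

Lemma class_coef_le (k : nat) : (0 < k)%N ->
  `|fre f k%:Z| + `|fim f k%:Z| <= 4 * psi k%:R.
Proof.
move=> k0; have [-> ->] := class_coef k0.
have [a1 b1] := class_phi_coef_le k.
have pk : 0 < psi k%:R by apply: classM_gt0; rewrite ?ler1n.
rewrite !normrM (gtr0_norm pk) -mulrDr [4 * _]mulrC ler_pM2l //.
have ac (a c : R) : `|a| <= 1 -> `|c| <= 1 -> `|a * c| <= 1.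
  by move=> ha hc; rewrite normrM -[1]mulr1 ler_pM.
have h1 := le_trans (ler_normD _ _) (lerD (ac _ _ a1 (cos_max th)) (ac _ _ b1 (sin_max th))).
have h2 := le_trans (ler_normB _ _) (lerD (ac _ _ b1 (cos_max th)) (ac _ _ a1 (sin_max th))).
by have := lerD h1 h2; lra.
Qed.

(** The factor pi collects the 2 of [harmonic_term] and the 2 pi of [fourier_coef]; the phase [th]
    of the kernel undoes the rotation of the derivative. *)
Lemma class_tail_conv (n N : nat) (x : R) : (0 < n)%N ->
  pi * (\sum_(i < N) harmonic_term f (n + i) x) =
  Rintegral mu I (fun t => phi t * cossum (fun i => psi (n + i)%:R) n N th (x - t)).
Proof.
move=> n0; have [phiL _] := fphi; have iphi := inL1_integrable phiL.
pose g i (t : R) := psi (n + i)%:R * cos ((n + i)%:R * t - ((n + i)%:R * x - th)).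
have cg i : continuous (g i).
  by apply: continuous_cmul_fun; exact: cos_affine_continuous.
have -> : (fun t => phi t * cossum (fun i => psi (n + i)%:R) n N th (x - t)) =
    (fun t => phi t * \sum_(i < N) g i t).
  apply/funext => t; congr (_ * _); apply: eq_bigr => i _; congr (_ * _).
  by rewrite -cosN; congr cos; ring.
rewrite (Rintegral_mul_sum N iphi cg) mulr_sumr; apply: eq_bigr => i _.
have ic : mu.-integrable I (EFin \o (fun t => phi t * cos ((n + i)%:R * t - ((n + i)%:R * x - th)))).
  by apply: integrable_mul_continuous iphi _; exact: cos_affine_continuous.
have -> : (fun t => phi t * g i t) = (fun t => psi (n + i)%:R *
    (phi t * cos ((n + i)%:R * t - ((n + i)%:R * x - th)))).
  by apply/funext => t; rewrite /g mulrCA.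
rewrite (Rintegral_scale _ ic) fourier_coef // /harmonic_term.
have ni : (0 < n + i)%N by rewrite addn_gt0 n0.
have [-> ->] := class_coef ni.
rewrite cosB sinB; ring.
Qed.

Variable s : R.
Hypothesis s1 : 1 < s.

(** [kernel_Lp] with the sum of the coefficients as height and the largest of them, psi(n), as B.
    The factor pi of the convolution formula is discarded, being at least 1. *)
Lemma class_tail_Lp (n N : nat) (A : R) : (0 < n)%N -> 0 < A ->
  \sum_(i < N) psi (n + i)%:R <= A ->
  (\int[mu]_(x in I) (`|(\sum_(i < N) harmonic_term f (n + i) x)%R| `^ s)%:E <=
   (2 * 2 `^ s * 4 / (s - 1) * (A `^ (s - 1) * psi n%:R))%:E)%E.
Proof.
move=> n0 A0 sumA; have [phiL _] := fphi; have [_ mphi _] := phiL.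
have pos i : 0 < psi (n + i)%:R.
  by apply: classM_gt0; rewrite // ler1n addn_gt0 n0.
have pn : 0 < psi n%:R by have := pos 0%N; rewrite addn0.
have sp : 0 < s by exact: lt_trans ltr01 s1.
pose P := cossum (fun i => psi (n + i)%:R) n N th.
have cP : continuous P by exact: cossum_continuous.
have PA y : `|P y| <= A.
  by apply: le_trans sumA; apply: cossum_norm_le => i _; exact: ltW.
have PB y : `|sin (y / 2)| * `|P y| <= psi n%:R.
  apply: cossum_sin_le; last exact: ltW.
  - move=> i _; rewrite (ltW (pos i)) /=; apply: (classM_decrw psiM).
      by rewrite ler1n.
    by rewrite ler_nat leq_addr.
  - right=> i _; apply: (classM_decrw psiM); first by rewrite ler1n addn_gt0 n0.
    by rewrite ler_nat leq_add2l.
have pP : periodic2pi P.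
  move=> y; apply: eq_bigr => i _; congr (_ * _).
  by rewrite -(@cos_add2pi R (n + i) ((n + i)%:R * y - th)); congr cos; ring.
pose S x := pi * \sum_(i < N) harmonic_term f (n + i) x.
have csum : continuous (fun x => \sum_(i < N) harmonic_term f (n + i) x).
  apply: (@sum_continuous R N (fun i => harmonic_term f (n + i))) => i.
  exact: harmonic_term_continuous.
have cS : continuous S by exact: continuous_cmul_fun.
have ES x : S x = Rintegral mu I (fun t => phi t * P (x - t)) by exact: class_tail_conv.
have Y := young_convolution s1 mphi phi1 cP pP PA cS ES.
have cnP : continuous (fun y => `|P y|).
  by move=> y; apply: continuous_comp; [exact: cP|exact: norm_continuous].
have PA' y : 0 <= `|P y| <= A by rewrite normr_ge0 PA.
have Ker := kernel_Lp s1 A0 pn cnP PA' PB.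
apply: le_trans (le_trans Y Ker).
have mpow (h : R -> R) : continuous h -> measurable_fun I (fun x => (`|h x| `^ s)%:E).
  move=> ch; apply/measurable_EFinP; apply: (measurableT_comp (measurable_powR s)).
  apply: continuous_measurable => x.
  by apply: continuous_comp; [exact: ch|exact: norm_continuous].
apply: (ge0_le_integral mu mI).
- by move=> x _; rewrite lee_fin powR_ge0.
- exact: mpow.
- exact: mpow.
- move=> x _; rewrite lee_fin; apply: ge0_ler_powR; rewrite ?nnegrE ?(ltW sp) //.
  rewrite /S normrM ler_peMl //.
  by rewrite ger0_norm ?pi_ge0 //; have := pi_ge2 R; lra.
Qed.

(** Fatou's lemma along finite tails, which converge to the remainder by inversion. [A1] only
    ensures that convergence and does not enter the bound. *)
Lemma class_rest_Lp (m : nat) (A A1 : R) : 0 < A ->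
  (forall N, \sum_(i < N) psi (m.+1 + i)%:R <= A) ->
  (forall N, \sum_(i < N) psi i.+1%:R <= A1) ->
  (\int[mu]_(x in I)
     (`|(f x - (fre f 0 + \sum_(i < m) harmonic_term f i.+1 x))%R| `^ s)%:E <=
   (2 * 2 `^ s * 4 / (s - 1) * (A `^ (s - 1) * psi m.+1%:R))%:E)%E.
Proof.
move=> A0 sumA sum1; have [_ mf _] := f1.
have sp : 0 < s by exact: lt_trans ltr01 s1.
have csum (n N : nat) : continuous (fun x => \sum_(i < N) harmonic_term f (n + i) x).
  apply: (@sum_continuous R N (fun i => harmonic_term f (n + i))) => i.
  exact: harmonic_term_continuous.
apply: (@fatou_Lp (fun N x => \sum_(i < N) harmonic_term f (m.+1 + i) x)) => //.
- apply: measurable_funTS; apply: measurable_funB => //; apply: continuous_measurable.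
  by apply: (@continuous_add_fun R (fun=> fre f 0)); [exact: cst_continuous|exact: (csum 1%N m)].
- have inv := @fourier_inversion R f (fun k => 4 * psi k.+1%:R) (4 * A1) f1
    (fun k => class_coef_le (ltn0Sn k)).
  have {}inv := inv (fun N => _); have {inv} := inv _.
  move=> /(_ _) H; apply: ae_imply (H _) _ => [N|x Hx Ix].
    by rewrite -mulr_sumr ler_pM2l.
  have := Hx Ix; rewrite -(cvg_shiftn m) => c.
  have -> : (fun N => \sum_(i < N) harmonic_term f (m.+1 + i) x) =
     (fun N => (fre f 0 + \sum_(k < N + m) harmonic_term f k.+1 x) -
               (fre f 0 + \sum_(i < m) harmonic_term f i.+1 x)).
    apply/funext => N; rewrite addnC big_split_ord /=; ring.
  by apply: cvgB => //; exact: cvg_cst.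
- by move=> N; exact: class_tail_Lp.
Qed.

End Class.

Lemma approx_err_measurable (f : R -> R) (g : seq int) : inL1 f ->
  measurable_fun setT (approx_err f g).
Proof.
move=> [_ mf _].
have mc (k th : R) : measurable_fun setT (fun x : R => cos (k * x - th)).
  by apply: continuous_measurable; exact: cos_affine_continuous.
have mcos (k : R) : measurable_fun setT (fun x : R => cos (k * x)).
  by have := mc k 0; under eq_fun do rewrite subr0.
have msin (k : R) : measurable_fun setT (fun x : R => sin (k * x)).
  by have := mc k (pi / 2); under eq_fun do rewrite cosBpihalf.
have mcst (c : R) : measurable_fun [set: R] (fun=> c : R) by exact: measurable_cst.
have msum (h : int -> R -> R) : (forall k, measurable_fun setT (h k)) ->
    measurable_fun setT (fun x => \sum_(k <- g) h k x).
  move=> mh; elim: g => [|k g' IH].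
    by under eq_fun do rewrite big_nil; exact: mcst.
  by under eq_fun do rewrite big_cons; exact: measurable_funD.
have msqrt : measurable_fun setT (@Num.sqrt R).
  by apply: continuous_measurable; exact: sqrt_continuous.
have mre : measurable_fun setT (fun x : R => \sum_(k <- g) (fre f k * cos (k%:~R * x) - fim f k * sin (k%:~R * x))).
  apply: (msum (fun k x => fre f k * cos (k%:~R * x) - fim f k * sin (k%:~R * x))) => k.
  by apply: measurable_funB; apply: measurable_funM.
have mim : measurable_fun setT (fun x : R => \sum_(k <- g) (fre f k * sin (k%:~R * x) + fim f k * cos (k%:~R * x))).
  apply: (msum (fun k x => fre f k * sin (k%:~R * x) + fim f k * cos (k%:~R * x))) => k.
  by apply: measurable_funD; apply: measurable_funM.
apply: (measurableT_comp msqrt); apply: measurable_funD; apply: measurable_funX.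
  exact: measurable_funB.
exact: mim.
Qed.

Lemma powR_add_le (a b s : R) : 0 < s -> 0 <= a -> 0 <= b ->
  (a + b) `^ s <= 2 `^ s * (a `^ s + b `^ s).
Proof.
move=> s0 a0 b0.
wlog ab : a b a0 b0 / a <= b => [H|].
  by case: (leP a b) => h; [exact: H|rewrite addrC [a `^ s + _]addrC; apply: H => //; exact: ltW].
apply: (@le_trans _ _ ((2 * b) `^ s)).
  by apply: ge0_ler_powR; rewrite ?nnegrE ?(ltW s0) ?addr_ge0 ?mulr_ge0 //; lra.
by rewrite powRM // ler_pM2l ?powR_gt0 // lerDr powR_ge0.
Qed.

Lemma pnorm_le (err X : R -> R) (W B s : R) : 0 < s -> 0 <= W -> 0 <= B ->
  measurable_fun setT err -> measurable_fun setT X ->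
  (forall x, 0 <= err x <= `|X x| + W) ->
  (\int[mu]_(x in I) (`|X x| `^ s)%:E <= B%:E)%E ->
  (pnorm s err <= ((2 `^ s * (B + 2 * pi * W `^ s)) `^ s^-1)%:E)%E.
Proof.
move=> s0 W0 B0 merr mX errX XB.
have mXn : measurable_fun setT (fun x => `|X x|) by exact: measurableT_comp.
have mXs : measurable_fun setT (fun x => `|X x| `^ s).
  exact: (measurableT_comp (measurable_powR s) mXn).
have mes : measurable_fun I (fun x => (`|err x| `^ s)%:E).
  apply/measurable_EFinP; apply: (measurableT_comp (measurable_powR s)).
  by apply: measurableT_comp => //; exact: measurable_funTS.
have H : (\int[mu]_(x in I) (`|err x| `^ s)%:E <= (2 `^ s * (B + 2 * pi * W `^ s))%:E)%E.
  apply: (@le_trans _ _ (\int[mu]_(x in I) ((2 `^ s)%:E * ((`|X x| `^ s)%:E + (W `^ s)%:E)))%E).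
    apply: (ge0_le_integral mu mI).
    - by move=> x _; rewrite lee_fin powR_ge0.
    - exact: mes.
    - apply/measurable_EFinP; apply: measurable_funM => //; apply: measurable_funD => //.
      exact: measurable_funTS.
    - move=> x _; rewrite -EFinD -EFinM lee_fin; have /andP[e0 e1] := errX x.
      apply: le_trans (powR_add_le s0 (normr_ge0 (X x)) W0).
      by apply: ge0_ler_powR; rewrite ?nnegrE ?(ltW s0) ?addr_ge0 // ger0_norm.
  have mXE : measurable_fun I (fun x => (`|X x| `^ s)%:E).
    by apply/measurable_EFinP; exact: measurable_funTS.
  have mWE : measurable_fun I (fun=> (W `^ s)%:E) by exact: measurable_cst.
  have X0 x : I x -> (0 <= (`|X x| `^ s)%:E)%E by rewrite lee_fin powR_ge0.
  have Ws0 x : I x -> (0 <= (W `^ s)%:E)%E by rewrite lee_fin powR_ge0.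
  rewrite (ge0_integralZl_EFin mu mI) ?powR_ge0 //; last 2 first.
  - by move=> x _; rewrite -EFinD lee_fin addr_ge0 ?powR_ge0.
  - exact: emeasurable_funD.
  rewrite (ge0_integralD mu mI X0 mXE Ws0 mWE) EFinM.
  apply: lee_wpmul2l; first by rewrite lee_fin powR_ge0.
  rewrite EFinD; apply: leeD => //.
  rewrite (integral_cst mu mI) muleC.
  have -> : (2 * pi * W `^ s)%:E = (mu I * (W `^ s)%:E)%E by rewrite lebesgue_I02pi -EFinM.
  exact: lexx.
rewrite /pnorm -poweR_EFin; apply: gt0_ler_poweR => //.
- by rewrite invr_ge0 ltW.
- rewrite in_itv/= leey andbT; apply: integral_ge0 => x _; by rewrite lee_fin powR_ge0.
- rewrite in_itv/= leey andbT lee_fin mulr_ge0 ?powR_ge0 // addr_ge0 // !mulr_ge0 ?powR_ge0 //.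
  exact: pi_ge0.
Qed.

End FourierTail.

(** * Hoelder's inequality and the Fejer test function *)

Section TestFunction.
Variable R : realType.
Local Notation mu := (@lebesgue_measure R).
Local Notation I := (@I02pi R).
Let mI := @measurable_I02pi R.

Lemma integrable_powR (H : R -> R) (p : R) : 0 < p -> continuous H ->
  mu.-integrable I (EFin \o (fun x => `|H x| `^ p)).
Proof.
move=> p0 cH.
have [M [_ HM]] : [bounded H x | x in I].
  by apply: continuous_bounded_itv => //; rewrite ltW // pi2_gt0.
have i1 : mu.-integrable I (EFin \o (fun=> 1 : R)).
  by apply: continuous_integrable_I; exact: cst_continuous.
have mH : measurable_fun I (fun x => `|H x| `^ p).
  apply: (measurableT_comp (measurable_powR p)); apply: continuous_measurable => x.
  by apply: continuous_comp; [exact: cH|exact: norm_continuous].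
have := @integrable_mul_bounded R (fun=> 1) (fun x => `|H x| `^ p) ((M + 1) `^ p) i1 mH.
have -> : (fun x => 1 * `|H x| `^ p) = (fun x => `|H x| `^ p) by apply/funext => x; rewrite mul1r.
apply=> x Ix; rewrite ger0_norm ?powR_ge0 //.
have h : `|H x| <= M + 1 by apply: HM; rewrite ?ltrDl.
by apply: ge0_ler_powR => //; rewrite ?nnegrE ?(ltW p0) // (le_trans _ h).
Qed.

(** Young's inequality for products is integrated for |H| / x and |G| / y. Taking x and y as
    positive bounds instead of the norms themselves avoids dividing by a norm that may be 0. *)
Lemma hoelder_continuous (H G : R -> R) (p q x y : R) : 0 < p -> 0 < q ->
  p^-1 + q^-1 = 1 -> 0 < x -> 0 < y -> continuous H -> continuous G ->
  Rintegral mu I (fun t => `|H t| `^ p) <= x `^ p ->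
  Rintegral mu I (fun t => `|G t| `^ q) <= y `^ q ->
  Rintegral mu I (fun t => H t * G t) <= x * y.
Proof.
move=> p0 q0 pq x0 y0 cH cG Hx Gy.
have iH := integrable_powR p0 cH; have iG := integrable_powR q0 cG.
have iHG : mu.-integrable I (EFin \o (fun t => H t * G t)).
  by apply: integrable_mul_continuous => //; exact: continuous_integrable_I.
(* Chosen so that the two hypotheses contribute x y / p and x y / q. *)
pose ch := x * y / (x `^ p * p); pose cg := x * y / (y `^ q * q).
have ch0 : 0 <= ch by rewrite divr_ge0 // mulr_ge0 ?powR_ge0 // ltW.
have cg0 : 0 <= cg by rewrite divr_ge0 // mulr_ge0 ?powR_ge0 // ltW.
have i1 : mu.-integrable I (EFin \o (fun t => ch * `|H t| `^ p)) by exact: integrable_scale.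
have i2 : mu.-integrable I (EFin \o (fun t => cg * `|G t| `^ q)) by exact: integrable_scale.
have xn := lt0r_neq0 (powR_gt0 p x0); have yn := lt0r_neq0 (powR_gt0 q y0).
have pw t : H t * G t <= ch * `|H t| `^ p + cg * `|G t| `^ q.
  apply: le_trans (ler_norm _) _; rewrite normrM.
  have := @conjugate_powR R (`|H t| / x) (`|G t| / y) p q.
  move=> /(_ (divr_ge0 (normr_ge0 _) (ltW x0)) (divr_ge0 (normr_ge0 _) (ltW y0)) p0 q0 pq) Y.
  have E (a b z : R) : 0 <= a -> 0 < b -> (a / b) `^ z = a `^ z / b `^ z.
    move=> a0 b0; rewrite powRM ?invr_ge0 ?(ltW b0) //.
    by rewrite -(powR_inv1 (ltW b0)) -powRrM mulN1r powRN.
  rewrite !E // in Y.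
  have xy0 : 0 < x * y by exact: mulr_gt0.
  have -> : `|H t| * `|G t| = x * y * (`|H t| / x * (`|G t| / y)).
    by field; rewrite !lt0r_neq0.
  have -> : ch * `|H t| `^ p + cg * `|G t| `^ q = x * y *
     (`|H t| `^ p / x `^ p / p + `|G t| `^ q / y `^ q / q).
    by rewrite /ch /cg; field; rewrite xn yn !lt0r_neq0.
  by rewrite ler_pM2l.
have L : Rintegral mu I (fun t => H t * G t) <=
    Rintegral mu I (fun t => ch * `|H t| `^ p + cg * `|G t| `^ q).
  by apply: (@le_Rintegral _ _ _ mu I (fun t => H t * G t) (fun t => ch * `|H t| `^ p + cg * `|G t| `^ q) mI) => //; exact: integrable_add.
apply: le_trans L _; rewrite (Rintegral_add i1 i2) (Rintegral_scale _ iH) (Rintegral_scale _ iG).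
apply: le_trans (lerD (ler_wpM2l ch0 Hx) (ler_wpM2l cg0 Gy)) _.
have -> : ch * x `^ p + cg * y `^ q = x * y * (p^-1 + q^-1).
  by rewrite /ch /cg; field; rewrite xn yn !lt0r_neq0.
by rewrite pq mulr1.
Qed.

Lemma cossum_periodic (c : nat -> R) m N th : periodic2pi (cossum c m N th).
Proof.
move=> y; apply: eq_bigr => i _; congr (_ * _).
by rewrite -(@cos_add2pi R (m + i) ((m + i)%:R * y - th)); congr cos; ring.
Qed.

Lemma continuous_inL1 (f : R -> R) : continuous f -> periodic2pi f -> inL1 f.
Proof.
move=> cf pf; split => //; first exact: continuous_measurable.
by have /integrableP[] := continuous_integrable_I cf.
Qed.

Lemma cossum_inL1 (c : nat -> R) m N th : inL1 (cossum c m N th).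
Proof. by apply: continuous_inL1; [exact: cossum_continuous|exact: cossum_periodic]. Qed.

(** Orthogonality leaves the term of frequency k alone, whose index is [k.-1] since the frequencies
    start at 1. *)
Lemma cossum_mul_cos (c : nat -> R) N th (k : nat) tau :
  Rintegral mu I (fun x => cos (k%:R * x - tau) * cossum c 1 N th x) =
  if (0 < k <= N)%N then pi * c k.-1 * cos (th - tau) else 0.
Proof.
pose g i (x : R) := c i * cos ((1 + i)%:R * x - th).
have cg i : continuous (g i).
  by apply: continuous_cmul_fun; exact: cos_affine_continuous.
have ic tau' k' : mu.-integrable I (EFin \o (fun x => cos (k' * x - tau'))).
  by apply: continuous_integrable_I; exact: cos_affine_continuous.
rewrite (Rintegral_mul_sum N (ic _ _) cg).
have term i : Rintegral mu I (fun x => cos (k%:R * x - tau) * g i x) =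
    if i.+1 == k then pi * c i * cos (th - tau) else 0.
  have icc : mu.-integrable I (EFin \o (fun x => cos ((1 + i)%:R * x - th) * cos (k%:R * x - tau))).
    by apply: integrable_mul_continuous => //; exact: cos_affine_continuous.
  have -> : (fun x => cos (k%:R * x - tau) * g i x) =
    (fun x => c i * (cos ((1 + i)%:R * x - th) * cos (k%:R * x - tau))).
    by apply/funext => x; rewrite /g; ring.
  rewrite (Rintegral_scale _ icc) integral_cos_cos // add1n.
  by case: ifP => _; [ring|rewrite mulr0].
under eq_bigr do rewrite term.
case: k {term} => [|k] /=; first by rewrite big1.
case: ifPn => [kN|kN].
  rewrite (bigD1 (Ordinal kN)) //= eqxx big1 ?addr0 // => i ik.
  by rewrite ifN // eqSS; apply: contraNneq ik => ik; apply/eqP/val_inj.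
rewrite big1 // => i _; rewrite ifN // eqSS; apply: contraNneq kN => <-.
exact: ltn_ord.
Qed.

Lemma cossum_coefs (c : nat -> R) N th (k : nat) :
  fre (cossum c 1 N th) k%:Z = (if (0 < k <= N)%N then c k.-1 / 2 else 0) * cos th /\
  fim (cossum c 1 N th) k%:Z = - ((if (0 < k <= N)%N then c k.-1 / 2 else 0) * sin th).
Proof.
have fL := cossum_inL1 c 1 N th.
have pn : pi != 0 :> R by rewrite lt0r_neq0 // pi_gt0.
have H tau : 2 * pi * (fre (cossum c 1 N th) k%:Z * cos tau - fim (cossum c 1 N th) k%:Z * sin tau) =
   if (0 < k <= N)%N then pi * c k.-1 * cos (th - tau) else 0.
  rewrite -fourier_coef // -cossum_mul_cos.
  by apply: eq_Rintegral => x _; rewrite mulrC.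
have H0 := H 0; have H1 := H (pi / 2).
rewrite cos0 sin0 subr0 mulr0 mulr1 subr0 in H0.
rewrite cos_pihalf sin_pihalf mulr0 mulr1 sub0r cosBpihalf in H1.
have aux (u v : R) : 2 * pi * u = pi * v -> u = v / 2.
  by move=> E; apply: (mulfI pn); rewrite [RHS]mulrA -E; field.
split.
  move: H0; case: ifP => _ E; last by apply: (mulfI pn); rewrite mul0r mulr0; lra.
  by rewrite mulrAC; apply: aux; rewrite E mulrA.
move: H1; case: ifP => _ E; last first.
  by apply: (mulfI pn); rewrite mul0r oppr0 mulr0; lra.
rewrite -[LHS]opprK; congr (- _); rewrite mulrAC; apply: aux; rewrite E mulrA //.
Qed.

Variables (psi : R -> R) (beta : R).
Hypothesis psiM : classM psi.
Let th := beta * pi / 2.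

Lemma cossum_psi_deriv (a : nat -> R) N :
  is_psi_beta_deriv psi beta (cossum (fun i => a i * psi i.+1%:R) 1 N th) (cossum a 1 N 0).
Proof.
split; first exact: cossum_inL1.
set f := cossum _ 1 N th; set phi := cossum a 1 N 0.
have fL : inL1 f by exact: cossum_inL1.
have pL : inL1 phi by exact: cossum_inL1.
have psin j : psi j.+1%:R != 0.
  by rewrite lt0r_neq0 //; apply: (classM_gt0 psiM); rewrite ler1n.
have sc : cos th ^+ 2 + sin th ^+ 2 = 1 by exact: cos2Dsin2.
have pos j : fre phi j.+1%:Z = (fre f j.+1%:Z * cos th - fim f j.+1%:Z * sin th) / psi j.+1%:R /\
   fim phi j.+1%:Z = (fre f j.+1%:Z * sin th + fim f j.+1%:Z * cos th) / psi j.+1%:R.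
  have [-> ->] := cossum_coefs a N 0 j.+1.
  have [-> ->] := cossum_coefs (fun i => a i * psi i.+1%:R) N th j.+1.
  rewrite cos0 sin0 /=; have pj := psin j; split.
    case: ifP => _; last by rewrite !mul0r oppr0 mul0r subr0 mul0r.
    transitivity (a j / 2 * (cos th ^+ 2 + sin th ^+ 2)); first by rewrite sc !mulr1.
    by field.
  by case: ifP => _; field.
case=> [[|j]|j] // _.
  have -> : Num.sg j.+1%:Z = 1 by [].
  rewrite mulr1 -/th.
  have -> : psi (`|j.+1%:Z|%:~R) = psi j.+1%:R by [].
  exact: pos.
move=> th0 c.
have -> : th0 = - th by rewrite /th0 NegzE sgrN mulrNz mulrN mulr1.
have -> : c = psi j.+1%:R by rewrite /c NegzE normrN.
rewrite NegzE cosN sinN !freN !fimN //; have [-> ->] := pos j.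
split; [congr (_ / _); ring|by rewrite -mulNr; congr (_ / _); ring].
Qed.

(** The derivative is phi = (F_N - 1) / (4 pi). As F_N >= 0, |phi| <= phi + 1 / (2 pi), and phi has
    mean 0, so the integral of |phi| is at most 1. This is the origin of the factor 1 / (2 pi) in
    [a]. *)
Lemma fejer_class (N : nat) : (0 < N)%N ->
  let a i : R := (1 - i.+1%:R / N%:R) / (2 * pi) in
  Lclass1 psi beta (cossum (fun i => a i * psi i.+1%:R) 1 N th).
Proof.
move=> N0 a; split; first exact: cossum_inL1.
exists (cossum a 1 N 0); split; first exact: cossum_psi_deriv.
have p2 := @pi2_gt0 R.
have pn : pi != 0 :> R by rewrite lt0r_neq0 // pi_gt0.
have phiE x : cossum a 1 N 0 x = (fejer N x - 1) / (4 * pi).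
  have -> : cossum a 1 N 0 x = (2 * pi)^-1 * cossum (fun i => 1 - i.+1%:R / N%:R) 1 N 0 x.
    by rewrite /cossum mulr_sumr; apply: eq_bigr => i _; rewrite /a; ring.
  have aux (P z : R) : P != 0 -> (2 * P)^-1 * z = (1 + 2 * z - 1) / (4 * P).
    by move=> P0; field.
  exact: aux pn.
have int0 : Rintegral mu I (cossum a 1 N 0) = 0.
  transitivity (Rintegral mu I (fun x => cos (0%:R * x - 0) * cossum a 1 N 0 x)).
    by apply: eq_Rintegral => x _; rewrite mul0r subr0 cos0 mul1r.
  exact: (@cossum_mul_cos a N 0 0 0).
have cphi : continuous (cossum a 1 N 0) by exact: cossum_continuous.
split.
  have icphi := continuous_integrable_I cphi.
  have i1 : mu.-integrable I (EFin \o (fun=> (2 * pi)^-1 : R)).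
    by apply: continuous_integrable_I; exact: cst_continuous.
  apply: (@le_trans _ _ (\int[mu]_(x in I) (cossum a 1 N 0 x + (2 * pi)^-1)%:E)%E).
    apply: (ge0_le_integral mu mI).
    - by move=> x _; rewrite lee_fin.
    - by have /integrableP[] := integrable_norm icphi.
    - by have /integrableP[] := integrable_add icphi i1.
    - move=> x _; rewrite lee_fin phiE.
      have F0 := @fejer_ge0 R N x N0.
      have aux (P : R) : P != 0 -> (2 * P)^-1 = 2 / (4 * P) by move=> P0; field.
      rewrite (aux _ pn).
      rewrite -mulrDl normrM [`|(4 * pi)^-1|]ger0_norm; last by rewrite invr_ge0 mulr_ge0 // pi_ge0.
      rewrite ler_pM2r ?invr_gt0 ?mulr_gt0 ?pi_gt0 //.
      by rewrite ler_norml; apply/andP; split; lra.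
  rewrite -(EFin_Rintegral (integrable_add icphi i1)) (Rintegral_add icphi i1).
  by rewrite int0 add0r Rintegral_cst_I mulVf // lt0r_neq0.
have ip : mu.-integrable (@Ipi R) (EFin \o cossum a 1 N 0) by exact: continuous_integrable.
have := periodic_Rintegral (continuous_measurable (D := setT) cphi) (cossum_periodic a 1 N 0).
rewrite int0 /Rintegral => E.
have fin : (\int[mu]_(x in @Ipi R) (cossum a 1 N 0 x)%:E)%E \is a fin_num.
  by apply: integrable_fin_num ip; exact: measurable_itv.
by rewrite -(fineK fin) E.
Qed.

End TestFunction.

(** * Pairing a residual with a weighted cosine sum *)

Section Pairing.
Variable R : realType.
Local Notation mu := (@lebesgue_measure R).
Local Notation I := (@I02pi R).
Let mI := @measurable_I02pi R.

(** F = E - e is nonnegative on S, so its sum over the part of g inside S is at most its sum over S;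
    the constant part e just counts elements. *)
Lemma sum_uniq_diff_ge (T : eqType) (S g : seq T) (E : T -> R) (e : R) :
  uniq S -> uniq g -> 0 <= e -> (forall k, k \in S -> e <= E k) ->
  (forall k, k \notin S -> E k = 0) ->
  e * ((size S)%:R - (size g)%:R) <= \sum_(k <- S) E k - \sum_(k <- g) E k.
Proof.
move=> uS ug e0 ES E0.
pose F k := E k - e.
have sF (s : seq T) : \sum_(k <- s) E k = \sum_(k <- s) F k + e * (size s)%:R.
  have -> : e * (size s)%:R = \sum_(k <- s) e.
    by rewrite big_const_seq count_predT iter_addr_0 mulr_natr.
  by rewrite -big_split /=; apply: eq_bigr => k _; rewrite subrK.
have -> : \sum_(k <- g) E k = \sum_(k <- [seq k <- g | k \in S]) E k.
  rewrite big_filter [LHS](bigID (fun k => k \in S)) /= [X in _ + X]big1 ?addr0 //.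
have FS k : k \in S -> 0 <= F k by move=> kS; rewrite subr_ge0 ES.
have P : perm_eq [seq k <- g | k \in S] [seq k <- S | k \in g].
  by apply: uniq_perm; rewrite ?filter_uniq // => k; rewrite !mem_filter andbC.
have L1 : \sum_(k <- [seq k <- g | k \in S]) F k <= \sum_(k <- S) F k.
  rewrite (perm_big _ P) big_filter [leRHS](bigID (fun k => k \in g)) /= lerDl.
  by rewrite big_seq_cond sumr_ge0 // => k /andP[kS _]; exact: FS.
have L2 : e * (size [seq k <- g | k \in S])%:R <= e * (size g)%:R.
  by rewrite ler_wpM2l // ler_nat size_filter count_size.
by rewrite !sF mulrBr; lra.
Qed.

Lemma sum_sym_freqs (e : nat -> R) M : e 0%N = 0 ->
  \sum_(k <- sym_freqs M) e `|k|%N = 2 * \sum_(i < M) e i.+1.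
Proof.
move=> e0; elim: M => [|M IH]; first by rewrite big_ord0 /= big_seq1 absz0 e0 mulr0.
rewrite [LHS]big_cons big_cons IH big_ord_recr /=; ring.
Qed.

(** The real parts at k and - k agree, so each carries half of the cosine. *)
Lemma cossum_term (c : nat -> R) N th (k : int) x :
  fre (cossum c 1 N th) k * cos (k%:~R * x) - fim (cossum c 1 N th) k * sin (k%:~R * x) =
  (if (0 < `|k| <= N)%N then c `|k|%N.-1 / 2 else 0) * cos (`|k|%N%:R * x - th).
Proof.
have pos (j : nat) : fre (cossum c 1 N th) j%:Z * cos (j%:R * x) - fim (cossum c 1 N th) j%:Z * sin (j%:R * x) =
  (if (0 < j <= N)%N then c j.-1 / 2 else 0) * cos (j%:R * x - th).
  by have [-> ->] := cossum_coefs c N th j; rewrite cosB; ring.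
case: k => j; first exact: pos.
rewrite NegzE freN (fimN _ (cossum_inL1 _ _ _ _)) abszN absz_nat -pos.
have -> : (- j.+1%:Z)%:~R * x = - (j.+1%:R * x) by rewrite mulrNz mulNr.
by rewrite cosN sinN mulrNN.
Qed.

Lemma continuous_mul_fun (f g : R -> R) : continuous f -> continuous g ->
  continuous (fun x => f x * g x).
Proof. by move=> cf cg x; apply: continuousM; [exact: cf|exact: cg]. Qed.

Lemma residual_continuous (c : nat -> R) N th (g : seq int) :
  let f := cossum c 1 N th in
  continuous (fun x => f x - \sum_(k <- g) (fre f k * cos (k%:~R * x) - fim f k * sin (k%:~R * x))).
Proof.
move=> f.
have cf : continuous f by exact: cossum_continuous.
elim: g => [|k g IH]; first by under eq_fun do rewrite big_nil subr0.
have -> : (fun x => f x - \sum_(j <- k :: g) (fre f j * cos (j%:~R * x) - fim f j * sin (j%:~R * x))) =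
   (fun x => (f x - \sum_(j <- g) (fre f j * cos (j%:~R * x) - fim f j * sin (j%:~R * x)))
     + (- (if (0 < `|k| <= N)%N then c `|k|%N.-1 / 2 else 0)) * cos (`|k|%N%:R * x - th)).
  by apply/funext => x; rewrite big_cons /f cossum_term; ring.
apply: continuous_add_fun => //; apply: continuous_cmul_fun.
exact: cos_affine_continuous.
Qed.

(** By orthogonality each frequency k with 0 < |k| <= M contributes e(|k|) / 2, and removing k takes
    exactly this away. Only the real part of the residual is paired, its absolute value being at
    most [approx_err]. *)
Lemma residual_pairing (c w : nat -> R) N M th (g : seq int) : (M <= N)%N ->
  let f := cossum c 1 N th in
  let e k := if (0 < k <= M)%N then pi * c k.-1 * w k.-1 else 0 in
  Rintegral mu I (fun x =>
    (f x - \sum_(k <- g) (fre f k * cos (k%:~R * x) - fim f k * sin (k%:~R * x))) *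
    cossum w 1 M th x) =
  (\sum_(k <- sym_freqs M) e `|k|%N - \sum_(k <- g) e `|k|%N) / 2.
Proof.
move=> MN f e; set G := cossum w 1 M th.
have cG : continuous G by exact: cossum_continuous.
have cf : continuous f by exact: cossum_continuous.
have iG : mu.-integrable I (EFin \o G) by exact: continuous_integrable_I.
have cosG (k : nat) : Rintegral mu I (fun x => cos (k%:R * x - th) * G x) =
    if (0 < k <= M)%N then pi * w k.-1 else 0.
  by rewrite cossum_mul_cos subrr cos0 mulr1.
have icG (k : R) : mu.-integrable I (EFin \o (fun x => cos (k * x - th) * G x)).
  apply: continuous_integrable_I; apply: (continuous_mul_fun _ cG).
  exact: cos_affine_continuous.
pose t k x := (if (0 < `|k| <= N)%N then c `|k|%N.-1 / 2 else 0) * cos (`|k|%N%:R * x - th).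
have it k : mu.-integrable I (EFin \o (fun x => t k x * G x)).
  have := integrable_scale (if (0 < `|k| <= N)%N then c `|k|%N.-1 / 2 else 0) (icG `|k|%N%:R).
  by under eq_fun do rewrite mulrA.
have tG k : Rintegral mu I (fun x => t k x * G x) = e `|k|%N / 2.
  under eq_Rintegral do rewrite -mulrA.
  rewrite (Rintegral_scale _ (icG _)) cosG /e.
  case: `|k|%N => [|j] /=; first by rewrite !mul0r.
  case: (ltnP j M) => jM; last by rewrite mulr0 mul0r.
  by rewrite (leq_trans jM MN); ring.
have fG : Rintegral mu I (fun x => f x * G x) = (\sum_(k <- sym_freqs M) e `|k|%N) / 2.
  rewrite sum_sym_freqs // mulrC mulrA mulVf // mul1r.
  under eq_Rintegral do rewrite mulrC.
  rewrite (Rintegral_mul_sum N iG (g := fun i x => c i * cos ((1 + i)%:R * x - th))); last first.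
    by move=> i; apply: continuous_cmul_fun; exact: cos_affine_continuous.
  have E (i : nat) : Rintegral mu I (fun x => G x * (c i * cos ((1 + i)%:R * x - th))) = e i.+1.
    under eq_Rintegral do rewrite mulrC -mulrA.
    rewrite (Rintegral_scale _ (icG _)) cosG /e /= add1n /=.
    by case: ifP => _; [ring|rewrite mulr0].
  under eq_bigr do rewrite E.
  rewrite -(subnKC MN) big_split_ord /= [X in _ + X]big1 ?addr0 // => i _.
  by rewrite /e /= ltnNge leq_addr.
elim: g => [|k g IH].
  under eq_Rintegral do rewrite big_nil subr0.
  by rewrite big_nil subr0.
have ir : mu.-integrable I (EFin \o (fun x => (f x - \sum_(k <- g) (fre f k * cos (k%:~R * x) - fim f k * sin (k%:~R * x))) * G x)).
  apply: continuous_integrable_I; apply: (continuous_mul_fun _ cG).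
  exact: residual_continuous.
have -> : (fun x => (f x - \sum_(j <- k :: g) (fre f j * cos (j%:~R * x) - fim f j * sin (j%:~R * x))) * G x) =
   (fun x => (f x - \sum_(j <- g) (fre f j * cos (j%:~R * x) - fim f j * sin (j%:~R * x))) * G x
     + (-1) * (t k x * G x)).
  by apply/funext => x; rewrite big_cons cossum_term -/(t k x); ring.
rewrite (Rintegral_add ir (integrable_scale _ (it k))) IH (Rintegral_scale _ (it k)) tG big_cons.
by ring.
Qed.

End Pairing.

(** * The lower estimate by duality *)

Section LowerBound.
Variable R : realType.
Local Notation mu := (@lebesgue_measure R).
Local Notation I := (@I02pi R).
Let mI := @measurable_I02pi R.

Lemma size_nonzero_sym_freqs n : size [seq k <- sym_freqs n | k != 0] = (2 * n)%N.
Proof. by elim: n => //= n ->; rewrite mulnS. Qed.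

Lemma normr_le_sqrt_sum_sqr (a b : R) : `|a| <= Num.sqrt (a ^+ 2 + b ^+ 2).
Proof. by rewrite -sqrtr_sqr ler_wsqrtr // lerDl sqr_ge0. Qed.

(** Refuting an upper bound on the integral supplies that bound as a working hypothesis, in the
    shape that Hoelder's inequality takes. *)
Lemma le_pnorm (s x : R) (err : R -> R) : 0 < s -> 0 <= x ->
  ((\int[mu]_(t in I) (`|err t| `^ s)%:E <= (x `^ s)%:E)%E -> False) ->
  (x%:E <= pnorm s err)%E.
Proof.
move=> s0 x0 H.
have {H} : ((x `^ s)%:E < \int[mu]_(t in I) (`|err t| `^ s)%:E)%E.
  by rewrite ltNge; apply/negP.
move=> /ltW H.
have -> : x%:E = poweR (x `^ s)%:E s^-1.
  by rewrite poweR_EFin -powRrM mulfV ?lt0r_neq0 // powRr1.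
rewrite /pnorm; apply: gt0_ler_poweR => //.
- by rewrite invr_ge0 ltW.
- by rewrite in_itv/= leey andbT lee_fin powR_ge0.
- by rewrite in_itv/= leey andbT; apply: integral_ge0 => t _; rewrite lee_fin powR_ge0.
Qed.

Lemma weight_kernel_Lq (w : nat -> R) (M : nat) th (q A B : R) :
  1 < q -> 0 < A -> 0 < B -> (forall i, (i < M)%N -> 0 <= w i <= B) ->
  (forall i, (i.+1 < M)%N -> w i <= w i.+1) -> \sum_(i < M) w i <= A ->
  Rintegral mu I (fun x => `|cossum w 1 M th x| `^ q) <=
  2 * 2 `^ q * 4 / (q - 1) * (A `^ (q - 1) * B).
Proof.
move=> q1 A0 B0 wB winc wA.
have q0 : 0 < q by exact: lt_trans ltr01 q1.
have cG : continuous (cossum w 1 M th) by exact: cossum_continuous.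
rewrite -lee_fin (EFin_Rintegral (integrable_powR q0 cG)).
apply: (kernel_Lp q1 A0 B0 (P := fun x => `|cossum w 1 M th x|)).
- by move=> x; apply: continuous_comp; [exact: cG|exact: norm_continuous].
- move=> y; rewrite normr_ge0 (le_trans _ wA) //; apply: cossum_norm_le => i iM.
  by have /andP[] := wB i iM.
- by move=> y; apply: cossum_sin_le; [exact: wB|left|exact: ltW].
Qed.

Variables (psi : R -> R) (beta : R).
Hypothesis psiM : classM psi.
Variable s : R.
Hypothesis s1 : 1 < s.

(** q is conjugate to s, and the power 1 / q is the norm bound of the weight kernel at nu = 1, with
    height C and B = C. The 8 is twice the 4 that the counting yields, so the contradiction is
    strict. *)
Definition lower_const (C : R) : R :=
  let q := s / (s - 1) in
  (8 * (2 * 2 `^ q * 4 / (q - 1) * (C `^ (q - 1) * C)) `^ q^-1)^-1.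

(** Only m <= 2n matters for the count of surviving frequencies, which treats 2n - 1 and 2n at
    once. *)
Lemma eperp_class_ge (n m M : nat) (nu C : R) : (0 < n)%N -> (m <= 2 * n)%N ->
  0 < nu -> 0 < C -> n%:R + nu <= M%:R ->
  (forall i, (i < M)%N -> psi n%:R / psi i.+1%:R <= C) ->
  \sum_(i < M) psi n%:R / psi i.+1%:R <= C * nu ->
  ((lower_const C * (psi n%:R * nu `^ (1 - s^-1)))%:E <= eperp_class m s psi beta)%E.
Proof.
move=> n0 mn nu0 C0 nM wC sumw; rewrite /lower_const.
set q := s / (s - 1); set D := 2 * 2 `^ q * 4 / (q - 1) * (C `^ (q - 1) * C).
have s0 : 0 < s by exact: lt_trans ltr01 s1.
have sm1 : 0 < s - 1 by rewrite subr_gt0.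
have q1 : 1 < q by rewrite /q ltr_pdivlMr // mul1r ltrBlDr ltrDl.
have q0 : 0 < q by exact: lt_trans ltr01 q1.
have qm1 : 0 < q - 1 by rewrite subr_gt0.
have D0 : 0 < D by rewrite /D !mulr_gt0 ?powR_gt0 ?invr_gt0.
have conj : s^-1 + q^-1 = 1 by rewrite /q; field; rewrite !lt0r_neq0.
have psi_gt0 k : (0 < k)%N -> 0 < psi k%:R by move=> k0; apply: (classM_gt0 psiM); rewrite ler1n.
have pn := psi_gt0 n n0.
have M0 : (0 < M)%N by rewrite -(ltr0n R) (lt_le_trans _ nM) // addr_gt0 // ltr0n.
pose N := (2 * M)%N; have N0 : (0 < N)%N by rewrite muln_gt0.
pose th := beta * pi / 2.
pose a i : R := (1 - i.+1%:R / N%:R) / (2 * pi).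
pose c i := a i * psi i.+1%:R.
pose w i := psi n%:R / psi i.+1%:R.
pose f := cossum c 1 N th; pose G := cossum w 1 M th.
have fc : Lclass1 psi beta f by exact: (fejer_class beta psiM N0).
have fL : inL1 f by exact: cossum_inL1.
pose x0 := (8 * D `^ q^-1)^-1 * (psi n%:R * nu `^ (1 - s^-1)).
have x00 : 0 < x0 by rewrite /x0 !mulr_gt0 ?invr_gt0 ?mulr_gt0 ?powR_gt0.
apply: (@le_trans _ _ (eperp_f m s f)); last by apply: ereal_sup_ubound; exists f.
apply: le_ereal_inf_tmp => _ [g [ug sg] <-].
apply: le_pnorm => //; first exact: ltW.
move=> Herr.
pose H x := f x - \sum_(k <- g) (fre f k * cos (k%:~R * x) - fim f k * sin (k%:~R * x)).
have cH : continuous H by exact: residual_continuous.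
have cG : continuous G by exact: cossum_continuous.
have HH : Rintegral mu I (fun t => `|H t| `^ s) <= x0 `^ s.
  rewrite -lee_fin (EFin_Rintegral (integrable_powR s0 cH)); apply: le_trans Herr.
  apply: (ge0_le_integral mu mI).
  - by move=> x _; rewrite lee_fin powR_ge0.
  - by have /integrableP[] := integrable_powR s0 cH.
  - apply/measurable_EFinP; apply: (measurableT_comp (measurable_powR s)).
    apply: (measurableT_comp (@normr_measurable R setT)).
    by apply: measurable_funTS; exact: approx_err_measurable.
  - move=> x _; rewrite lee_fin; apply: ge0_ler_powR; rewrite ?nnegrE ?(ltW s0) //.
    by apply: le_trans (ler_norm _); exact: normr_le_sqrt_sum_sqr.
(* The height C nu makes the kernel bound scale as nu^(q-1), and (q - 1) / q = 1 / s. *)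
pose y0 := D `^ q^-1 * nu `^ s^-1.
have y00 : 0 < y0 by rewrite mulr_gt0 ?powR_gt0.
have GG : Rintegral mu I (fun t => `|G t| `^ q) <= y0 `^ q.
  have Cnu : 0 < C * nu by rewrite mulr_gt0.
  have := @weight_kernel_Lq w M th q (C * nu) C q1 Cnu C0.
  have -> : 2 * 2 `^ q * 4 / (q - 1) * ((C * nu) `^ (q - 1) * C) = y0 `^ q.
    rewrite /y0 [RHS]powRM ?powR_ge0 // -!powRrM mulVf ?lt0r_neq0 // powRr1 ?(ltW D0) //.
    have -> : s^-1 * q = q - 1 by rewrite /q; field; rewrite !lt0r_neq0.
    by rewrite powRM ?(ltW C0) ?(ltW nu0) // /D; ring.
  apply.
  - by move=> i iM; rewrite wC // divr_ge0 // ltW // psi_gt0.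
  - move=> i _; rewrite ler_pM2l // lef_pV2 ?posrE ?psi_gt0 //.
    by apply: (classM_decrw psiM); rewrite ?ler1n ?ler_nat.
  - exact: sumw.
have J1 := hoelder_continuous s0 q0 conj x00 y00 cH cG HH GG.
have MN : (M <= N)%N by rewrite leq_pmull.
pose e k := if (0 < k <= M)%N then pi * c k.-1 * w k.-1 else 0.
have J2 : Rintegral mu I (fun x => H x * G x) =
    (\sum_(k <- sym_freqs M) e `|k|%N - \sum_(k <- g) e `|k|%N) / 2.
  exact: residual_pairing.
have e0 : e 0%N = 0 by [].
(* [e] vanishes at frequency 0; the remaining 2M frequencies face at most 2n removals. *)
pose S := [seq k <- sym_freqs M | k != 0].
have ES : \sum_(k <- sym_freqs M) e `|k|%N = \sum_(k <- S) e `|k|%N.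
  rewrite big_filter [LHS](bigID (fun k : int => k != 0)) /= [X in _ + X]big1 ?addr0 //.
  by move=> k; rewrite negbK => /eqP ->.
have szS : size S = (2 * M)%N by exact: size_nonzero_sym_freqs.
have memS k : (k \in S) = (0 < `|k| <= M)%N.
  by rewrite mem_filter mem_sym_freqs absz_gt0.
have aux (P Q T Z : R) : P != 0 -> Q != 0 -> P * (Z / (2 * P) * Q) * (T / Q) = T * (Z / 2).
  by move=> P0 Q0; field; rewrite P0 Q0.
have pi0 : pi != 0 :> R by rewrite lt0r_neq0 // pi_gt0.
(* The product is psi(n) (1 - k / N) / 2, and k <= M = N / 2 keeps the Fejer factor at least 1/2. *)
have eS k : k \in S -> psi n%:R / 4 <= e `|k|%N.
  rewrite memS /e => kM; rewrite kM.
  case: `|k|%N kM => [|i] //= iM.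
  have pi1 := psi_gt0 _ (ltn0Sn i).
  have -> : pi * c i * w i = psi n%:R * ((1 - i.+1%:R / N%:R) / 2).
    rewrite /c /w /a; apply: aux pi0 _; exact: lt0r_neq0.
  rewrite ler_pM2l //.
  have h : i.+1%:R / N%:R <= 1 / 2 :> R.
    by rewrite /N natrM ler_pdivrMr ?mulr_gt0 ?ltr0n // mulrA mulfVK ?mul1r ?ler_nat.
  by lra.
have uS : uniq S by rewrite filter_uniq // sym_freqs_uniq.
have p4 : 0 <= psi n%:R / 4 by rewrite divr_ge0 // ltW.
have eNS k : k \notin S -> e `|k|%N = 0.
  by rewrite memS /e => /negbTE ->.
have := sum_uniq_diff_ge uS ug p4 eS eNS.
rewrite -ES szS sg => J3.
have mn' : m%:R <= 2 * n%:R :> R by rewrite -natrM ler_nat.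
have J4 : psi n%:R / 4 * (2 * nu) <= psi n%:R / 4 * ((2 * M)%:R - m%:R).
  by rewrite ler_wpM2l // natrM; lra.
have xy : x0 * y0 = psi n%:R * nu / 8.
  rewrite /x0 /y0.
  have nuE : nu `^ (1 - s^-1) * nu `^ s^-1 = nu.
    by rewrite -powRD ?subrK ?powRr1 ?(ltW nu0) // oner_eq0.
  rewrite -[in RHS]nuE.
  have d0 := lt0r_neq0 (powR_gt0 q^-1 D0).
  by field.
have pnu : 0 < psi n%:R * nu by rewrite mulr_gt0.
(* By counting the pairing is at least psi(n) nu / 4, by Hoelder's inequality at most psi(n) nu /
   8. *)
rewrite J2 xy in J1.
clear -J1 J3 J4 pnu.
lra.
Qed.

End LowerBound.

(** * The upper estimate by symmetric partial sums *)

Section UpperBound.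
Variable R : realType.
Local Notation mu := (@lebesgue_measure R).
Local Notation I := (@I02pi R).
Let mI := @measurable_I02pi R.
Variables (psi : R -> R) (beta : R).
Hypothesis psiM : classM psi.
Variable s : R.
Hypothesis s1 : 1 < s.

(** Under the s-th root stand the kernel bound for the remainder and the cost (8 psi(n))^s, over a
    period, of one extra frequency; nu >= K expresses the latter as a multiple of nu^(s-1). *)
Definition upper_const (C K : R) : R :=
  (2 `^ s * (2 * 2 `^ s * 4 / (s - 1) * C `^ (s - 1) + 2 * pi * 8 `^ s / K `^ (s - 1))) `^ s^-1.

Lemma eperp_class_le (n m : nat) (nu C K A1 : R) : (0 < n)%N ->
  (m = 2 * n - 1)%N \/ (m = 2 * n)%N -> 0 < K -> K <= nu -> 0 < C ->
  (forall N, \sum_(i < N) psi (n + i)%:R <= C * (psi n%:R * nu)) ->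
  (forall N, \sum_(i < N) psi i.+1%:R <= A1) ->
  (eperp_class m s psi beta <= (upper_const C K * (psi n%:R * nu `^ (1 - s^-1)))%:E)%E.
Proof.
(* From here the index of the statement is [n.+1]: [sym_freqs n] has exactly 2 (n + 1) - 1 elements,
   and the even order adds the single frequency n + 1. *)
case: n => // n _ mE K0 Knu C0 sumC sum1.
have s0 : 0 < s by exact: lt_trans ltr01 s1.
have sm1 : 0 < s - 1 by rewrite subr_gt0.
have nu0 : 0 < nu by exact: lt_le_trans Knu.
have pn : 0 < psi n.+1%:R by apply: (classM_gt0 psiM); rewrite ler1n.
have A0 : 0 < C * (psi n.+1%:R * nu) by rewrite !mulr_gt0.
apply: ge_ereal_sup => _ [f [fL [phi [fphi [phi1 _]]]] <-].
pose X x := f x - (fre f 0 + \sum_(i < n) harmonic_term f i.+1 x).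
(* Twice the coefficient bound 4 psi(n + 1), as charged by [approx_err_cons]. *)
pose W := 8 * psi n.+1%:R.
have W0 : 0 <= W by rewrite mulr_ge0 // ltW.
have [g [ug sg gX]] : exists g : seq int, [/\ uniq g, size g = m &
    forall x, 0 <= approx_err f g x <= `|X x| + W].
  case: mE => ->.
    exists (sym_freqs n); split.
    - exact: sym_freqs_uniq.
    - by rewrite size_sym_freqs mulnS add2n subn1 addn1.
    - by move=> x; rewrite sqrtr_ge0 /= approx_err_sym // lerDl.
  exists (n.+1%:Z :: sym_freqs n); split.
  - by rewrite /= sym_freqs_uniq mem_sym_freqs ltnn.
  - by rewrite /= size_sym_freqs mulnS add2n addn1.
  - move=> x; rewrite sqrtr_ge0 /=; apply: le_trans (approx_err_cons _ _ _ fL) _.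
    have := class_coef_le psiM fphi phi1 (ltn0Sn n).
    by rewrite /W => h; rewrite lerD2l; lra.
have XB := class_rest_Lp psiM fL fphi phi1 s1 A0 sumC sum1.
set B := 2 * 2 `^ s * 4 / (s - 1) * ((C * (psi n.+1%:R * nu)) `^ (s - 1) * psi n.+1%:R) in XB.
have B0 : 0 <= B.
  by rewrite /B !mulr_ge0 ?powR_ge0 ?invr_ge0 ?(ltW sm1) ?(ltW pn).
have mX : measurable_fun setT X.
  have [_ mf _] := fL; apply: measurable_funB => //; apply: continuous_measurable.
  apply: (@continuous_add_fun R (fun=> fre f 0)); first exact: cst_continuous.
  apply: (@sum_continuous R n (fun i => harmonic_term f i.+1)) => i.
  exact: harmonic_term_continuous.
apply: (@le_trans _ _ (pnorm s (approx_err f g))).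
  by apply: ereal_inf_lbound; exists g.
apply: le_trans (pnorm_le s0 W0 B0 (approx_err_measurable g fL) mX gX XB) _.
rewrite lee_fin.
have -> : upper_const C K * (psi n.+1%:R * nu `^ (1 - s^-1)) =
   (2 `^ s * (2 * 2 `^ s * 4 / (s - 1) * C `^ (s - 1) + 2 * pi * 8 `^ s / K `^ (s - 1)) *
     (psi n.+1%:R `^ s * nu `^ (s - 1))) `^ s^-1.
  rewrite [RHS]powRM; last 2 first.
  - rewrite mulr_ge0 ?powR_ge0 // addr_ge0 ?mulr_ge0 ?powR_ge0 ?invr_ge0 ?(ltW sm1) ?pi_ge0 //.
    exact: powR_ge0.
  - by rewrite mulr_ge0 ?powR_ge0.
  congr (_ * _); rewrite powRM ?powR_ge0 // -!powRrM mulfV ?lt0r_neq0 // powRr1 ?(ltW pn) //.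
  by rewrite mulrBl mulfV ?lt0r_neq0 // mul1r.
have T0 : 0 <= 2 `^ s * (B + 2 * pi * W `^ s).
  by rewrite mulr_ge0 ?powR_ge0 // addr_ge0 // mulr_ge0 ?powR_ge0 // mulr_ge0 ?pi_ge0.
have T1 : 2 `^ s * (B + 2 * pi * W `^ s) <=
   2 `^ s * (2 * 2 `^ s * 4 / (s - 1) * C `^ (s - 1) + 2 * pi * 8 `^ s / K `^ (s - 1)) *
     (psi n.+1%:R `^ s * nu `^ (s - 1)).
  rewrite -[leRHS]mulrA ler_pM2l ?powR_gt0 // [leRHS]mulrDl; apply: lerD.
    have -> : psi n.+1%:R `^ s = psi n.+1%:R `^ (s - 1) * psi n.+1%:R.
      by rewrite -[X in _ * X]powRr1 ?(ltW pn) // -powRD ?subrK // (gt_eqF s0).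
    rewrite /B !powRM ?(ltW C0) ?(ltW pn) ?(ltW nu0) ?mulr_ge0 ?(ltW pn) ?(ltW nu0) //.
    by rewrite le_eqVlt; apply/orP; left; apply/eqP; ring.
  rewrite /W powRM ?(ltW pn) //.
  have k0 : 0 < K `^ (s - 1) by exact: powR_gt0.
  have kn : K `^ (s - 1) <= nu `^ (s - 1).
    by apply: ge0_ler_powR; rewrite ?nnegrE ?(ltW sm1) ?(ltW K0) ?(ltW nu0).
  have -> : 2 * pi * 8 `^ s / K `^ (s - 1) * (psi n.+1%:R `^ s * nu `^ (s - 1)) =
    2 * pi * (8 `^ s * psi n.+1%:R `^ s) * (nu `^ (s - 1) / K `^ (s - 1)) by ring.
  rewrite ler_peMr ?mulr_ge0 ?powR_ge0 ?pi_ge0 //.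
  by rewrite ler_pdivlMr // mul1r.
by apply: ge0_ler_powR; rewrite ?nnegrE ?invr_ge0 ?(ltW s0) // (le_trans T0 T1).
Qed.

End UpperBound.

Unset Implicit Arguments.

Theorem theorem3 (R : realType) (s : R) (psi : R -> R) :
  1 < s -> classM2 psi ->
  (forall t, 1 < t -> derivable psi t 1) ->
  {in `]1, +oo[ &, {homo (fun t => psi t / `|derive1 psi t|) : x y / x <= y}} ->
  psi t / `|derive1 psi t| @[t --> +oo] --> +oo ->
  forall beta : R,
  exists C1 C2 : R, 0 < C1 /\ 0 < C2 /\
    forall n : nat, (0 < n)%N ->
      let b := psi n%:R * (eta_psi psi n%:R - n%:R) `^ (1 - s^-1) in
      [/\ ((C1 * b)%:E <= eperp_class (2 * n - 1) s psi beta)%E,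
          (eperp_class (2 * n - 1) s psi beta <= (C2 * b)%:E)%E,
          ((C1 * b)%:E <= eperp_class (2 * n) s psi beta)%E &
          (eperp_class (2 * n) s psi beta <= (C2 * b)%:E)%E].
Proof.
move=> s1 [[psiM [hmu muy]] [K [K0 HK]]] dpsi mono _ beta.
have [Cw Cw0 Hw] := weight_bounds psiM dpsi mono K0 HK.
have [Ct Ct0 Ht] := tail_sum_bound psiM K0 HK hmu muy.
exists (lower_const s Cw), (upper_const s Ct K).
have s0 : 0 < s by exact: lt_trans ltr01 s1.
have sm1 : 0 < s - 1 by rewrite subr_gt0.
split.
  have q1 : 1 < s / (s - 1) by rewrite ltr_pdivlMr // mul1r ltrBlDr ltrDl.
  by rewrite /lower_const invr_gt0 !mulr_gt0 ?powR_gt0 // !mulr_gt0 ?powR_gt0 ?invr_gt0 ?subr_gt0.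
split.
  rewrite powR_gt0 // mulr_gt0 ?powR_gt0 // addr_gt0 //.
    by rewrite !mulr_gt0 ?powR_gt0 ?invr_gt0.
  by rewrite !mulr_gt0 ?powR_gt0 ?invr_gt0 ?powR_gt0 ?pi_gt0.
move=> n n0 b.
have n1 : 1 <= n%:R :> R by rewrite ler1n.
have Kn := HK _ n1; have nu0 := lt_le_trans K0 Kn.
have [M [nM wC sumw]] := Hw n n0.
have lower m : (m <= 2 * n)%N -> ((lower_const s Cw * b)%:E <= eperp_class m s psi beta)%E.
  by move=> mn; exact: (eperp_class_ge beta psiM s1 n0 mn nu0 Cw0 nM wC sumw).
(* The tail bound at index 1 bounds all partial sums of psi, as inversion requires. *)
have sum1 N := Ht 1%N N isT.
have upper m : (m = 2 * n - 1)%N \/ (m = 2 * n)%N ->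
    (eperp_class m s psi beta <= (upper_const s Ct K * b)%:E)%E.
  by move=> mE; exact: (eperp_class_le beta psiM s1 n0 mE K0 Kn Ct0 (fun N => Ht n N n0) sum1).
by split; [apply: lower; exact: leq_subr|apply: upper; left|exact: lower|apply: upper; right].
Qed.
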